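(* Let $n\ge 2$ and $1\le r\le n$. (i) For each constant $H_r$ with $0<H_r\le\frac{n-r}{n}$, there exists, up to translations or reflections, a unique entire rotational $H_r$-graph in $\mathbb{H}^n\times\mathbb{R}$, and it is strictly convex. (ii) For each constant $H_r>\frac{n-r}{n}$, there exists, up to translations or reflections, a unique embedded compact rotational $H_r$-hypersurface in $\mathbb{H}^n\times\mathbb{R}$, and it is strictly convex. Moreover, for constant $H_r>0$: an embedded compact rotational $H_r$-hypersurface in $\mathbb{H}^n\times\mathbb{R}$ must have $H_r>\frac{n-r}{n}$, and an entire rotational $H_r$-graph must have $0<H_r\le\frac{n-r}{n}$.
   Context: $\mathbb{H}^n$ is hyperbolic space and $\mathbb{H}^n\times\mathbb{R}$ has the product metric. For an oriented $n$-dimensional hypersurface with principal curvatures $k_1,\ldots,k_n$, the $r$-mean curvature is $H_r=\binom{n}{r}^{-1}\sum_{i_1<\cdots<i_r}k_{i_1}\cdots k_{i_r}$. An $H_r$-hypersurface (respectively $H_r$-graph) is a hypersurface (respectively vertical graph) with constant $r$-mean curvature $H_r$ (for a suitable choice of unit normal). An entire graph is a vertical graph $\{(p,u(p))\}$ of a function $u$ defined on all of $\mathbb{H}^n$. Rotational means invariant under rotations about a vertical axis $\{o\}\times\mathbb{R}$, $o\in\mathbb{H}^n$, i.e. generated by rotating a curve $t=\lambda(\rho)$ (or such curves glued together), where $\rho$ is the hyperbolic distance to the axis. Translations are vertical translations and horizontal translations (translations of $\mathbb{H}^n$); reflections are through slices $\mathbb{H}^n\times\{t\}$. Compact hypersurfaces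 are connected and without boundary. Strictly convex means that all principal curvatures are positive at every point with respect to the normal orientation. *)

(* Defs.v *)
From HB Require Import structures.
From mathcomp Require Import all_boot all_order all_algebra.
From mathcomp Require Import all_classical all_reals all_analysis.
Set Implicit Arguments.
Unset Strict Implicit.
Unset Printing Implicit Defensive.
Import Order.TTheory GRing.Theory Num.Theory.
Import numFieldNormedType.Exports.
Local Open Scope classical_set_scope.
Local Open Scope ring_scope.

(* H^n is the hyperboloid in Minkowski space R^{n,1} = 'rV[R]_n.+1, whose      *)
(* time-like coordinate is the one of index 0. Hence H^n x R sits in           *)
(* R^{n,1} x R, and carries the metric induced by [ip].                        *)

Section Regularity.
Context {R : realType} {V W : normedModType R}.

Fixpoint Ck (k : nat) (U : set V) (f : V -> W) : Prop :=
  match k with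
  | 0%N => forall x, U x -> {for x, continuous f}
  | k'.+1 => (forall x, U x -> differentiable f x) /\
             (forall v, Ck k' U ('D_v f))
  end.

Definition smooth_on (U : set V) (f : V -> W) := forall k, Ck k U f.

End Regularity.

Section HyperbolicSpace.
Context {R : realType} {n : nat}.

Definition lor (x y : 'rV[R]_n.+1) : R :=
  - (x 0 0 * y 0 0) + \sum_(i < n) x 0 (lift ord0 i) * y 0 (lift ord0 i).

Definition hyp : set 'rV[R]_n.+1 := [set x | lor x x = -1 /\ 0 < x 0 0].

Definition lor_isometry (A : 'M[R]_n.+1) :=
  forall x y, lor (x *m A) (y *m A) = lor x y.

Definition rotation_about (o : 'rV[R]_n.+1) (A : 'M[R]_n.+1) :=
  [/\ lor_isometry A, \det A = 1 & o *m A = o].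

Definition cosh (a : R) : R := (expR a + expR (- a)) / 2.
Definition sinh (a : R) : R := (expR a - expR (- a)) / 2.

(* A is the translation of length a along the geodesic                         *)
(* s |-> cosh s *: p + sinh s *: v; its axis is that geodesic, and it fixes    *)
(* the Lorentz-orthogonal complement of the plane spanned by p and v.          *)
Definition hyp_translation (A : 'M[R]_n.+1) :=
  exists p v a,
    [/\ hyp p, lor p v = 0, lor v v = 1,
        p *m A = cosh a *: p + sinh a *: v /\
        v *m A = sinh a *: p + cosh a *: v
      & forall w, lor p w = 0 -> lor v w = 0 -> w *m A = w].

(* Smoothness of a function on the submanifold H^n; values of u off H^n are    *)
(* irrelevant.                                                                 *)
Definition smooth_on_hyp (u : 'rV[R]_n.+1 -> R) :=
  forall x, hyp x -> exists W (g : 'rV[R]_n.+1 -> R),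
    [/\ open W, W x, smooth_on W g & {in W `&` hyp, g =1 u}].

End HyperbolicSpace.

Section Hypersurfaces.
Context {R : realType} {n : nat}.

Notation E := ('rV[R]_n.+1 * R)%type.

Definition ip (u v : E) : R := lor u.1 v.1 + u.2 * v.2.

Definition HxR : set E := [set p | hyp p.1].

(* Orthogonal projection onto the tangent space of H^n x R at p, using that    *)
(* p.1 is the (time-like) unit normal of the hyperboloid.                      *)
Definition tproj (p u : E) : E := (u.1 + lor p.1 u.1 *: p.1, u.2).

(* Local parametrization of S: an immersion that is a homeomorphism onto an    *)
(* open subset of S.                                                           *)
Definition chart (S : set E) (U : set 'rV[R]_n) (X : 'rV[R]_n -> E) :=
  [/\ open U, smooth_on U X,
      forall a v, U a -> 'D_v X a = 0 -> v = 0,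
      {in U &, injective X}
    & forall U', open U' -> U' `<=` U ->
        exists W, open W /\ X @` U' = S `&` W].

Definition hypersurface (S : set E) :=
  S `<=` HxR /\
  forall p, S p -> exists U X a, [/\ chart S U X, U a & X a = p].

Definition unit_normal (S : set E) (N : E -> E) :=
  {within S, continuous N} /\
  forall p, S p ->
    [/\ lor p.1 (N p).1 = 0, ip (N p) (N p) = 1
      & forall U X a v, chart S U X -> U a -> X a = p ->
          ip ('D_v X a) (N p) = 0].

Definition first_form (X : 'rV[R]_n -> E) (a : 'rV[R]_n) : 'M[R]_n :=
  \matrix_(i, j) ip ('D_(delta_mx 0 i) X a) ('D_(delta_mx 0 j) X a).

(* <nabla_i (d_j X), N>: the Levi-Civita connection of H^n x R is the          *)
(* tangential part of the flat one.                                            *)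
Definition second_form (N : E -> E) (X : 'rV[R]_n -> E) (a : 'rV[R]_n)
    : 'M[R]_n :=
  \matrix_(i, j)
    ip (tproj (X a) ('D_(delta_mx 0 i) ('D_(delta_mx 0 j) X) a)) (N (X a)).

(* Matrix of the shape operator v |-> - nabla_v N in the basis (d_i X).        *)
Definition shape_mx N X a : 'M[R]_n :=
  invmx (first_form X a) *m second_form N X a.

Definition principal_curvatures (S : set E) (N : E -> E) (p : E)
    (k : 'I_n -> R) :=
  exists U X a, [/\ chart S U X, U a, X a = p
    & char_poly (shape_mx N X a) = \prod_i ('X - (k i)%:P)].

Definition mean_curvature (r : nat) (k : 'I_n -> R) : R :=
  'C(n, r)%:R^-1 * \sum_(I : {set 'I_n} | #|I| == r) \prod_(i in I) k i.

Definition Hr_hypersurface (r : nat) (c : R) (S : set E) (N : E -> E) :=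
  [/\ hypersurface S, unit_normal S N
    & forall p, S p -> exists k,
        principal_curvatures S N p k /\ mean_curvature r k = c].

Definition strictly_convex (S : set E) (N : E -> E) :=
  forall p k, S p -> principal_curvatures S N p k -> forall i, 0 < k i.

Definition entire_graph (S : set E) :=
  exists u, smooth_on_hyp u /\ S = [set p | hyp p.1 /\ p.2 = u p.1].

Definition rotational (S : set E) :=
  exists o, hyp o /\
    forall A, rotation_about o A -> forall p, S p -> S (p.1 *m A, p.2).

Definition htrans (A : 'M[R]_n.+1) (p : E) : E := (p.1 *m A, p.2).
Definition vtrans (c : R) (p : E) : E := (p.1, p.2 + c).
Definition slice_reflection (t : R) (p : E) : E := (p.1, 2 * t - p.2).

Definition congruent (S S' : set E) :=
  exists A c, hyp_translation A /\
    (S' = (vtrans c \o htrans A) @` S \/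
     exists t, S' = (slice_reflection t \o vtrans c \o htrans A) @` S).

Definition entire_rotational_Hr_graph r c (S : set E) (N : E -> E) :=
  [/\ Hr_hypersurface r c S N, entire_graph S & rotational S].

Definition compact_rotational_Hr_hypersurface r c (S : set E) (N : E -> E) :=
  [/\ Hr_hypersurface r c S N, compact S, connected S, S !=set0
    & rotational S].

End Hypersurfaces.

(* Main.v *)
(* Write p = (z, t), y = - <z, o> = cosh rho, x = y^2 - 1 = sinh^2 rho. Invariance
   under the rotations about o forces the normal off the axis into the vertical
   plane through the axis, N = (- q (y z - o), w), so that s = q sinh rho and w
   are its radial and vertical components. The directions orthogonal to this
   plane are then principal with curvature q y, and with kappa the curvature of
   the profile the equation H_r = c reads
     (n - r) (q y)^r + r (q y)^(r-1) kappa = n c.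
   It makes
     s^r (sinh rho)^(n-r) - n c \int_0^rho (sinh v)^(n-1) / (cosh v)^(r-1) dv
   constant along profiles, hence off the axis, and this constant is 0 as soon as
   the hypersurface meets the axis. An entire graph does so trivially, a compact
   hypersurface by comparison at an extremal point. Hence q is a function of x
   alone, and w^2 = 1 - h(x) with h(x) = x q(x)^2 increasing from 0 to
   (n c / (n - r))^(2/r) (to infinity if r = n). If c <= (n - r) / n, then h < 1,
   w never vanishes, and the profile is an entire graph. Otherwise h reaches 1 at
   some xs, and the profile, parametrized by w in [-1, 1], closes up to a sphere.
   Both profiles are determined up to a vertical translation and a reflection,
   and q, kappa > 0 gives strict convexity. *)

Require Import Defs.
From HB Require Import structures.
From mathcomp Require Import all_boot all_order all_algebra.
From mathcomp Require Import all_classical all_reals all_analysis.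
From mathcomp Require Import perm ring lra.
Set Implicit Arguments.
Unset Strict Implicit.
Unset Printing Implicit Defensive.
Import Order.TTheory GRing.Theory Num.Theory.
Import numFieldNormedType.Exports.
Local Open Scope classical_set_scope.
Local Open Scope ring_scope.

(** * Differentials and C^k maps *)

Local Opaque derive.

(** The hypotheses supply no profile curve, and the normal is only continuous. The argument
    therefore runs along arbitrary differentiable curves in the hypersurface: the profile direction
    is found inside the tangent space, the normal is shown to be differentiable off the axis, and
    each conserved quantity has zero derivative along every such curve. It is then constant on all
    off-axis points, because axis points are isolated in charts and, as n >= 2, removing a point
    does not disconnect a ball. The variable x = sinh^2 rho is polynomial in the ambient
    coordinates, and the integral rescaled to [0, 1] is smooth for x > -1. Hence q, h and the
    curvature of the profile are smooth across the axis, where rho is not. The value of s^r leaves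
    the sign of s open for even r; that sign is constant and is absorbed by a reflection or by a
    change of w. In the compact case the conserved relation only places S inside a model. That the
    model is exhausted follows because w takes every value in [-1, 1], its extremes lying on the
    axis, and because rotations act transitively at a given radius. *)

Section Differentials.
Context {R : realType}.
Implicit Types V W Z : normedModType R.

(** Pairs differentiability with the values of all directional derivatives, so that the rules below
    compute derivatives without naming ['d f x]. [L] is a bare function; its linearity is recovered
    through [dif_diffE] when needed. *)
Definition dif V W (f : V -> W) (x : V) (L : V -> W) :=
  differentiable f x /\ forall v, 'D_v f x = L v.

Lemma dif_eq V W (f : V -> W) x L L' : dif f x L -> L =1 L' -> dif f x L'.
Proof. by move=> [df dL] e; split=> // v; rewrite dL e. Qed.

Lemma dif_is_diff V W (f : V -> W) x (L : V -> W) :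
  is_diff x f L -> dif f x L.
Proof.
move=> h; have df : differentiable f x by exact: ex_diff.
by split=> // v; rewrite deriveE// diff_val.
Qed.

Lemma is_diff_dif V W (f : V -> W) x L : dif f x L -> is_diff x f L.
Proof.
move=> [df dL]; apply: DiffDef => //.
by apply/funext => v; rewrite -deriveE// dL.
Qed.

Lemma dif_derive V W (f : V -> W) x L v : dif f x L -> 'D_v f x = L v.
Proof. by case. Qed.

Lemma differentiable_dif V W (f : V -> W) x :
  differentiable f x -> dif f x (fun v => 'D_v f x).
Proof. by split. Qed.

Lemma dif_cont V W (f : V -> W) x L : dif f x L -> {for x, continuous f}.
Proof. by move=> [/differentiable_continuous]. Qed.

Lemma dif_diffE V W (f : V -> W) x L : dif f x L -> 'd f x = L :> (V -> W).
Proof. by move=> /is_diff_dif h; rewrite diff_val. Qed.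

Lemma dif_eps V W (f : V -> W) x L : dif f x L ->
  forall e, 0 < e -> \forall y \near x, `|f y - f x - L (y - x)| <= e * `|y - x|.
Proof.
move=> h e e0; have LE := dif_diffE h; case: h => df _.
have /eqaddoP/(_ _ e0) := diff_locally df.
rewrite LE => nx; rewrite (near_shift 0 x).
by apply: filterS nx => y /=; rewrite !fctE /= subr0 addrK opprD addrA.
Qed.

(** The way back from estimates to differentials; it allows changing a function away from the point
    ([dif_near]) and differentiating along lifted curves ([lift_derive]). *)
Lemma eps_dif V W (f : V -> W) x (L : {linear V -> W}) : continuous L ->
  (forall e, 0 < e -> \forall y \near x, `|f y - f x - L (y - x)| <= e * `|y - x|) ->
  dif f x L.
Proof.
move=> cL h.
have e1 : f \o shift x = cst (f x) + L +o_ 0 id.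
  apply/eqaddoP => e e0; rewrite nearE; have := h e e0.
  rewrite (near_shift 0 x) => hx; apply: filterS hx => y /=.
  by rewrite !fctE /= subr0 addrK opprD addrA.
have dL := diff_unique cL e1.
have df : differentiable f x by apply/diff_locallyP; rewrite dL; split.
by split=> // v; rewrite deriveE// dL.
Qed.

Lemma dif_near V W (f g : V -> W) x L :
  (\forall z \near x, f z = g z) -> dif f x L -> dif g x L.
Proof.
move=> fg df; have fgx := nbhs_singleton fg.
have LE := dif_diffE df.
have := @eps_dif _ _ g x ('d f x); rewrite LE; apply.
  by rewrite -LE; apply: diff_continuous; case: df.
move=> e e0; have h := dif_eps df e0.
by apply: filterS2 fg h => y <-; rewrite -fgx.
Qed.

Lemma dif_cst V W (a : W) (x : V) : dif (fun=> a) x (fun=> 0).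
Proof. exact: (dif_is_diff (is_diff_cst a x)). Qed.

Lemma dif_id V (x : V) : dif id x id.
Proof. exact: (dif_is_diff (is_diff_id x)). Qed.

Lemma difD V W (f g : V -> W) x L M :
  dif f x L -> dif g x M -> dif (fun y => f y + g y) x (fun v => L v + M v).
Proof.
move=> /is_diff_dif hf /is_diff_dif hg; exact: (dif_is_diff (is_diffD hf hg)).
Qed.

Lemma difN V W (f : V -> W) x L :
  dif f x L -> dif (fun y => - f y) x (fun v => - L v).
Proof. by move=> /is_diff_dif hf; exact: (dif_is_diff (is_diffN hf)). Qed.

Lemma difB V W (f g : V -> W) x L M :
  dif f x L -> dif g x M -> dif (fun y => f y - g y) x (fun v => L v - M v).
Proof. by move=> hf hg; apply: difD => //; apply: difN. Qed.

Lemma difM V (f g : V -> R) x L M : dif f x L -> dif g x M ->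
  dif (fun y => f y * g y) x (fun v => f x * M v + g x * L v).
Proof.
move=> /is_diff_dif hf /is_diff_dif hg; exact: (dif_is_diff (is_diffM hf hg)).
Qed.

Lemma dif_comp V W Z (f : V -> W) (g : W -> Z) x L M :
  dif f x L -> dif g (f x) M -> dif (fun y => g (f y)) x (fun v => M (L v)).
Proof.
move=> /is_diff_dif hf /is_diff_dif hg; exact: (dif_is_diff (is_diff_comp hf hg)).
Qed.

Lemma dif_lin V W (L : {linear V -> W}) x : continuous L -> dif L x L.
Proof.
move=> cL; have dL : differentiable L x by apply: linear_differentiable.
by split=> // v; rewrite deriveE// diff_lin.
Qed.

Lemma dif_linear V W (L : V -> W) x : linear L -> continuous L -> dif L x L.
Proof.
move=> lL cL.
pose LL := GRing.isLinear.Build R V W *:%R L lL.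
pose L' : {linear V -> W} := HB.pack L LL.
exact: (@dif_lin _ _ L').
Qed.

Lemma dif_is_derive (f : R -> R) (x d : R) :
  is_derive x 1 f d <-> dif f x (fun v => v * d).
Proof.
split=> [h|[df dL]]; last first.
  split; first exact/derivable1_diffP.
  by rewrite dL mul1r.
have df : differentiable f x by apply/derivable1_diffP; case: h.
split=> // v; rewrite deriveE// deriv1E; last by case: h.
by rewrite derive1E derive_val.
Qed.

Lemma dif_curve W (f : R -> W) (x : R) d :
  is_derive x 1 f d <-> dif f x (fun v => v *: d).
Proof.
split=> [h|[df dL]]; last first.
  split; first exact/derivable1_diffP.
  by rewrite dL scale1r.
have df : differentiable f x by apply/derivable1_diffP; case: h.
split=> // v; rewrite deriveE// deriv1E; last by case: h.
by rewrite derive1E derive_val.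
Qed.

Lemma dif_comp1 V (f : V -> R) (g : R -> R) x L d :
  dif f x L -> is_derive (f x) 1 g d -> dif (fun y => g (f y)) x (fun v => L v * d).
Proof. by move=> hf /dif_is_derive hg; exact: (dif_comp hf hg). Qed.

Lemma difX V (f : V -> R) k x L : dif f x L ->
  dif (fun y => f y ^+ k) x (fun v => k%:R * f x ^+ k.-1 * L v).
Proof.
move=> hf; elim: k => [|k IH].
  under [X in dif X]eq_fun do rewrite expr0.
  by apply: dif_eq (dif_cst _ _) _ => v; rewrite !mul0r.
under [X in dif X]eq_fun do rewrite exprS.
apply: dif_eq (difM hf IH) _ => v /=.
case: k {IH} => [|k]; first by ring.
rewrite /= [in RHS]mulrSr [f x ^+ k.+1]exprS; ring.
Qed.

Lemma difV V (f : V -> R) x L : f x != 0 -> dif f x L ->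
  dif (fun y => (f y)^-1) x (fun v => - L v / f x ^+ 2).
Proof.
move=> fx0 hf.
have h : is_derive (f x) 1 (fun y : R => y^-1) (- (f x) ^- 2 *: 1).
  by apply: (@is_deriveV _ id).
by apply: dif_eq (dif_comp1 hf h) _ => v; rewrite scaleNr /GRing.scale/= mulr1 mulrN mulNr.
Qed.

Lemma dif_sum V W (I : eqType) (r : seq I) (f : I -> V -> W) x (L : I -> V -> W) :
  (forall i, dif (f i) x (L i)) ->
  dif (fun y => \sum_(i <- r) f i y) x (fun v => \sum_(i <- r) L i v).
Proof.
move=> h; elim: r => [|i r IH].
  under [X in dif X]eq_fun do rewrite big_nil.
  by apply: dif_eq (dif_cst _ _) _ => v; rewrite big_nil.
under [X in dif X]eq_fun do rewrite big_cons.
by apply: dif_eq (difD (h i) IH) _ => v; rewrite big_cons.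
Qed.

Lemma dif_pair V W Z (f : V -> W) (g : V -> Z) x L M :
  dif f x L -> dif g x M -> dif (fun y => (f y, g y)) x (fun v => (L v, M v)).
Proof.
move=> /is_diff_dif hf /is_diff_dif hg; exact: (dif_is_diff (is_diff_pair hf hg)).
Qed.

Lemma dif_fst V W Z (f : V -> W * Z) x L :
  dif f x L -> dif (fun y => (f y).1) x (fun v => (L v).1).
Proof.
move=> hf; apply: dif_comp hf _; apply: dif_linear; first by [].
by move=> z; exact: cvg_fst.
Qed.

Lemma dif_snd V W Z (f : V -> W * Z) x L :
  dif f x L -> dif (fun y => (f y).2) x (fun v => (L v).2).
Proof.
move=> hf; apply: dif_comp hf _; apply: dif_linear; first by [].
by move=> z; exact: cvg_snd.
Qed.

Lemma dif_coord V m n (f : V -> 'M[R]_(m, n)) x L i j :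
  dif f x L -> dif (fun y => f y i j) x (fun v => L v i j).
Proof.
move=> hf; have lL : linear (fun y : 'M[R]_(m, n) => y i j).
  by move=> a u v; rewrite !mxE.
exact: dif_comp hf (dif_linear (f x) lL (@coord_continuous _ _ _ i j)).
Qed.

Lemma dif_scalel V W (f : V -> R) (w : W) x L : dif f x L ->
  dif (fun y => f y *: w) x (fun v => L v *: w).
Proof.
move=> hf; have lL : linear (fun y : R => y *: w).
  by move=> a u v; rewrite scalerDl scalerA.
exact: dif_comp hf (dif_linear (f x) lL (@scalel_continuous _ _ w)).
Qed.

Lemma dif_mx V m n (f : V -> 'M[R]_(m, n)) x (L : V -> 'M[R]_(m, n)) :
  (forall i j, dif (fun y => f y i j) x (fun v => L v i j)) -> dif f x L.
Proof.
move=> h.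
have fE : (fun y => \sum_(p <- index_enum ('I_m * 'I_n)%type)
    f y p.1 p.2 *: delta_mx p.1 p.2) = f.
  apply/funext => y; rewrite [RHS]matrix_sum_delta pair_bigA /=.
  by [].
rewrite -fE; apply: dif_eq.
  by apply: dif_sum => p; apply: dif_scalel; exact: h.
by move=> v; rewrite [RHS]matrix_sum_delta pair_bigA.
Qed.

End Differentials.

(** * Closure properties of C^k maps *)

Section CkTheory.
Context {R : realType}.
Implicit Types V W Z : normedModType R.

Lemma Ck_differentiable V W k (U : set V) (f : V -> W) x :
  Ck k.+1 U f -> U x -> differentiable f x.
Proof. by case=> + _; apply. Qed.

Lemma Ck_derive V W k (U : set V) (f : V -> W) v :
  Ck k.+1 U f -> Ck k U ('D_v f).
Proof. by case=> _; apply. Qed.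

Lemma Ck_ext V W k (U : set V) (f g : V -> W) : open U ->
  (forall x, U x -> f x = g x) -> Ck k U f -> Ck k U g.
Proof.
move=> oU; elim: k f g => [|k IH] f g fg /=.
  move=> cf x Ux; rewrite /prop_for /continuous_at -(fg x Ux).
  apply: cvg_trans (cf x Ux); apply: near_eq_cvg.
  by apply: filterS (open_nbhs_nbhs (conj oU Ux)) => z /fg.
have nfg x : U x -> \forall z \near x, f z = g z.
  by move=> Ux; apply: filterS (open_nbhs_nbhs (conj oU Ux)) => z /fg.
case=> df Df; split=> [x Ux|v].
  by have [] := dif_near (nfg x Ux) (differentiable_dif (df x Ux)).
apply: IH (Df v) => x Ux.
exact/near_eq_derive/nfg.
Qed.

Lemma CkS_Ck V W k (U : set V) (f : V -> W) : Ck k.+1 U f -> Ck k U f.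
Proof.
elim: k f => [|k IH] f /= [df Df]; last by split=> // v; apply: IH; exact: Df.
by move=> x Ux; exact/differentiable_continuous/df.
Qed.

Lemma Ck_sub V W k (U U' : set V) (f : V -> W) : U' `<=` U ->
  Ck k U f -> Ck k U' f.
Proof.
move=> s; elim: k f => [|k IH] f /=; first by move=> h x /s /h.
by move=> [h1 h2]; split=> [x /s /h1//|v]; apply: IH.
Qed.

Lemma Ck_dif V W k (U : set V) (f : V -> W) (L : V -> V -> W) : open U ->
  (forall x, U x -> dif f x (L x)) -> (forall v, Ck k U (fun x => L x v)) ->
  Ck k.+1 U f.
Proof.
move=> oU df DL; split=> [x /df[]//|v].
by apply: Ck_ext (DL v) => // x Ux; have [_ ->] := df x Ux.
Qed.

Lemma Ck_dif1 V W k (U : set V) (f : V -> W) x :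
  Ck k.+1 U f -> U x -> dif f x (fun v => 'D_v f x).
Proof. by move=> h Ux; apply/differentiable_dif/(Ck_differentiable h). Qed.

Lemma Ck_cst V W k (U : set V) (a : W) : open U -> Ck k U (fun=> a).
Proof.
move=> oU; elim: k a => [|k IH] a; first by move=> x _; exact: cvg_cst.
by apply: (Ck_dif oU (fun x _ => dif_cst a x)) => v.
Qed.

Lemma Ck_linear V W k (U : set V) (L : V -> W) : open U ->
  linear L -> continuous L -> Ck k U L.
Proof.
move=> oU lL cL; case: k => [|k]; first by move=> x _; exact: cL.
apply: (Ck_dif oU (fun x _ => dif_linear x lL cL)) => v; exact: Ck_cst.
Qed.

Lemma CkD V W k (U : set V) (f g : V -> W) : open U ->
  Ck k U f -> Ck k U g -> Ck k U (fun x => f x + g x).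
Proof.
move=> oU; elim: k f g => [|k IH] f g hf hg.
  by move=> x Ux; apply: cvgD; [exact: hf|exact: hg].
apply: (Ck_dif oU (fun x Ux => difD (Ck_dif1 hf Ux) (Ck_dif1 hg Ux))) => v.
by apply: IH; exact: Ck_derive.
Qed.

Lemma Ck_comp_linear V W Z k (U : set V) (f : V -> W) (L : W -> Z) : open U ->
  linear L -> continuous L -> Ck k U f -> Ck k U (fun x => L (f x)).
Proof.
move=> oU lL cL; elim: k f => [|k IH] f hf.
  by move=> x Ux; apply: continuous_comp; [exact: hf|exact: cL].
apply: (Ck_dif oU (fun x Ux => dif_comp (Ck_dif1 hf Ux) (dif_linear _ lL cL))).
by move=> v; apply: IH; exact: Ck_derive.
Qed.

Lemma CkN V W k (U : set V) (f : V -> W) : open U ->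
  Ck k U f -> Ck k U (fun x => - f x).
Proof.
move=> oU; apply: (Ck_comp_linear (L := -%R)) => //.
  by move=> a u v; rewrite opprD scalerN.
exact: opp_continuous.
Qed.

Lemma CkB V W k (U : set V) (f g : V -> W) : open U ->
  Ck k U f -> Ck k U g -> Ck k U (fun x => f x - g x).
Proof. by move=> oU hf hg; apply: CkD => //; apply: CkN. Qed.

Lemma CkM V k (U : set V) (f g : V -> R) : open U ->
  Ck k U f -> Ck k U g -> Ck k U (fun x => f x * g x).
Proof.
move=> oU; elim: k f g => [|k IH] f g hf hg.
  by move=> x Ux; apply: cvgM; [exact: hf|exact: hg].
apply: (Ck_dif oU (fun x Ux => difM (Ck_dif1 hf Ux) (Ck_dif1 hg Ux))) => v.
by apply: CkD => //; apply: IH; (exact: CkS_Ck || exact: Ck_derive).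
Qed.

Lemma CkX V k (U : set V) (f : V -> R) m : open U ->
  Ck k U f -> Ck k U (fun x => f x ^+ m).
Proof.
move=> oU hf; elim: m => [|m IH].
  by under [X in Ck _ _ X]eq_fun do rewrite expr0; exact: Ck_cst.
by under [X in Ck _ _ X]eq_fun do rewrite exprS; exact: CkM.
Qed.

Lemma Ck_sum V W k (U : set V) (I : Type) (r : seq I) (P : pred I)
  (f : I -> V -> W) : open U -> (forall i, P i -> Ck k U (f i)) ->
  Ck k U (fun x => \sum_(i <- r | P i) f i x).
Proof.
move=> oU h; elim: r => [|i r IH].
  by under [X in Ck _ _ X]eq_fun do rewrite big_nil; exact: Ck_cst.
have [Pi|nPi] := boolP (P i).
  under [X in Ck _ _ X]eq_fun do rewrite big_cons Pi.
  exact: CkD (h i Pi) IH.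
by under [X in Ck _ _ X]eq_fun do rewrite big_cons (negbTE nPi).
Qed.

(** Outer functions of one real variable suffice. The general chain rule would differentiate [g] in
    the direction ['D_v f x], which moves with [x]; here that derivative factors as a product and
    [CkM] closes the induction. *)
Lemma Ck_comp1 V k (U : set V) (D : set R) (f : V -> R) (g : R -> R) :
  open U -> Ck k U f -> Ck k D g -> (forall x, U x -> D (f x)) ->
  Ck k U (fun x => g (f x)).
Proof.
move=> oU + + UD; elim: k f g UD => [|k IH] f g UD hf hg.
  by move=> x Ux; apply: continuous_comp; [exact: hf|exact/hg/UD].
apply: (Ck_dif oU (fun x Ux => dif_comp (Ck_dif1 hf Ux) (Ck_dif1 hg (UD x Ux)))).
move=> v.
apply: (@Ck_ext _ _ _ _ (fun x => 'D_v f x * 'D_1 g (f x))) => //.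
  move=> x Ux; have [dg _] := Ck_dif1 hg (UD x Ux).
  have [|_ E] := proj1 (dif_is_derive g (f x) ('D_1 g (f x))).
    by apply: derivableP; exact/derivable1_diffP.
  exact/esym/E.
apply: CkM => //; first exact: Ck_derive.
by apply: (IH f ('D_1 g)) => //; [exact: CkS_Ck|exact: Ck_derive].
Qed.

Lemma Ck_derive1 k (D : set R) (f g : R -> R) : open D ->
  (forall x, D x -> is_derive x 1 f (g x)) -> Ck k D g -> Ck k.+1 D f.
Proof.
move=> oD h hg.
apply: (Ck_dif oD (fun x Dx => proj1 (dif_is_derive _ _ _) (h x Dx))) => v.
by apply: CkM => //; exact: Ck_cst.
Qed.

Lemma Ck_scalel V W k (U : set V) (f : V -> R) (w : W) : open U ->
  Ck k U f -> Ck k U (fun x => f x *: w).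
Proof.
move=> oU; apply: (Ck_comp_linear (L := fun y : R => y *: w)) => //.
  by move=> a u v; rewrite scalerDl scalerA.
exact: scalel_continuous.
Qed.

Lemma Ck_mx V m n k (U : set V) (f : V -> 'M[R]_(m, n)) : open U ->
  (forall i j, Ck k U (fun x => f x i j)) -> Ck k U f.
Proof.
move=> oU h.
have fE : (fun y => \sum_(p <- index_enum ('I_m * 'I_n)%type)
    f y p.1 p.2 *: delta_mx p.1 p.2) = f.
  by apply/funext => y; rewrite [RHS]matrix_sum_delta pair_bigA /=.
by rewrite -fE; apply: Ck_sum => // p _; apply: Ck_scalel.
Qed.

Lemma Ck_coord V m n k (U : set V) (f : V -> 'M[R]_(m, n)) i j : open U ->
  Ck k U f -> Ck k U (fun x => f x i j).
Proof.
move=> oU; apply: (Ck_comp_linear (L := fun y : 'M[R]_(m, n) => y i j)) => //.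
  by move=> a u v; rewrite !mxE.
exact: coord_continuous.
Qed.

Lemma Ck_pair V W Z k (U : set V) (f : V -> W) (g : V -> Z) : open U ->
  Ck k U f -> Ck k U g -> Ck k U (fun x => (f x, g x)).
Proof.
move=> oU; elim: k f g => [|k IH] f g hf hg.
  by move=> x Ux; apply: cvg_pair; [exact: hf|exact: hg].
apply: (Ck_dif oU (fun x Ux => dif_pair (Ck_dif1 hf Ux) (Ck_dif1 hg Ux))) => v.
by apply: IH; exact: Ck_derive.
Qed.

Lemma Ck_inv k : Ck k [set x : R | x != 0] (fun x => x^-1).
Proof.
have oD : open [set x : R | x != 0].
  have -> : [set x : R | x != 0] = ~` [set 0].
    by apply/seteqP; split => x /= /eqP.
  exact/closed_openC/accessible_closed_set1/hausdorff_accessible/norm_hausdorff.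
elim: k => [|k IH]; first by move=> x /= x0; exact: inv_continuous.
apply: (@Ck_derive1 _ _ _ (fun x => - (x^-1 * x^-1))) => //.
  move=> x /= x0; apply: is_derive_eq (is_deriveV x0 (is_derive_id x 1)) _.
  by rewrite /GRing.scale/= mulr1 expr2 invfM.
by apply: CkN => //; apply: CkM.
Qed.

Lemma CkV V k (U : set V) (f : V -> R) : open U ->
  (forall x, U x -> f x != 0) -> Ck k U f -> Ck k U (fun x => (f x)^-1).
Proof. by move=> oU f0 hf; apply: Ck_comp1 hf (Ck_inv k) _. Qed.

Lemma Ck_powR k a : Ck k [set x : R | 0 < x] (fun x => x `^ a).
Proof.
have oD : open [set x : R | 0 < x] by exact: open_gt.
elim: k a => [|k IH] a.
  move=> x /= x0; apply: differentiable_continuous.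
  by apply/derivable1_diffP; case: (is_derive1_powR a x0).
apply: (@Ck_derive1 _ _ _ (fun x => a * x `^ (a - 1))) => //.
by apply: CkM => //; exact: Ck_cst.
Qed.

Lemma is_derive1_sqrt (x : R) : 0 < x ->
  is_derive x 1 Num.sqrt (2 * Num.sqrt x)^-1.
Proof.
move=> x0.
have s0 : 0 < Num.sqrt x by rewrite sqrtr_gt0.
have := @is_derive_inverse R (fun y => y ^+ 2) Num.sqrt (2 * Num.sqrt x) (Num.sqrt x).
rewrite sqr_sqrtr ?ltW//; apply.
- near=> y; rewrite sqrtr_sqr ger0_norm//.
  by apply: ltW; near: y; exact: lt_nbhsr.
- by near=> y; exact: exprn_continuous.
- by apply/dif_is_derive; apply: dif_eq (difX 2 (dif_id _)) _ => v /=; rewrite expr1; ring.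
- by rewrite mulf_neq0// ?gt_eqF.
Unshelve. all: by end_near. Qed.

Lemma Ck_sqrt k : Ck k [set x : R | 0 < x] Num.sqrt.
Proof.
have oD : open [set x : R | 0 < x] by exact: open_gt.
elim: k => [|k IH]; first by move=> x _; exact: sqrt_continuous.
apply: (@Ck_derive1 _ _ _ (fun x => (2 * Num.sqrt x)^-1)) => //.
apply: CkV => //; first by move=> x /= x0; rewrite mulf_neq0// gt_eqF// sqrtr_gt0.
by apply: CkM => //; exact: Ck_cst.
Qed.

End CkTheory.

(** * Symmetry of second derivatives *)

Section Schwarz.
Context {R : realType}.
Implicit Types V W : normedModType R.

Lemma is_derive_line V W (f : V -> W) (a v : V) (s : R) L :
  dif f (a + s *: v) L -> is_derive s 1 (fun t : R => f (a + t *: v)) (L v).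
Proof.
move=> hf; apply/dif_curve.
have h1 : dif (fun t : R => a + t *: v) s (fun u => u *: v).
  apply: dif_eq (difD (dif_cst a s) (dif_scalel v (dif_id s))) _ => u /=.
  by rewrite add0r.
apply: dif_eq (dif_comp h1 hf) _ => u /=.
by have := dif_diffE hf => <-; rewrite linearZ.
Qed.

Lemma MVT0 (f : R -> R) (df : R -> R) (h : R) : 0 < h ->
  (forall s, 0 <= s <= h -> is_derive s 1 f (df s)) ->
  exists2 s, 0 <= s <= h & f h - f 0 = h * df s.
Proof.
move=> h0 hd.
have [||s sI ->] := @MVT R f df 0 h h0.
- by move=> s; rewrite in_itv/= => /andP[s0 sh]; apply: hd; rewrite !ltW.
- apply: derivable_within_continuous => s; rewrite in_itv/= => sh.
  by case: (hd s sh).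
- exists s; first by move: sI; rewrite in_itv/= => /andP[s0 sh]; rewrite !ltW.
  by rewrite subr0 mulrC.
Qed.

(** The mean value theorem twice: in [s] for the difference in direction [v], then in [t] for
    ['D_u f]. *)
Lemma second_difference V (U : set V) (f : V -> R) (a u v : V) (h : R) :
  0 < h -> Ck 2 U f ->
  (forall s t, 0 <= s <= h -> 0 <= t <= h -> U (a + s *: u + t *: v)) ->
  exists s t, [/\ 0 <= s <= h, 0 <= t <= h &
    f (a + h *: u + h *: v) - f (a + h *: u) - f (a + h *: v) + f a =
    h ^+ 2 * 'D_v ('D_u f) (a + s *: u + t *: v)].
Proof.
move=> h0 hf hU.
have hh : 0 <= h <= h by rewrite ltW//=.
have h00 : (0 : R) <= 0 <= h by rewrite lexx ltW.
have [s sI e1] : exists2 s, 0 <= s <= h &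
  (f (a + h *: u + h *: v) - f (a + h *: u)) -
  (f (a + 0 *: u + h *: v) - f (a + 0 *: u)) =
  h * ('D_u f (a + s *: u + h *: v) - 'D_u f (a + s *: u)).
  apply: (@MVT0 (fun s => f (a + s *: u + h *: v) - f (a + s *: u))) => // s sI.
  apply: is_deriveB.
    have := @is_derive_line _ _ f (a + h *: v) u s (fun w => 'D_w f (a + s *: u + h *: v)).
    have e t : a + h *: v + t *: u = a + t *: u + h *: v by rewrite addrAC.
    have <- : (fun t : R => f (a + h *: v + t *: u)) = (fun t => f (a + t *: u + h *: v)).
      by apply/funext => t; rewrite e.
    apply; rewrite e.
    exact: Ck_dif1 hf (hU _ _ sI hh).
  apply: (@is_derive_line _ _ f a u s (fun w => 'D_w f (a + s *: u))).
  by apply: (Ck_dif1 hf); have := hU _ _ sI h00; rewrite scale0r addr0.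
have [t tI e2] : exists2 t, 0 <= t <= h &
  'D_u f (a + s *: u + h *: v) - 'D_u f (a + s *: u + 0 *: v) =
  h * 'D_v ('D_u f) (a + s *: u + t *: v).
  have dG t : 0 <= t <= h -> is_derive t 1
      (fun t => 'D_u f (a + s *: u + t *: v)) ('D_v ('D_u f) (a + s *: u + t *: v)).
    move=> tI; have := Ck_dif1 (Ck_derive u hf) (hU _ _ sI tI).
    exact: (@is_derive_line _ _ ('D_u f) (a + s *: u) v t).
  exact: (MVT0 h0 dG).
exists s, t; split=> //.
move: e1 e2; rewrite !scale0r !addr0 => e1 e2.
by rewrite expr2 -mulrA -e2 -e1; ring.
Qed.

(** Exchanging [u] and [v] leaves the second difference unchanged, so a value of one mixed
    derivative close to [a] equals a value of the other close to [a]; continuity does the rest. *)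
Lemma derive_sym V (U : set V) (f : V -> R) (a u v : V) : open U -> U a ->
  Ck 2 U f -> 'D_v ('D_u f) a = 'D_u ('D_v f) a.
Proof.
move=> oU Ua hf.
have c1 : {for a, continuous ('D_v ('D_u f))} by apply: (Ck_derive v (Ck_derive u hf)).
have c2 : {for a, continuous ('D_u ('D_v f))} by apply: (Ck_derive u (Ck_derive v hf)).
apply/eqP; rewrite -subr_eq0 -normr_le0; apply/ler_addgt0Pl => e e0; rewrite addr0.
have e20 : 0 < e / 2 by rewrite divr_gt0.
have nU : nbhs a U by exact: open_nbhs_nbhs.
have /= n1 : \forall t \near a, `|'D_v ('D_u f) t - 'D_v ('D_u f) a| < e / 2.
  exact: cvgr_distC_lt c1 _ e20.
have /= n2 : \forall t \near a, `|'D_u ('D_v f) t - 'D_u ('D_v f) a| < e / 2.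
  exact: cvgr_distC_lt c2 _ e20.
have [d /= d0 dB] := proj1 (nbhs_ballP _ _) (filterI nU (filterI n1 n2)).
(* [h * (|u| + |v|) < d] keeps the whole parallelogram in the ball; the [+ 1] covers [u = v = 0]. *)
pose h := d / (2 * (`|u| + `|v| + 1)).
have uv0 : 0 < `|u| + `|v| + 1 by rewrite ltr_wpDl// addr_ge0.
have h0 : 0 < h by rewrite divr_gt0// mulr_gt0.
have hB s t : 0 <= s <= h -> 0 <= t <= h -> ball a d (a + s *: u + t *: v).
  move=> /andP[s0 sh] /andP[t0 th].
  rewrite -ball_normE /= -addrA opprD addNKr normrN.
  apply: (@le_lt_trans _ _ (h * (`|u| + `|v|))).
    rewrite (le_trans (ler_normD _ _))// !normrZ !ger0_norm// mulrDr.
    by rewrite lerD// ler_wpM2r.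
  apply: (@le_lt_trans _ _ (h * (`|u| + `|v| + 1))).
    by rewrite ler_wpM2l ?ltW// ltrDl.
  rewrite /h invfM mulrA -mulrA mulVf ?gt_eqF// mulr1.
  by rewrite ltr_pdivrMr// mulr_natr mulr2n ltrDl.
have hU s t : 0 <= s <= h -> 0 <= t <= h -> U (a + s *: u + t *: v).
  by move=> sI tI; have [] := dB _ (hB s t sI tI).
have [s1 [t1 [sI tI E1]]] := second_difference h0 hf hU.
have hU' s t : 0 <= s <= h -> 0 <= t <= h -> U (a + s *: v + t *: u).
  by move=> sI' tI'; rewrite addrAC; apply: hU.
have [s2 [t2 [sI' tI' E2]]] := second_difference h0 hf hU'.
have [_ [b1 _]] := dB _ (hB s1 t1 sI tI).
have [_ [_ b2]] := dB _ (hB t2 s2 tI' sI').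
move: E1 E2 b1 b2; rewrite [a + h *: u + h *: v]addrAC [a + t2 *: u + s2 *: v]addrAC.
move: (derive _ _ _) (derive _ a _) (derive _ _ _) (derive _ _ _) => p q p' q'.
move: (f _) (f _) (f _) (f _) => y1 y2 y3 y4 E1 E2 b1 b2.
have E : p' = q'.
  apply: (@mulfI _ (h ^+ 2)); first by rewrite expf_neq0// gt_eqF.
  by rewrite -E1 -E2; ring.
rewrite [leRHS](splitr e) (le_trans (ler_distD p' _ _))//.
by rewrite lerD// ltW// 1?distrC// E.
Qed.

End Schwarz.

Lemma nbhs_open (T : topologicalType) (a : T) (A : set T) : nbhs a A ->
  exists U, [/\ open U, U a & U `<=` A].
Proof. by rewrite nbhsE => -[U [oU Ua] UA]; exists U. Qed.

(** * The Lorentz form and rotations *)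

Section Lorentz.
Context {R : realType} {n : nat}.
Implicit Types (x y z u v e f o p : 'rV[R]_n.+1) (A : 'M[R]_n.+1).

Definition lormx : 'M[R]_n.+1 :=
  diag_mx (\row_j if j == 0 then -1 else 1).

Lemma lorE x y : lor x y = (x *m lormx *m y^T) 0 0.
Proof.
rewrite /lor mxE big_ord_recl mul_mx_diag !mxE eqxx mulrN1 mulNr; congr (_ + _).
by apply: eq_bigr => i _; rewrite !mxE lift_eqF mulr1.
Qed.

Lemma lorC x y : lor x y = lor y x.
Proof.
rewrite /lor mulrC; congr (_ + _); apply: eq_bigr => i _; exact: mulrC.
Qed.

Lemma lorDl x y z : lor (x + y) z = lor x z + lor y z.
Proof. by rewrite !lorE !mulmxDl mxE. Qed.

Lemma lorZl a x z : lor (a *: x) z = a * lor x z.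
Proof. by rewrite !lorE -!scalemxAl mxE. Qed.

Lemma lorNl x z : lor (- x) z = - lor x z.
Proof. by rewrite -scaleN1r lorZl mulN1r. Qed.

Lemma lorDr x y z : lor x (y + z) = lor x y + lor x z.
Proof. by rewrite ![lor x _]lorC lorDl. Qed.

Lemma lorZr a x z : lor x (a *: z) = a * lor x z.
Proof. by rewrite ![lor x _]lorC lorZl. Qed.

Lemma lorNr x z : lor x (- z) = - lor x z.
Proof. by rewrite ![lor x _]lorC lorNl. Qed.

Lemma lor0l x : lor 0 x = 0.
Proof. by rewrite -(scale0r x) lorZl mul0r. Qed.

Lemma lor0r x : lor x 0 = 0.
Proof. by rewrite lorC lor0l. Qed.

Lemma lorBr x y z : lor x (y - z) = lor x y - lor x z.
Proof. by rewrite lorDr lorNr. Qed.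

Definition lorlin := (lorDl, lorDr, lorZl, lorZr, lorNl, lorNr).

Definition tdot x y : R := \sum_(i < n) x 0 (lift ord0 i) * y 0 (lift ord0 i).

Lemma tdot_ge0 x : 0 <= tdot x x.
Proof. by apply: sumr_ge0 => i _; rewrite -expr2 sqr_ge0. Qed.

Lemma tdot_eq0 x : tdot x x = 0 -> forall i, x 0 (lift ord0 i) = 0.
Proof.
move=> /eqP; rewrite psumr_eq0; last by move=> i _; rewrite -expr2 sqr_ge0.
by move=> /allP h i; have := h i (mem_index_enum i); rewrite mulf_eq0 orbb => /eqP.
Qed.

(** Comes from [\sum_i (B x_i - C y_i)^2 = B (A B - C^2)]; when [B = 0] the vector [y] has no
    spatial part and [C = 0]. *)
Lemma tdot_cs x y : tdot x y ^+ 2 <= tdot x x * tdot y y.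
Proof.
set A := tdot x x; set B := tdot y y; set C := tdot x y.
have h : 0 <= B * (A * B - C ^+ 2).
  have -> : B * (A * B - C ^+ 2) = \sum_(i < n)
      (B * x 0 (lift ord0 i) - C * y 0 (lift ord0 i)) ^+ 2.
    transitivity (B ^+ 2 * A - 2 * B * C * C + C ^+ 2 * B); first by ring.
    have -> : B ^+ 2 * A - 2 * B * C * C + C ^+ 2 * B =
      B ^+ 2 * tdot x x + (- (2 * B * C)) * tdot x y + C ^+ 2 * tdot y y.
      by rewrite -/A -/B -/C mulNr.
    clearbody B C; rewrite /tdot !mulr_sumr -!big_split /=.
    by apply: eq_bigr => i _; ring.
  by apply: sumr_ge0 => i _; exact: sqr_ge0.
have [B0|B0] := eqVneq B 0.
  suff -> : C = 0 by rewrite expr0n /= B0 mulr0.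
  by rewrite /C /tdot big1// => i _; rewrite (tdot_eq0 B0) mulr0.
have Bp : 0 < B by rewrite lt_neqAle eq_sym B0 tdot_ge0.
by rewrite pmulr_rge0 // subr_ge0 in h.
Qed.

Lemma lor_tdot x y : lor x y = - (x 0 0 * y 0 0) + tdot x y.
Proof. by []. Qed.

(** Tangent vectors of the hyperboloid are spacelike: orthogonality fixes the time component of [v],
    and Cauchy-Schwarz on the spatial parts bounds [tdot v v] by [x_0^2 * lor v v]. *)
Lemma tangent_ge0 x v : hyp x -> lor x v = 0 ->
  0 <= lor v v /\ (lor v v = 0 -> v = 0).
Proof.
move=> [xx x0]; rewrite !lor_tdot in xx * => xv.
have cs := tdot_cs x v; have tv := tdot_ge0 v.
have txE : tdot x x = x 0 0 ^+ 2 - 1 by rewrite expr2; lra.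
have xvE : tdot x v = x 0 0 * v 0 0 by lra.
have x02 : 0 < x 0 0 ^+ 2 by rewrite exprn_gt0.
have key : tdot v v <= x 0 0 ^+ 2 * (- (v 0 0 * v 0 0) + tdot v v).
  rewrite xvE txE in cs; rewrite -subr_ge0; rewrite -subr_ge0 in cs.
  by apply: le_trans cs _; rewrite le_eqVlt; apply/orP; left; apply/eqP; ring.
split; first by rewrite -(pmulr_rge0 _ x02) (le_trans tv).
move=> v0; rewrite v0 mulr0 in key.
have tv0 : tdot v v = 0 by apply/eqP; rewrite eq_le key tv.
have tl := tdot_eq0 tv0.
apply/rowP => j; rewrite mxE.
case: (unliftP ord0 j) => [i ->|->]; first exact: tl.
move: v0; rewrite tv0 addr0 => /eqP; rewrite oppr_eq0 mulf_eq0 orbb => /eqP.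
by [].
Qed.

Lemma hyp_lor_lt0 x z : hyp x -> hyp z -> lor x z < 0.
Proof.
move=> [xx x0] [zz z0]; rewrite !lor_tdot in xx zz *.
have cs := tdot_cs x z.
have txE : tdot x x = x 0 0 ^+ 2 - 1 by rewrite expr2; lra.
have tzE : tdot z z = z 0 0 ^+ 2 - 1 by rewrite expr2; lra.
rewrite addrC subr_lt0 ltNge; apply/negP => h.
have h2 : (x 0 0 * z 0 0) ^+ 2 <= tdot x z ^+ 2.
  have p0 : 0 <= x 0 0 * z 0 0 by rewrite mulr_ge0// ltW.
  by rewrite ler_pXn2r// nnegrE (le_trans p0).
have tz := tdot_ge0 z; have tx := tdot_ge0 x.
have := le_trans h2 cs; rewrite txE tzE exprMn.
rewrite txE in tx; rewrite tzE in tz.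
move: (x 0 0 ^+ 2) (z 0 0 ^+ 2) tx tz => a b ta tb hh.
nra.
Qed.

(** The number [- lor x z] is the hyperbolic cosine of the distance. The vector [z + lor x z *: x]
    is tangent at [x] with square [lor x z ^+ 2 - 1], which must be nonnegative and vanishes only
    with the vector. *)
Lemma hyp_lor_le x z : hyp x -> hyp z ->
  lor x z <= -1 /\ (lor x z = -1 -> x = z).
Proof.
move=> hx hz; have l0 := hyp_lor_lt0 hx hz.
have xv : lor x (z + lor x z *: x) = 0.
  by rewrite !lorlin; case: hx => -> _; ring.
have vv : lor (z + lor x z *: x) (z + lor x z *: x) = lor x z ^+ 2 - 1.
  rewrite !lorlin [lor z x]lorC; case: hx => -> _; case: hz => -> _; ring.
have [v0 vE] := tangent_ge0 hx xv; rewrite vv in v0 vE.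
split.
  rewrite leNgt; apply/negP => h.
  by nra.
move=> l1; have : z + lor x z *: x = 0 by apply: vE; rewrite l1; ring.
by rewrite l1 scaleN1r => /subr0_eq.
Qed.

Lemma timelike_hyp x z : lor x x = -1 -> hyp z -> lor x z < 0 -> hyp x.
Proof.
move=> xx hz xz; split=> //; rewrite ltNge le_eqVlt; apply/negP => /orP[/eqP x0|x0].
  have := tdot_ge0 x; rewrite lor_tdot x0 mul0r oppr0 add0r in xx.
  by rewrite xx; lra.
have hx : hyp (- x) by split; rewrite ?lorlin ?opprK// mxE oppr_gt0.
have := hyp_lor_lt0 hx hz; rewrite lorlin; lra.
Qed.

Lemma isometry_hyp A z x : lor_isometry A -> hyp z -> hyp (z *m A) -> hyp x ->
  hyp (x *m A).
Proof.
move=> iA hz hzA hx; apply: timelike_hyp hzA _; rewrite iA; first by case: hx.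
exact: hyp_lor_lt0.
Qed.

Lemma mulrow_inj A B : (forall x, x *m A = x *m B) -> A = B.
Proof. by move=> h; apply/row_matrixP => i; rewrite !rowE. Qed.

Lemma isometry_det A : lor_isometry A -> \det A ^+ 2 = 1.
Proof.
move=> iA.
have AJ : A *m lormx *m A^T = lormx.
  apply/matrixP => i j.
  have e (M : 'M[R]_n.+1) k l : M k l = ((delta_mx 0 k : 'rV_n.+1) *m M *m (delta_mx 0 l : 'rV_n.+1)^T) 0 0.
    by rewrite trmx_delta -rowE -colE !mxE.
  rewrite e [RHS]e -!lorE -iA lorE trmx_mul !mulmxA.
  by [].
have dJ : \det lormx != 0.
  rewrite det_diag; apply/prodf_neq0 => i _; rewrite mxE.
  by case: ifP => _; rewrite ?oppr_eq0 oner_eq0.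
have := congr1 determinant AJ; rewrite !det_mulmx det_tr => h.
by apply: (mulfI dJ); rewrite mulr1 -[RHS]h; ring.
Qed.

Lemma isometry_unit A : lor_isometry A -> A \in unitmx.
Proof.
move=> /isometry_det h; rewrite unitmxE unitfE.
by apply/eqP => h0; move: h; rewrite h0 expr0n => /eqP; rewrite eq_sym oner_eq0.
Qed.

Lemma isometry_inv A : lor_isometry A -> lor_isometry (invmx A).
Proof.
move=> iA x y; have uA := isometry_unit iA.
by rewrite -iA -!mulmxA !mulVmx// !mulmx1.
Qed.

Definition lcol x : 'cV[R]_n.+1 := lormx *m x^T.

Lemma mul_lcol x y z : x *m (lcol y *m z) = lor x y *: z.
Proof.
rewrite /lcol !mulmxA [x *m lormx *m y^T]mx11_scalar -lorE.
by rewrite mul_scalar_mx.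
Qed.

(** For Lorentz-orthonormal spacelike [e], [f]: the rotation [f |-> c f + s e], [e |-> c e - s f],
    written as the identity plus rank one terms so that it fixes the orthogonal complement. *)
Definition rotmx e f (c s : R) : 'M[R]_n.+1 :=
  1%:M + (c - 1) *: (lcol f *m f + lcol e *m e) + s *: (lcol f *m e - lcol e *m f).

Lemma mul_rotmx x e f c s : x *m rotmx e f c s =
  x + (c - 1) *: (lor x f *: f + lor x e *: e) + s *: (lor x f *: e - lor x e *: f).
Proof.
by rewrite /rotmx !mulmxDr mulmx1 -!scalemxAr !mulmxDr mulmxN !mul_lcol.
Qed.

Section Rotations.
Variables (o e f : 'rV[R]_n.+1).
Hypotheses (ee : lor e e = 1) (ff : lor f f = 1) (ef : lor e f = 0).
Hypotheses (oe : lor o e = 0) (of_ : lor o f = 0).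

Lemma rotmx_isometry c s : c ^+ 2 + s ^+ 2 = 1 -> lor_isometry (rotmx e f c s).
Proof.
move=> cs x y; rewrite !mul_rotmx !lorlin ee ff ef [lor f e]lorC ef.
rewrite [lor e y]lorC [lor f y]lorC.
move: (lor x e) (lor x f) (lor y e) (lor y f) => a b a' b'.
have : s ^+ 2 = 1 - c ^+ 2 by rewrite -cs; ring.
move=> s2; apply/eqP; rewrite -subr_eq0; apply/eqP.
transitivity ((s ^+ 2 - (1 - c ^+ 2)) * (a * a' + b * b')); first ring.
by rewrite s2 subrr mul0r.
Qed.

Lemma rotmx_mul c s : rotmx e f c s *m rotmx e f c s =
  rotmx e f (c ^+ 2 - s ^+ 2) (2 * c * s).
Proof.
apply: mulrow_inj => x; rewrite mulmxA !mul_rotmx.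
rewrite !lorlin ee ff ef [lor f e]lorC ef.
move: (lor x e) (lor x f) => a b.
apply/rowP => i; rewrite !mxE; ring.
Qed.

(** Makes every plane rotation a square ([rotmx_mul]), hence of determinant 1, since isometries have
    determinant 1 or -1. *)
Lemma half_angle (c s : R) : c ^+ 2 + s ^+ 2 = 1 ->
  exists c' s', [/\ c' ^+ 2 + s' ^+ 2 = 1, c = c' ^+ 2 - s' ^+ 2 & s = 2 * c' * s'].
Proof.
move=> cs; have s20 := sqr_ge0 s.
have c1 : -1 <= c by nra.
have [cm|cm] := eqVneq c (-1).
  exists 0, 1; rewrite cm expr0n expr1n mulr0 mul0r add0r sub0r; split=> //.
  by apply/eqP; rewrite -sqrf_eq0; apply/eqP; move: cs; rewrite cm sqrrN expr1n; lra.
have c10 : 0 < (1 + c) / 2 by rewrite divr_gt0// -ltrBlDl sub0r lt_neqAle eq_sym cm.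
have r0 : 0 < Num.sqrt ((1 + c) / 2) by rewrite sqrtr_gt0.
have r2 : Num.sqrt ((1 + c) / 2) ^+ 2 = (1 + c) / 2 by rewrite sqr_sqrtr// ltW.
exists (Num.sqrt ((1 + c) / 2)), (s / (2 * Num.sqrt ((1 + c) / 2))).
have s2 : (s / (2 * Num.sqrt ((1 + c) / 2))) ^+ 2 = (1 - c) / 2.
  rewrite expr_div_n exprMn r2.
  have -> : s ^+ 2 = (1 - c) * (1 + c) by move: cs => /(canRL (addKr _)) ->; ring.
  by field; rewrite gt_eqF//; lra.
rewrite r2 s2; split; [by field|by field|].
by field; rewrite gt_eqF.
Qed.

Lemma rotmx_rotation c s : c ^+ 2 + s ^+ 2 = 1 ->
  rotation_about o (rotmx e f c s).
Proof.
move=> cs; split; first exact: rotmx_isometry.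
  have [c' [s' [cs' -> ->]]] := half_angle cs.
  by rewrite -rotmx_mul det_mulmx -expr2 isometry_det//; apply: rotmx_isometry.
by rewrite mul_rotmx oe of_ !scale0r addr0 subr0 !scaler0 !addr0.
Qed.

Lemma rotmx_f c s : f *m rotmx e f c s = c *: f + s *: e.
Proof.
rewrite mul_rotmx ff [lor f e]lorC ef !scale0r subr0 addr0 !scale1r.
by apply/rowP => i; rewrite !mxE; ring.
Qed.

End Rotations.

Lemma normalize v : 0 < lor v v -> exists2 a, 0 < a & lor (a *: v) (a *: v) = 1.
Proof.
move=> v0; exists (Num.sqrt (lor v v))^-1; first by rewrite invr_gt0 sqrtr_gt0.
rewrite !lorlin mulrA -invfM -expr2 sqr_sqrtr ?ltW// mulVf// gt_eqF//.
Qed.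

(** A dimension count: two linear conditions on [R^(n+1)] leave a nonzero vector as soon as
    [n >= 2], and orthogonality to [o] makes it spacelike. *)
Lemma unit_orthogonal o f : (2 <= n)%N -> hyp o ->
  exists e, [/\ lor e e = 1, lor o e = 0 & lor e f = 0].
Proof.
move=> n2 ho.
pose M : 'M[R]_(n.+1, 1 + 1) := row_mx (lcol o) (lcol f).
have : kermx M != 0.
  rewrite kermx_eq0 /row_free neq_ltn; apply/orP; left.
  by apply: leq_ltn_trans (rank_leq_col M) _; rewrite addn1 ltnS.
move=> /rowV0Pn [v /sub_kermxP vM v0].
have e x : (v *m lcol x) 0 0 = lor v x by rewrite /lcol mulmxA -lorE.
move: vM; rewrite mul_mx_row -[0]row_mx0 => /eq_row_mx [vo vf].
have {}vo : lor v o = 0 by rewrite -e vo mxE.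
have {}vf : lor v f = 0 by rewrite -e vf mxE.
have [vv0 vvE] := tangent_ge0 ho (etrans (lorC _ _) vo).
have vv : 0 < lor v v by rewrite lt_neqAle vv0 andbT eq_sym; apply: contra_neq v0 => /vvE.
have [a a0 aE] := normalize vv.
by exists (a *: v); rewrite aE !lorlin vf mulr0 lorC vo mulr0.
Qed.

(** Polar coordinates about [o], with [sg] the hyperbolic sine of the distance. At [x = o] no
    direction is distinguished and [f = 0] is returned, which is why its norm is conditional. *)
Lemma polar o x : hyp o -> hyp x ->
  exists f sg, [/\ 0 <= sg, sg ^+ 2 = lor x o ^+ 2 - 1, x = (- lor x o) *: o + sg *: f,
   lor o f = 0 & (sg != 0 -> lor f f = 1)].
Proof.
move=> ho hx; have [oo _] := ho; have [xx _] := hx.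
have [l1 _] := hyp_lor_le hx ho.
have l2 : 0 <= lor x o ^+ 2 - 1 by nra.
have s2 := sqr_sqrtr l2.
set sg := Num.sqrt _ in s2 *.
have [s0|s0] := eqVneq sg 0.
  exists 0, sg; rewrite s0 scale0r addr0 lor0r lexx expr0n; split=> //.
  - by rewrite -s2 s0 expr0n.
  - suff /(hyp_lor_le hx ho).2 -> : lor x o = -1 by rewrite oo opprK scale1r.
    by move: s2; rewrite s0 expr0n /= => h; nra.
  - by rewrite eqxx.
exists (sg^-1 *: (x + lor x o *: o)), sg.
rewrite sqrtr_ge0 -s2 scalerA divff// scale1r !lorlin oo [lor o x]lorC; split=> //.
- by rewrite addrC -addrA scaleNr subrr addr0.
- by ring.
- move=> _; rewrite xx; apply: (@mulfI _ (sg ^+ 2)); first by rewrite expf_neq0.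
  by rewrite mulr1 {2}s2; field.
Qed.

Lemma rotation_id o : rotation_about o 1%:M.
Proof. by split; rewrite ?det1 ?mulmx1// => x y; rewrite !mulmx1. Qed.

Lemma rotation_transitive o x z : (2 <= n)%N -> hyp o -> hyp x -> hyp z ->
  lor x o = lor z o -> exists2 A, rotation_about o A & x *m A = z.
Proof.
move=> n2 ho hx hz xzo.
have [f [sg [sg0 sg2 xE of0 ffE]]] := polar ho hx.
have [g [sg' [sg'0 sg'2 zE og0 ggE]]] := polar ho hz.
have sgE : sg' = sg.
  apply/eqP; rewrite -(@eqrXn2 _ 2)// sg2 sg'2 xzo//.
rewrite {}sgE -xzo in zE ggE.
have [s0|s0] := eqVneq sg 0.
  exists 1%:M; first exact: rotation_id.
  by rewrite mulmx1 xE zE s0 !scale0r.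
have ff := ffE s0; have gg := ggE s0.
pose c := lor f g; pose d := g - c *: f.
have od : lor o d = 0 by rewrite /d !lorlin og0 of0; ring.
have fd : lor d f = 0 by rewrite /d !lorlin ff [lor g f]lorC -/c; ring.
have dd : lor d d = 1 - c ^+ 2 by rewrite /d !lorlin gg ff [lor g f]lorC -/c; ring.
have [dd0 ddE] := tangent_ge0 ho od.
suff [e [s [ee oe ef cs dE]]] : exists e s, [/\ lor e e = 1, lor o e = 0, lor e f = 0,
    c ^+ 2 + s ^+ 2 = 1 & d = s *: e].
  exists (rotmx e f c s); first exact: rotmx_rotation.
  rewrite {1}xE mulmxDl -!scalemxAl rotmx_f// -dE /d.
  have [_ _ ->] := @rotmx_rotation o e f ee ff ef oe of0 c s cs.
  by rewrite [c *: f + _]addrC subrK -zE.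
(* [d = 0] means that [g] is [f] or [- f]; any unit [e] orthogonal to [o] and [f] then spans the
   plane of rotation together with [f], and the sine is 0. *)
have [d0|d0] := eqVneq d 0.
  have [e [ee oe ef]] := unit_orthogonal f n2 ho.
  exists e, 0; rewrite scale0r; split=> //.
  by move: dd; rewrite d0 lor0l expr0n /= => h; rewrite addr0; lra.
have dp : 0 < lor d d by rewrite lt_neqAle dd0 andbT eq_sym; apply: contra_neq d0 => /ddE.
have [a a0 aE] := normalize dp.
exists (a *: d), a^-1; rewrite aE lorZr od lorZl fd !mulr0 scalerA mulVf ?gt_eqF// scale1r.
move: aE; rewrite lorZl lorZr dd => aE; split=> //.
rewrite exprVn; apply: (@mulfI _ (a ^+ 2)); first by rewrite expf_neq0// gt_eqF.
by rewrite mulrDr divff ?expf_neq0 ?gt_eqF// mulr1 -aE; ring.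
Qed.

Definition base_point : 'rV[R]_n.+1 := delta_mx 0 0.

Lemma lor_base x : lor x base_point = - x 0 0.
Proof.
rewrite /lor mxE !eqxx mulr1 big1 ?addr0// => i _.
by rewrite mxE /= mulr0.
Qed.

Lemma hyp_base : hyp base_point.
Proof. by split; rewrite ?lor_base !mxE !eqxx ?ltr01. Qed.

Lemma cosh_sinh (y s : R) : 1 <= y -> 0 <= s -> s ^+ 2 = y ^+ 2 - 1 ->
  exists a, cosh a = y /\ sinh a = s.
Proof.
move=> y1 s0 s2; have ys : 0 < y + s by rewrite ltr_wpDr// (lt_le_trans _ y1).
exists (ln (y + s)); rewrite /cosh /sinh expRN lnK//.
have -> : (y + s)^-1 = y - s.
  apply: (@mulfI _ (y + s)); first by rewrite gt_eqF.
  rewrite divff ?gt_eqF//; transitivity (y ^+ 2 - s ^+ 2); last ring.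
  by rewrite s2; ring.
by split; field.
Qed.

Lemma translation_to o : (2 <= n)%N -> hyp o -> exists A,
  [/\ hyp_translation A, lor_isometry A & base_point *m A = o].
Proof.
move=> n2 ho; have hb := hyp_base; set b := base_point in hb *.
have [bb _] := hb.
suff [v [sg [sg0 sg2 bv vv oE]]] : exists v sg, [/\ 0 <= sg, sg ^+ 2 = lor o b ^+ 2 - 1,
    lor b v = 0, lor v v = 1 & o = (- lor o b) *: b + sg *: v].
  have [l1 _] := hyp_lor_le ho hb.
  have [||a [ca sa]] := @cosh_sinh (- lor o b) sg _ sg0 _; first by lra.
    by rewrite sg2 sqrrN.
  pose c := - lor o b.
  (* The boost in the plane of [b] and [v]. Compared with [rotmx], the term in [lcol b *m b] changes
     sign because [b] is timelike. *)
  pose A : 'M[R]_n.+1 := 1%:M + (c - 1) *: (lcol v *m v - lcol b *m b)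
     + sg *: (lcol v *m b - lcol b *m v).
  have AE x : x *m A = x + (c - 1) *: (lor x v *: v - lor x b *: b) +
     sg *: (lor x v *: b - lor x b *: v).
    by rewrite /A !mulmxDr mulmx1 -!scalemxAr !mulmxDr !mulmxN !mul_lcol.
  have bA : b *m A = o.
    rewrite AE bb bv [RHS]oE -/c.
    by apply/rowP => i; rewrite !mxE; ring.
  exists A; split=> //.
  - exists b, v, a; rewrite ca sa -/c; split=> //.
      split; first by rewrite bA {1}oE.
      rewrite AE vv lorC bv !scale0r !subr0 !scale1r.
      by apply/rowP => i; rewrite !mxE; ring.
    move=> w bw vw; rewrite AE lorC vw lorC bw !scale0r !subr0 !scaler0 !addr0.
    by [].
  - move=> x y; rewrite !AE !lorlin vv bb bv [lor v b]lorC bv [lor v y]lorC [lor b y]lorC.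
    move: (lor x v) (lor x b) (lor y v) (lor y b) => p q p' q'.
    apply/eqP; rewrite -subr_eq0; apply/eqP.
    have s2c : sg ^+ 2 - (c ^+ 2 - 1) = 0 by rewrite sg2 /c sqrrN subrr.
    transitivity ((sg ^+ 2 - (c ^+ 2 - 1)) * (q * q' - p * p')); first ring.
    by rewrite s2c mul0r.
have [f [sg [sg0 sg2 oE bf ffE]]] := polar hb ho.
(* If [o] is the base point itself, the translation is trivial and any unit tangent [v] serves. *)
have [s0|s0] := eqVneq sg 0; last by exists f, sg; split=> //; exact: ffE.
have [e [ee oe _]] := unit_orthogonal 0 n2 hb.
by exists e, sg; split=> //; rewrite s0 scale0r {1}oE s0 scale0r.
Qed.

End Lorentz.

(** * Characteristic polynomials and mean curvatures *)

Section CharPoly.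
Context {F : fieldType}.

(** The matrix determinant lemma, from two block factorizations of [B]. It is stated over a domain
    because [a] will be ['X - k%:P]; the second factorization carries an extra factor [a], cancelled
    at the end. *)
Lemma det_rank1 (K : idomainType) n (a : K) (c : 'cV[K]_n) (l : 'rV[K]_n) :
  (0 < n)%N -> a != 0 ->
  \det (a%:M - c *m l) = a ^+ n.-1 * (a - (l *m c) 0 0).
Proof.
case: n c l => // n c l _ a0 /=.
pose B := block_mx (1%:M : 'M[K]_1) l c (a%:M : 'M[K]_n.+1).
have d1 : \det B = \det (a%:M - c *m l).
  have := congr1 determinant (mulmx_block (1%:M : 'M[K]_1) 0 (- c) (1%:M : 'M[K]_n.+1)
    1%:M l c (a%:M)).
  rewrite det_mulmx det_lblock !det1 !mul1r => ->.
  rewrite !mul1mx !mul0mx !addr0 mulmx1 mulNmx addNr det_ublock det1 mul1r.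
  by rewrite addrC.
have d2 : \det B * a = (a - (l *m c) 0 0) * a ^+ n.+1.
  have := congr1 determinant (mulmx_block (1%:M : 'M[K]_1) l c (a%:M : 'M[K]_n.+1)
    (a%:M : 'M[K]_1) 0 (- c) 1%:M).
  rewrite det_mulmx det_lblock det1 mulr1 det_scalar expr1 -/B => ->.
  rewrite !mul1mx !mulmx0 !mulmx1 add0r mulmxN mulmxN mul_scalar_mx.
  rewrite mul_mx_scalar addrN add0r det_ublock det_scalar.
  by rewrite [_ - _]mx11_scalar det_scalar expr1 !mxE eqxx mulr1n.
by apply: (mulIf a0); rewrite -d1 d2 exprS; ring.
Qed.

Lemma char_poly_rank1 n (k : F) (c : 'cV[F]_n) (l : 'rV[F]_n) : (0 < n)%N ->
  char_poly (k%:M + c *m l) =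
  ('X - k%:P) ^+ n.-1 * ('X - (k + (l *m c) 0 0)%:P).
Proof.
move=> n0; rewrite /char_poly /char_poly_mx.
have -> : 'X%:M - map_mx polyC (k%:M + c *m l) =
    ('X - k%:P)%:M - map_mx polyC c *m map_mx polyC l.
  rewrite map_mxD map_scalar_mx map_mxM opprD addrA; congr (_ - _).
  by rewrite -scalar_mx_is_additive.
rewrite det_rank1 ?polyXsubC_eq0//; congr (_ * _).
by rewrite -map_mxM mxE polyCD opprD addrA.
Qed.

End CharPoly.

Section MeanCurvature.
Context {R : realType} {n : nat}.
Hypothesis n0 : (0 < n)%N.
Implicit Types (k kappa : R) (ks : 'I_n -> R).

Let i0 : 'I_n := Ordinal n0.

Definition two_curvatures k kappa : 'I_n -> R :=
  fun i => if i == i0 then kappa else k.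

Lemma prod_two_curvatures k kappa :
  \prod_i ('X - (two_curvatures k kappa i)%:P) =
  ('X - k%:P) ^+ n.-1 * ('X - kappa%:P) :> {poly R}.
Proof.
rewrite (bigD1 i0)//= mulrC /two_curvatures eqxx; congr (_ * _).
rewrite (eq_bigr (fun=> 'X - k%:P)); last by move=> i /negbTE ->.
rewrite prodr_const; congr (_ ^+ _).
by rewrite cardC1 card_ord.
Qed.

(** Unique factorization: a tuple of principal curvatures is only known through its characteristic
    polynomial, hence up to order. *)
Lemma two_curvatures_perm k kappa ks :
  \prod_i ('X - (ks i)%:P) = ('X - k%:P) ^+ n.-1 * ('X - kappa%:P) ->
  exists s : {perm 'I_n}, forall i, ks i = two_curvatures k kappa (s i).
Proof.
rewrite -prod_two_curvatures => h.
have e (f : 'I_n -> R) : \prod_(x <- [tuple f i | i < n]) ('X - x%:P) = \prod_i ('X - (f i)%:P).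
  by rewrite big_map big_enum.
have /tuple_permP[s sE] : perm_eq [tuple ks i | i < n] [tuple two_curvatures k kappa i | i < n].
  by apply: prod_XsubC_eq; rewrite !e.
exists s => i.
have : tnth [tuple ks i | i < n] i =
  tnth [tuple tnth [tuple two_curvatures k kappa i | i < n] (s i) | i < n] i.
  by congr tnth; apply: val_inj.
by rewrite !tnth_mktuple.
Qed.

Lemma two_curvatures_cases k kappa ks i :
  \prod_i ('X - (ks i)%:P) = ('X - k%:P) ^+ n.-1 * ('X - kappa%:P) ->
  ks i = k \/ ks i = kappa.
Proof.
move=> /two_curvatures_perm[s ->]; rewrite /two_curvatures.
by case: ifP => _; [right|left].
Qed.

Lemma card_sets_avoid m :
  #|[pred I : {set 'I_n} | (#|I| == m) && (i0 \notin I)]| = 'C(n.-1, m).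
Proof.
have e : #|~: [set i0]%SET| = n.-1 by rewrite cardsC1 card_ord.
rewrite -e -cards_draws -[LHS]cardsE; apply: eq_card => I; rewrite !inE andbC.
congr (_ && _); apply/idP/fintype.subsetP => [h i iI|h].
  by rewrite !inE; apply: contraNneq h => <-.
by apply/negP => /h; rewrite !inE eqxx.
Qed.

(** The index sets of size [r] split by membership of the slot [i0], giving ['C(n.-1, r)] products
    [k ^+ r] and ['C(n.-1, r.-1)] products [k ^+ r.-1 * kappa]; multiplying by [n] turns the
    binomials into [n - r] and [r] times ['C(n, r)]. *)
Lemma mean_two_curvatures r k kappa : (1 <= r <= n)%N ->
  n%:R * mean_curvature r (two_curvatures k kappa) =
  (n%:R - r%:R) * k ^+ r + r%:R * (k ^+ r.-1 * kappa).
Proof.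
case/andP; case: r => // r _ rn /=.
rewrite /mean_curvature (bigID (fun I : {set 'I_n} => i0 \in I)) /=.
have c1 : \sum_(I : {set 'I_n} | (#|I| == r.+1) && (i0 \notin I))
    \prod_(i in I) two_curvatures k kappa i = 'C(n.-1, r.+1)%:R * k ^+ r.+1.
  rewrite (eq_bigr (fun=> k ^+ r.+1)).
    by rewrite sumr_const mulr_natl; congr (_ *+ _); exact: card_sets_avoid.
  move=> I /andP[/eqP <- i0I]; rewrite (eq_bigr (fun=> k)) ?prodr_const//.
  by move=> i iI; rewrite /two_curvatures; case: eqP i0I iI => // -> /negbTE ->.
have c2 : \sum_(I : {set 'I_n} | (#|I| == r.+1) && (i0 \in I))
    \prod_(i in I) two_curvatures k kappa i = 'C(n.-1, r)%:R * (k ^+ r * kappa).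
  rewrite (eq_bigr (fun=> k ^+ r * kappa)).
    rewrite sumr_const mulr_natl; congr (_ *+ _).
    have h : (#|[pred I : {set 'I_n} | (#|I| == r.+1) && (i0 \in I)]| +
       #|[pred I : {set 'I_n} | (#|I| == r.+1) && (i0 \notin I)]| = 'C(n, r.+1))%N.
      rewrite -[n in RHS]card_ord -card_draws -[RHS]cardsE.
      rewrite -[RHS](cardID [pred I : {set 'I_n} | i0 \in I]).
      congr (_ + _)%N; apply: eq_card => I; rewrite !inE//.
      by rewrite andbC.
    apply/eqP; rewrite -(eqn_add2r 'C(n.-1, r.+1)) -{1}(card_sets_avoid r.+1) h.
    by rewrite addnC -binS (prednK n0).
  move=> I /andP[/eqP Ir i0I]; rewrite (bigD1 i0)//= {1}/two_curvatures eqxx mulrC.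
  congr (_ * _); rewrite (eq_bigr (fun=> k)).
    rewrite prodr_const; congr (_ ^+ _).
    move: Ir; rewrite (cardD1 i0 I) i0I add1n => -[<-]; apply: eq_card => i.
    by rewrite !inE andbC.
  by move=> i /andP[_ /negbTE]; rewrite /two_curvatures => ->.
rewrite c1 c2.
have C0 : 'C(n, r.+1)%:R != 0 :> R by rewrite pnatr_eq0 -lt0n bin_gt0.
have E1 : n%:R * 'C(n.-1, r)%:R = r.+1%:R * 'C(n, r.+1)%:R :> R.
  by rewrite -!natrM mul_bin_diag.
have E2 : n%:R * 'C(n.-1, r.+1)%:R = (n%:R - r.+1%:R) * 'C(n, r.+1)%:R :> R.
  have -> : 'C(n.-1, r.+1)%:R = 'C(n, r.+1)%:R - 'C(n.-1, r)%:R :> R.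
    by rewrite -{2}(prednK n0) binS natrD addrK.
  by rewrite mulrBr E1 mulrBl.
move: E1 E2 C0; move: ('C(n.-1, r)%:R : R) ('C(n.-1, r.+1)%:R : R) ('C(n, r.+1)%:R : R).
move=> A B C E1 E2 C0; transitivity (C^-1 * (n%:R * A * (k ^+ r * kappa) + n%:R * B * k ^+ r.+1)).
  by ring.
by rewrite E1 E2; field.
Qed.

Lemma mean_curvature_perm r (ks : 'I_n -> R) (s : {perm 'I_n}) :
  mean_curvature r (fun i => ks (s i)) = mean_curvature r ks.
Proof.
rewrite /mean_curvature; congr (_ * _).
rewrite [RHS](reindex_inj (imset_inj (@perm_inj _ s))) /=.
apply: eq_big => [I|I _]; first by rewrite card_imset//; exact: perm_inj.
by rewrite big_imset//= => i j _ _; exact: perm_inj.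
Qed.

Lemma mean_curvature_two r k kappa ks : (1 <= r <= n)%N ->
  \prod_i ('X - (ks i)%:P) = ('X - k%:P) ^+ n.-1 * ('X - kappa%:P) ->
  n%:R * mean_curvature r ks = (n%:R - r%:R) * k ^+ r + r%:R * (k ^+ r.-1 * kappa).
Proof.
move=> rn /two_curvatures_perm[s sE].
rewrite -mean_two_curvatures// -(mean_curvature_perm r (two_curvatures k kappa) s).
by congr (_ * mean_curvature _ _); apply/funext.
Qed.

End MeanCurvature.

(** * Charts and shape operators *)

Section Tangent.
Context {R : realType} {n : nat}.
Notation E := ('rV[R]_n.+1 * R)%type.
Implicit Types (Z : E).

Lemma ipC (Z Z' : E) : ip Z Z' = ip Z' Z.
Proof. by rewrite /ip lorC mulrC. Qed.

Lemma ipDl (Z Z' Z'' : E) : ip (Z + Z') Z'' = ip Z Z'' + ip Z' Z''.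
Proof. by rewrite /ip /= lorDl; ring. Qed.

Lemma ipZl a (Z Z' : E) : ip (a *: Z) Z' = a * ip Z Z'.
Proof. by rewrite /ip /= lorZl /GRing.scale/=; ring. Qed.

Lemma ip0l Z : ip 0 Z = 0.
Proof. by rewrite -(scale0r Z) ipZl mul0r. Qed.

Lemma ip_suml (I : Type) (r : seq I) (P : pred I) (F : I -> E) Z :
  ip (\sum_(i <- r | P i) F i) Z = \sum_(i <- r | P i) ip (F i) Z.
Proof.
elim/big_rec2: _ => [|i a b _ <-]; first exact: ip0l.
exact: ipDl.
Qed.

Lemma dif_lor (V : normedModType R) (f g : V -> 'rV[R]_n.+1) x L M :
  dif f x L -> dif g x M ->
  dif (fun y => lor (f y) (g y)) x (fun v => lor (L v) (g x) + lor (f x) (M v)).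
Proof.
move=> hf hg.
have h1 i : dif (fun y => f y 0 i * g y 0 i) x
   (fun v => f x 0 i * M v 0 i + g x 0 i * L v 0 i).
  by apply: difM; exact: dif_coord.
apply: dif_eq (difD (difN (h1 0)) (dif_sum _ (fun i => h1 (lift ord0 i)))) _ => v.
rewrite big_split /= /lor; set S1 := \sum_(i <- _) _; set S2 := \sum_(i <- _) _.
have -> : \sum_(i < n) L v 0 (lift ord0 i) * g x 0 (lift ord0 i) = S2.
  by apply: eq_bigr => i _; exact: mulrC.
by ring.
Qed.

Lemma dif_lorl (V : normedModType R) (f : V -> 'rV[R]_n.+1) x L z :
  dif f x L -> dif (fun y => lor (f y) z) x (fun v => lor (L v) z).
Proof.
move=> hf; apply: dif_eq (dif_lor hf (dif_cst z x)) _ => v.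
by rewrite lor0r addr0.
Qed.

Lemma dif_ipl (V : normedModType R) (f : V -> E) x L Z :
  dif f x L -> dif (fun y => ip (f y) Z) x (fun v => ip (L v) Z).
Proof.
move=> hf; apply: dif_eq (difD (dif_lorl Z.1 (dif_fst hf)) (difM (dif_snd hf) (dif_cst Z.2 x))) _.
by move=> v; rewrite /ip mulr0 add0r [Z.2 * _]mulrC.
Qed.

Lemma lor_tangent (V : normedModType R) (f : V -> E) x :
  differentiable f x -> (\forall y \near x, hyp (f y).1) ->
  forall v, lor (f x).1 ('D_v f x).1 = 0.
Proof.
move=> /differentiable_dif df hf v.
have h1 := dif_lor (dif_fst df) (dif_fst df).
have h2 : dif (fun y => lor (f y).1 (f y).1) x (fun=> 0).
  by apply: dif_near (dif_cst (-1 : R) x); apply: filterS hf => y [->].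
have := dif_derive v h1; rewrite (dif_derive v h2) lorC.
by move: (lor _ _) => a; lra.
Qed.

Section Span.
Variables (D : {linear 'rV[R]_n -> E}) (x : 'rV[R]_n.+1) (Nv : E).
Hypotheses (hx : hyp x) (Dinj : forall v, D v = 0 -> v = 0).
Hypothesis Dx : forall v, lor x (D v).1 = 0.

Lemma ip_tangent_eq0 Z : lor x Z.1 = 0 -> ip Z Z = 0 -> Z = 0.
Proof.
case: Z => z t /= xz; rewrite /ip /=; have [z0 zE] := tangent_ge0 hx xz.
rewrite -expr2 => /eqP; rewrite paddr_eq0 ?sqr_ge0// sqrf_eq0.
by move=> /andP[/eqP/zE -> /eqP ->].
Qed.

Definition gram : 'M[R]_n :=
  \matrix_(i, j) ip (D (delta_mx 0 i)) (D (delta_mx 0 j)).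

Lemma D_sum u : D u = \sum_i u 0 i *: D (delta_mx 0 i).
Proof. by rewrite {1}[u]row_sum_delta linear_sum; apply: eq_bigr => i _; rewrite linearZ. Qed.

Lemma mul_gram u j : (u *m gram) 0 j = ip (D u) (D (delta_mx 0 j)).
Proof.
rewrite mxE [in RHS]D_sum ip_suml; apply: eq_bigr => i _.
by rewrite mxE ipZl.
Qed.

Lemma mul_gram_tr u v : (u *m gram *m v^T) 0 0 = ip (D u) (D v).
Proof.
rewrite mxE ipC [in RHS](D_sum v) ip_suml; apply: eq_bigr => i _.
by rewrite mul_gram mxE ipZl mulrC ipC.
Qed.

Lemma gram_unit : gram \in unitmx.
Proof.
rewrite -row_free_unit; apply/inj_row_free => u u0.
have := mul_gram_tr u u; rewrite u0 mul0mx mxE => /esym h.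
exact/Dinj/ip_tangent_eq0.
Qed.

Hypotheses (xN : lor x Nv.1 = 0) (NN : ip Nv Nv = 1).
Hypothesis DN : forall v, ip (D v) Nv = 0.

(** The images of the basis vectors, [Nv] and the position vector [(x, 0)] are [n + 2] independent
    vectors of [R^(n+1) x R], hence span it; pairing with [Nv] and with [x] shows that the last two
    coefficients of [Z] vanish. *)
Lemma span_tangent Z : lor x Z.1 = 0 -> ip Z Nv = 0 -> exists u, D u = Z.
Proof.
move=> xZ ZN.
have scalar_mx0 k : (0 : R)%:M = 0 :> 'M[R]_k by exact: (raddf0 (@scalar_mx R k)).
pose vec (Y : E) : 'rV[R]_(n.+1 + 1) := row_mx Y.1 (Y.2%:M).
have vec_inj Y Y' : vec Y = vec Y' -> Y = Y'.
  move=> /eq_row_mx[]; case: Y Y' => [y t] [y' t'] /= -> h; congr (_, _).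
  by have := congr1 (fun M : 'M[R]_1 => M 0 0) h; rewrite !mxE.
have vecD Y Y' : vec (Y + Y') = vec Y + vec Y'.
  by rewrite /vec add_row_mx /= (raddfD (@scalar_mx R 1)).
have vecZ a Y : vec (a *: Y) = a *: vec Y.
  by rewrite /vec scale_row_mx /= -scale_scalar_mx.
pose M := col_mx (\matrix_i vec (D (delta_mx 0 i))) (col_mx (vec Nv) (vec (x, 0))).
have ME (a : 'rV[R]_n) (b c : 'M[R]_1) :
    row_mx a (row_mx b c) *m M = vec (D a + (b 0 0 *: Nv + c 0 0 *: (x, 0))).
  rewrite !mul_row_col !vecD !vecZ; congr (_ + (_ + _)).
  - rewrite mulmx_sum_row D_sum.
    elim/big_rec2: _ => [|i y Y _ ->]; first by rewrite /vec /= scalar_mx0 row_mx0.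
    by rewrite vecD vecZ rowK.
  - by rewrite [b]mx11_scalar mul_scalar_mx mxE eqxx mulr1n.
  - by rewrite [c]mx11_scalar mul_scalar_mx mxE eqxx mulr1n.
have xx : lor x x = -1 by case: hx.
have coef (a : 'rV[R]_n) (b c : R) Y : lor x Y.1 = 0 -> D a + (b *: Nv + c *: (x, 0)) = Y ->
    ip Y Nv = b /\ c = 0.
  move=> xY YE; split.
    rewrite -YE !ipDl DN !ipZl NN /ip /= xN; ring.
  have := congr1 (fun Y : E => lor x Y.1) YE.
  by rewrite /= !lorlin Dx xN xx xY; lra.
have Mfree : row_free M.
  apply/inj_row_free => u.
  rewrite -[u]hsubmxK -[rsubmx u]hsubmxK ME => h.
  have h0 : D (lsubmx u) + (lsubmx (rsubmx u) 0 0 *: Nv + rsubmx (rsubmx u) 0 0 *: (x, 0)) = 0.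
    by apply: vec_inj; rewrite h /vec /= scalar_mx0 row_mx0.
  have [] := coef _ _ _ (0 : E) (lor0r x) h0; rewrite ip0l => /esym b0 c0.
  move: h0; rewrite b0 c0 !scale0r !addr0 => /Dinj ->.
  rewrite [lsubmx (rsubmx u)]mx11_scalar b0 [rsubmx (rsubmx u)]mx11_scalar c0.
  by rewrite !scalar_mx0 !row_mx0.
have Mfull : row_full M.
  by rewrite /row_full (eqP Mfree) addnA !addn1.
have /submxP[u uE] : (vec Z <= M)%MS by exact: submx_full.
rewrite -[u]hsubmxK -[rsubmx u]hsubmxK ME in uE.
have hZ := esym (vec_inj _ _ uE).
have [] := coef _ _ _ _ xZ hZ; rewrite ZN => /esym b0 c0.
by exists (lsubmx u); move: hZ; rewrite b0 c0 !scale0r !addr0.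
Qed.

(** The pseudo-inverse of [D] with respect to [ip]; it is linear on the whole ambient space, so it
    can be applied to differences of points, not only to tangent vectors. *)
Definition left_inverse (Z : E) : 'rV[R]_n :=
  (\row_j ip Z (D (delta_mx 0 j))) *m invmx gram.

Lemma left_inverseK v : left_inverse (D v) = v.
Proof.
rewrite /left_inverse; have -> : \row_j ip (D v) (D (delta_mx 0 j)) = v *m gram.
  by apply/rowP => j; rewrite mul_gram mxE.
by rewrite mulmxK// gram_unit.
Qed.

Lemma left_inverse_linear : linear left_inverse.
Proof.
move=> a u v; rewrite /left_inverse scalemxAl -mulmxDl; congr (_ *m _).
by apply/rowP => j; rewrite !mxE ipDl ipZl.
Qed.

Lemma left_inverse_dif Z : dif left_inverse Z left_inverse.
Proof.
apply: dif_mx => i j.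
have e : (fun Y => left_inverse Y i j) =
  (fun Y => \sum_(k <- index_enum 'I_n) ip Y (D (delta_mx 0 k)) * invmx gram k j).
  by apply/funext => Y; rewrite mxE; apply: eq_bigr => k _; rewrite mxE.
rewrite e; apply: dif_eq.
  apply: dif_sum => k; apply: difM (dif_cst _ _).
  exact: dif_ipl (dif_id Z).
move=> Y /=; by apply: eq_bigr => k _; rewrite mulr0 add0r mulrC.
Qed.

End Span.
End Tangent.

Section Charts.
Context {R : realType} {n : nat}.
Notation E := ('rV[R]_n.+1 * R)%type.
Variables (S : set E) (U : set 'rV[R]_n) (X : 'rV[R]_n -> E).
Hypotheses (SH : S `<=` HxR) (cX : chart S U X).

Lemma chart_open : open U. Proof. by case: cX. Qed.

Lemma chart_near a : U a -> \forall b \near a, U b.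
Proof. by move=> Ua; exact: open_nbhs_nbhs (conj chart_open Ua). Qed.

Lemma chart_smooth k : Ck k U X. Proof. by case: cX => _ + _ _ _; apply. Qed.

Lemma chart_in a : U a -> S (X a).
Proof.
move=> Ua; have [_ _ _ _ /(_ U chart_open (@subset_refl _ U))[W [_ h]]] := cX.
by have : (X @` U) (X a) by [exists a]; rewrite h => -[].
Qed.

Lemma chart_hyp a : U a -> hyp (X a).1. Proof. by move=> /chart_in /SH. Qed.

Lemma chart_differentiable a : U a -> differentiable X a.
Proof. exact: Ck_differentiable (chart_smooth 1). Qed.

Lemma chart_dif a : U a -> dif X a (fun v => 'D_v X a).
Proof. by move=> /chart_differentiable /differentiable_dif. Qed.

Lemma chart_diffE a v : U a -> 'd X a v = 'D_v X a.
Proof. by move=> Ua; rewrite deriveE//; exact: chart_differentiable. Qed.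

Lemma chart_immersion a v : U a -> 'd X a v = 0 -> v = 0.
Proof. by move=> Ua; rewrite chart_diffE//; case: cX => _ _ + _ _; apply. Qed.

Lemma chart_tangent a v : U a -> lor (X a).1 ('D_v X a).1 = 0.
Proof.
move=> Ua; apply: lor_tangent; first exact: chart_differentiable.
by apply: filterS (chart_near Ua) => b; exact: chart_hyp.
Qed.

Lemma chart_tangent_d a v : U a -> lor (X a).1 ('d X a v).1 = 0.
Proof. by move=> Ua; rewrite chart_diffE//; exact: chart_tangent. Qed.

Lemma first_form_gram a : U a -> first_form X a = gram ('d X a).
Proof. by move=> Ua; apply/matrixP => i j; rewrite !mxE !chart_diffE. Qed.

Lemma first_form_unit a : U a -> first_form X a \in unitmx.
Proof.
move=> Ua; rewrite first_form_gram//; apply: gram_unit (chart_hyp Ua) _ _.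
  by move=> v; exact: chart_immersion.
by move=> v; exact: chart_tangent_d.
Qed.

Lemma mul_first_form a u j : U a ->
  (u *m first_form X a) 0 j = ip ('D_u X a) ('D_(delta_mx 0 j) X a).
Proof. by move=> Ua; rewrite first_form_gram// mul_gram !chart_diffE. Qed.

(** Reduced to [derive_sym] by composing with a linear form, since that lemma concerns scalar
    functions; the forms used later are the height and [lor _ o]. *)
Lemma chart_derive_sym a u v (L : E -> R) : U a -> linear L -> continuous L ->
  L ('D_u ('D_v X) a) = L ('D_v ('D_u X) a).
Proof.
move=> Ua lL cL; have X2 := chart_smooth 2.
have D1 v1 b : U b -> 'D_v1 (fun b => L (X b)) b = L ('D_v1 X b).
  by move=> Ub; exact: (dif_derive v1 (dif_comp (chart_dif Ub) (dif_linear _ lL cL))).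
have D2 v1 v2 : 'D_v2 ('D_v1 (fun b => L (X b))) a = L ('D_v2 ('D_v1 X) a).
  have h := dif_comp (Ck_dif1 (Ck_derive v1 X2) Ua) (dif_linear _ lL cL).
  have <- := dif_derive v2 h.
  by apply: near_eq_derive; apply: filterS (chart_near Ua) => b; exact: D1.
have LX : Ck 2 U (fun b => L (X b)) := Ck_comp_linear chart_open lL cL X2.
have h := @derive_sym _ _ U (fun b => L (X b)) a v u chart_open Ua LX.
exact: etrans (esym (D2 v u)) (etrans h (D2 u v)).
Qed.

Lemma chart_derive_sym_height a u v : U a ->
  ('D_u ('D_v X) a).2 = ('D_v ('D_u X) a).2.
Proof.
move=> Ua; apply: (@chart_derive_sym a u v (fun z : E => z.2) Ua).
  by [].
by move=> z; exact: cvg_snd.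
Qed.

Lemma chart_derive_sym_lor a u v o : U a ->
  lor ('D_u ('D_v X) a).1 o = lor ('D_v ('D_u X) a).1 o.
Proof.
move=> Ua; apply: (@chart_derive_sym a u v (fun z : E => lor z.1 o) Ua).
  by move=> b x z; rewrite /= !lorlin.
by move=> z; exact: (dif_cont (dif_lorl o (dif_fst (dif_id z)))).
Qed.

(* A curve in S through X a lifts to a curve in the chart that is Lipschitz at
   the base point, because the differential of X has a left inverse. *)
Lemma lift_derive a (g : R -> E) (s : R) d (f : E -> R) : U a ->
  is_derive s 1 g d -> (\forall t \near s, S (g t)) -> g s = X a ->
  dif (fun b => f (X b)) a (fun=> 0) -> is_derive s 1 (fun t => f (g t)) 0.
Proof.
move=> Ua gd gS gs fX; apply/dif_is_derive.
have lin0 : linear (fun _ : R => 0 : R) by move=> k u v; rewrite scaler0 addr0.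
have lin0B := GRing.isLinear.Build R R R *:%R (fun _ : R => 0 : R) lin0.
pose L0 : {linear R -> R} := HB.pack (fun _ : R => 0 : R) lin0B.
apply: dif_eq (_ : dif _ _ L0) _; last by move=> v; rewrite /= mulr0.
apply: eps_dif; first by move=> v; exact: cvg_cst.
move=> e e0 /=.
have gdif : dif g s (fun v => v *: d) by apply/dif_curve.
have gc : {for s, continuous g} := dif_cont gdif.
pose C := 1 + `|d|.
have C0 : 0 < C by rewrite ltr_pwDl.
have gL : \forall t \near s, `|g t - g s| <= C * `|t - s|.
  apply: filterS (dif_eps gdif ltr01) => t; rewrite mul1r => h.
  rewrite -[g t - g s](subrK ((t - s) *: d)) (le_trans (ler_normD _ _))//.
  by rewrite mulrDl mul1r lerD// normrZ mulrC.
pose D := 'd X a.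
have Dinj v : D v = 0 -> v = 0 by exact: chart_immersion.
have Dx v : lor (X a).1 (D v).1 = 0 by exact: chart_tangent_d.
pose La := left_inverse D.
have LaK v : La (D v) = v by exact: left_inverseK (chart_hyp Ua) Dinj Dx v.
have laB := GRing.isLinear.Build R E 'rV[R]_n *:%R La (left_inverse_linear D).
pose LL : {linear E -> 'rV[R]_n} := HB.pack La laB.
have LLc : continuous LL by move=> Z; exact: (dif_cont (left_inverse_dif D Z)).
have [K K0 KL] := linear_lipschitz LLc.
have XL : \forall b \near a, `|b - a| <= 2 * K * `|X b - X a|.
  have h12 : 0 < 2^-1 :> R by rewrite invr_gt0.
  have dX : dif (fun b => LL (X b)) a (fun v => v).
    apply: dif_eq (dif_comp (chart_dif Ua) (left_inverse_dif D (X a))) _ => v.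
    by rewrite -chart_diffE//; exact: LaK.
  apply: filterS (dif_eps dX h12) => b h.
  have e1 : `|b - a| <= `|LL (X b) - LL (X a)| + 2^-1 * `|b - a|.
    rewrite -[X in `|X| <= _](subrK (LL (X b) - LL (X a))) addrC.
    by rewrite (le_trans (ler_normD _ _))// lerD2l distrC.
  have e2 : `|LL (X b) - LL (X a)| <= K * `|X b - X a| by rewrite -linearB; exact: KL.
  move: e1 e2; rewrite -mulrA; move: `|_| `|_| (K * _) => p q r; lra.
(* [C] bounds the growth of [g] and [2 * K] that of the inverse of the chart at the base point; with
   this [e'] the product of the three constants is [e]. *)
pose e' := e / (2 * K * C).
have e'0 : 0 < e' by rewrite divr_gt0// !mulr_gt0.
have nf := dif_eps fX e'0.
have nUa : nbhs a U := chart_near Ua.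
have nUXf : nbhs a [set b | [/\ U b, `|b - a| <= 2 * K * `|X b - X a| &
    `|f (X b) - f (X a) - 0| <= e' * `|b - a|]].
  by apply: filterS3 nUa XL nf => b.
have [U' [oU' U'a U'P]] := nbhs_open nUXf.
have U'U : U' `<=` U by move=> b /U'P[].
have [_ _ _ _ /(_ U' oU' U'U)[W [oW WE]]] := cX.
have Wp : W (g s) by have : (X @` U') (X a) by [exists a]; rewrite WE gs => -[].
have nW : \forall t \near s, W (g t) by apply: gc; exact: open_nbhs_nbhs.
apply: filterS3 gS nW gL => t St Wt Lt.
have [b U'b bE] : (X @` U') (g t) by rewrite WE.
have [Ub XLb] := U'P _ U'b; rewrite subr0 => nfb.
rewrite subr0 -bE gs (le_trans nfb)//.
apply: (@le_trans _ _ (e' * (2 * K * (C * `|t - s|)))).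
  rewrite ler_pM2l// (le_trans XLb)// ler_pM2l ?mulr_gt0//.
  by rewrite bE -gs.
rewrite /e' le_eqVlt; apply/orP; left; apply/eqP.
by field; rewrite !gt_eqF.
Qed.

End Charts.

(** [unit_normal] only tests chart directions. The function [ip _ (N (g s))] has zero differential
    at the point in a chart, so [lift_derive] passes this on to any differentiable curve in [S], in
    particular to rotation orbits. *)
Lemma curve_normal {R : realType} {n : nat} (S : set ('rV[R]_n.+1 * R))
  (N : 'rV[R]_n.+1 * R -> 'rV[R]_n.+1 * R) (g : R -> 'rV[R]_n.+1 * R) (s : R) d :
  hypersurface S -> unit_normal S N ->
  is_derive s 1 g d -> (\forall t \near s, S (g t)) -> ip d (N (g s)) = 0.
Proof.
move=> [SH Sch] [_ SN] gd gS; have Sg := nbhs_singleton gS.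
have [U [X [a [cX Ua XE]]]] := Sch _ Sg.
have [_ _ NX] := SN _ Sg.
have fX : dif (fun b => ip (X b) (N (g s))) a (fun=> 0).
  apply: dif_eq (dif_ipl _ (chart_dif cX Ua)) _ => v.
  exact: NX cX Ua XE.
have := @lift_derive _ _ _ _ _ SH cX a g s d (ip^~ (N (g s))) Ua gd gS (esym XE) fX.
have gdif : dif g s (fun v => v *: d) by apply/dif_curve.
move=> [_]; have h := dif_ipl (N (g s)) gdif.
by rewrite (dif_derive (1 : R) h) scale1r.
Qed.

(** With [sg = sinh rho], the vector [sg^-1 *: (y x - o)], where [y = - lor x o], is the radial unit
    vector. So in the vertical plane the normal is [(- q sg, w)] and [T] is [(w, q sg)], and a
    tangent vector, being orthogonal to the normal, has there only a component along [T]. *)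
Lemma profile_dot {R : realType} {n : nat} (x o : 'rV[R]_n.+1) (q w sg : R)
  (A : 'rV[R]_n.+1 * R) :
  0 < sg -> sg ^+ 2 = (- lor x o) ^+ 2 - 1 ->
  q ^+ 2 * ((- lor x o) ^+ 2 - 1) + w ^+ 2 = 1 ->
  lor x A.1 = 0 -> q * lor A.1 o + w * A.2 = 0 ->
  let T := ((w / sg) *: ((- lor x o) *: x - o), q * sg) in
  - lor A.1 o = sg * w * ip A T /\ A.2 = q * sg * ip A T.
Proof.
move=> sg0 <- unitN xA r T; have sgn0 : sg != 0 by rewrite gt_eqF.
rewrite -exprMn exprMn in unitN.
rewrite /ip /T /= !lorlin [lor A.1 x]lorC xA.
have r' : w * A.2 = - (q * lor A.1 o) by rewrite -[RHS]addr0 -r; ring.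
split.
  transitivity (- ((q ^+ 2 * sg ^+ 2 + w ^+ 2) * lor A.1 o)); first by rewrite unitN mul1r.
  transitivity (- (w ^+ 2 * lor A.1 o) + q * sg ^+ 2 * - (q * lor A.1 o)); first ring.
  by rewrite -r'; field.
transitivity ((q ^+ 2 * sg ^+ 2 + w ^+ 2) * A.2); first by rewrite unitN mul1r.
transitivity (w * (w * A.2) + q ^+ 2 * sg ^+ 2 * A.2); first ring.
by rewrite r'; field.
Qed.

(** * The shape operator when the normal lies in the vertical plane through the axis *)

Section Shape.
Context {R : realType} {n : nat}.
Notation E := ('rV[R]_n.+1 * R)%type.
Variables (S : set E) (U : set 'rV[R]_n) (X : 'rV[R]_n -> E) (a : 'rV[R]_n).
Hypotheses (n0 : (0 < n)%N) (SH : S `<=` HxR) (cX : chart S U X) (Ua : U a).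
Variables (N : E -> E) (o : 'rV[R]_n.+1) (q w : R).
Notation y := (- lor (X a).1 o).
Hypotheses (NE : N (X a) = (- q *: (y *: (X a).1 - o), w)).
Hypotheses (ho : hyp o) (unitN : q ^+ 2 * (y ^+ 2 - 1) + w ^+ 2 = 1).
Variables (qh wh : 'rV[R]_n -> R) (dq dw : 'rV[R]_n -> R).
Hypotheses (qhd : dif qh a dq) (whd : dif wh a dw).
Hypotheses (qhE : qh a = q) (whE : wh a = w).
Hypothesis rel : \forall b \near a,
  forall v, qh b * lor ('D_v X b).1 o + wh b * ('D_v X b).2 = 0.

Let xx : lor (X a).1 (X a).1 = -1. Proof. by case: (chart_hyp SH cX Ua). Qed.

Let oo : lor o o = -1. Proof. by case: ho. Qed.

Let relv v : q * lor ('D_v X a).1 o + w * ('D_v X a).2 = 0.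
Proof. by rewrite -qhE -whE; exact: (nbhs_singleton rel). Qed.

Lemma xNa : lor (X a).1 (N (X a)).1 = 0.
Proof. by rewrite NE /= !lorlin xx; ring. Qed.

(** The second derivatives of [X] are eliminated by differentiating two identities, the
    orthogonality of ['D_v X] to the position and the relation [rel]; what remains involves only
    first derivatives of [X], [qh] and [wh]. *)
Lemma second_formE i j : second_form N X a i j =
  q * y * lor ('D_(delta_mx 0 i) X a).1 ('D_(delta_mx 0 j) X a).1
  - dq (delta_mx 0 i) * lor ('D_(delta_mx 0 j) X a).1 o
  - dw (delta_mx 0 i) * ('D_(delta_mx 0 j) X a).2.
Proof.
rewrite mxE.
have dX := chart_dif cX Ua.
have dDX : dif ('D_(delta_mx 0 j) X) a (fun v => 'D_v ('D_(delta_mx 0 j) X) a).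
  exact: Ck_dif1 (Ck_derive _ (chart_smooth cX 2)) Ua.
have h1 := dif_lor (dif_fst dX) (dif_fst dDX).
have h1' : dif (fun b => lor (X b).1 ('D_(delta_mx 0 j) X b).1) a (fun=> 0).
  apply: dif_near (dif_cst 0 a); apply: filterS (chart_near cX Ua) => b Ub.
  by rewrite (chart_tangent SH cX).
have h2 := difD (difM qhd (dif_lorl o (dif_fst dDX))) (difM whd (dif_snd dDX)).
have h2' : dif (fun b => qh b * lor ('D_(delta_mx 0 j) X b).1 o +
    wh b * ('D_(delta_mx 0 j) X b).2) a (fun=> 0).
  by apply: dif_near (dif_cst 0 a); apply: filterS rel => b ->.
have := dif_derive (delta_mx 0 i) h1; rewrite (dif_derive _ h1').
have := dif_derive (delta_mx 0 i) h2; rewrite (dif_derive _ h2') qhE whE.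
have xN := xNa; move: ('D_(delta_mx 0 j) X a) ('D_(delta_mx 0 i) X a).
move: (derive ('D_(delta_mx 0 j) X) a (delta_mx 0 i)) => A Xj Xi e1 e2.
rewrite /ip /tproj NE /= lorDl lorZl; move: xN; rewrite NE => -> /=.
rewrite mulr0 addr0 !lorlin [lor A.1 (X a).1]lorC.
have -> : lor (X a).1 A.1 = - lor Xi.1 Xj.1 by rewrite -[RHS]add0r e2; ring.
apply/eqP; rewrite -subr_eq0; apply/eqP; rewrite [RHS]e1; ring.
Qed.

Let ipN v : ip ('D_v X a) (N (X a)) = 0.
Proof.
have := relv v; have := chart_tangent SH cX v Ua.
rewrite /ip NE; move: ('D_v X a) => A xA r.
by rewrite /= !lorlin [lor A.1 (X a).1]lorC xA -[RHS]r; ring.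
Qed.

Let NN : ip (N (X a)) (N (X a)) = 1.
Proof.
rewrite /ip NE /= !lorlin oo xx [lor o _]lorC -[RHS]unitN; ring.
Qed.

Let dqlin u : dq u = \sum_i u 0 i * dq (delta_mx 0 i).
Proof.
have <- := dif_diffE qhd.
rewrite {1}[u]row_sum_delta linear_sum; apply: eq_bigr => i _; by rewrite linearZ.
Qed.

Let dwlin u : dw u = \sum_i u 0 i * dw (delta_mx 0 i).
Proof.
have <- := dif_diffE whd.
rewrite {1}[u]row_sum_delta linear_sum; apply: eq_bigr => i _; by rewrite linearZ.
Qed.

Lemma shape_rank1 (k : R) (al l u : 'rV[R]_n) :
  (forall i j, second_form N X a i j = k * first_form X a i j + al 0 i * l 0 j) ->
  l = u *m first_form X a ->
  char_poly (shape_mx N X a) =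
  ('X - k%:P) ^+ n.-1 * ('X - (k + \sum_i u 0 i * al 0 i)%:P).
Proof.
move=> h lE; have Gu := first_form_unit SH cX Ua.
have -> : shape_mx N X a = k%:M + invmx (first_form X a) *m al^T *m l.
  rewrite /shape_mx.
  have -> : second_form N X a = k *: first_form X a + al^T *m l.
    by apply/matrixP => i j; rewrite h !mxE big_ord1 !mxE.
  by rewrite mulmxDr -scalemxAr mulVmx// scalemx1 mulmxA.
rewrite char_poly_rank1//; congr (_ * ('X - (_ + _)%:P)).
rewrite lE -mulmxA [first_form X a *m _]mulmxA mulmxV// mul1mx mxE.
by apply: eq_bigr => i _; rewrite !mxE.
Qed.

(** On the axis the normal is vertical, so tangent vectors have no height component and are
    orthogonal to [o]; the terms in [dq] and [dw] drop out and the point is umbilic. *)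
Lemma shape_axis : (X a).1 = o -> char_poly (shape_mx N X a) =
  ('X - q%:P) ^+ n.-1 * ('X - q%:P).
Proof.
move=> Xo.
have w1 : w != 0.
  apply/eqP => w0; have := unitN; rewrite w0 Xo oo => /eqP.
  by rewrite opprK expr1n subrr mulr0 expr0n addr0 eq_sym oner_eq0.
have X2 v : lor ('D_v X a).1 o = 0 /\ ('D_v X a).2 = 0.
  have l0 : lor ('D_v X a).1 o = 0 by rewrite lorC -{1}Xo (chart_tangent SH cX).
  have := relv v; rewrite l0 mulr0 add0r => /eqP; rewrite mulf_eq0 (negbTE w1) /=.
  by move=> /eqP ->.
rewrite (@shape_rank1 q 0 0 0) ?mul0mx//.
  by rewrite big1 ?addr0// => i _; rewrite mxE mul0r.
move=> i j; rewrite second_formE !mxE mul0r addr0.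
have [] := X2 (delta_mx 0 j); have [_] := X2 (delta_mx 0 i).
move: ('D_(delta_mx 0 j) X a) ('D_(delta_mx 0 i) X a) => A B e1 e2 e3.
by rewrite /ip e1 e2 e3 Xo oo; ring.
Qed.

Section OffAxis.
Variable sg : R.
Hypotheses (sg0 : 0 < sg) (sg2 : sg ^+ 2 = y ^+ 2 - 1).

Definition profile_tangent : E := ((w / sg) *: (y *: (X a).1 - o), q * sg).
Let T := profile_tangent.

Let sgn0 : sg != 0. Proof. by rewrite gt_eqF. Qed.
Let unitN' : q ^+ 2 * sg ^+ 2 + w ^+ 2 = 1. Proof. by rewrite sg2. Qed.

Lemma profile_tangent_dot v :
  - lor ('D_v X a).1 o = sg * w * ip ('D_v X a) T /\
  ('D_v X a).2 = q * sg * ip ('D_v X a) T.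
Proof.
exact: (profile_dot sg0 sg2 unitN (chart_tangent SH cX v Ua) (relv v)).
Qed.

Lemma profile_direction : exists u, 'D_u X a = T.
Proof.
have [||||||u uE] := @span_tangent _ _ ('d X a) (X a).1 (N (X a)) (chart_hyp SH cX Ua) _ _ _ NN _ T.
- by move=> v; exact: (chart_immersion cX).
- by move=> v; exact: (chart_tangent_d SH cX).
- exact: xNa.
- by move=> v; rewrite (chart_diffE cX).
- by rewrite /T /= !lorlin xx; ring.
- rewrite /ip NE /T /= !lorlin oo xx [lor o _]lorC.
  transitivity (w * q / sg * (sg ^+ 2 - (y ^+ 2 - 1))); last by rewrite sg2 subrr mulr0.
  by field.
- by exists u; rewrite -(chart_diffE cX).
Qed.

Lemma profile_tangent_unit : ip T T = 1.
Proof.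
rewrite /ip /T /= !lorlin oo xx [lor o _]lorC.
transitivity (w ^+ 2 / sg ^+ 2 * (y ^+ 2 - 1) + q ^+ 2 * sg ^+ 2); first by field.
by rewrite -sg2 divfK ?expf_neq0// addrC.
Qed.

(** By [profile_tangent_dot] the terms of [second_formE] beyond the multiple [q * y] of the metric
    see ['D_j X] only through its component along [T], hence have rank one; the second eigenvalue is
    read off in the direction of [T]. *)
Lemma shape_off_axis u : 'D_u X a = T ->
  char_poly (shape_mx N X a) = ('X - (q * y)%:P) ^+ n.-1 *
    ('X - (q * y + (sg * w * dq u - q * sg * (dw u + q * y * (q * sg))))%:P).
Proof.
move=> uT.
pose l := \row_j ip ('D_(delta_mx 0 j) X a) T.
pose al := \row_i (sg * w * dq (delta_mx 0 i)
   - q * sg * (dw (delta_mx 0 i) + q * y * ('D_(delta_mx 0 i) X a).2)).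
rewrite (@shape_rank1 (q * y) al l u).
- congr (_ * ('X - (_ + _)%:P)).
  have D2 : q * sg = \sum_i u 0 i * ('D_(delta_mx 0 i) X a).2.
    transitivity ('D_u X a).2; first by rewrite uT.
    rewrite -(chart_diffE cX)// D_sum raddf_sum; apply: eq_bigr => i _.
    by rewrite (chart_diffE cX).
  rewrite {2}D2 dqlin dwlin !mulr_sumr -!big_split /= mulr_sumr -sumrB.
  by apply: eq_bigr => i _; rewrite mxE; ring.
- move=> i j; rewrite second_formE !mxE.
  have [e1 e2] := profile_tangent_dot (delta_mx 0 j).
  move: e1 e2; move: ('D_(delta_mx 0 j) X a) ('D_(delta_mx 0 i) X a) => A B e1 e2.
  have -> : lor A.1 o = - (sg * w * ip A T) by rewrite -e1 opprK.
  by rewrite [ip B A]/ip e2; ring.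
- by apply/rowP => j; rewrite mxE (mul_first_form cX)// uT [RHS]ipC.
Qed.

End OffAxis.

End Shape.

(** * Normals of rotational hypersurfaces *)

(** Algebra for the symmetry argument of [chart_profile_curvature]. [A] and [B] stand for ['D_v X]
    and ['D_u X], [A'] and [B'] for the two mixed second derivatives, and [w * ds - s * dw] is the
    differential of the angle of the normal. *)
Lemma angle_proportional {R : realType} {n : nat} (A B A' B' T : 'rV[R]_n.+1 * R)
  (o : 'rV[R]_n.+1) (r w s y q dqu dqv dwu dwv dsu dsv : R) : r != 0 ->
  dqu * lor A.1 o + dwu * A.2 = - (q * lor A'.1 o + w * A'.2) ->
  dqv * lor B.1 o + dwv * B.2 = - (q * lor B'.1 o + w * B'.2) ->
  lor A'.1 o = lor B'.1 o -> A'.2 = B'.2 ->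
  - lor A.1 o = r * w * ip A T -> A.2 = s * ip A T ->
  - lor B.1 o = r * w * ip B T -> B.2 = s * ip B T -> ip B T = 1 ->
  dqu = (dsu - s * y * w / r * ip B T) / r ->
  dqv = (dsv - s * y * w / r * ip A T) / r ->
  w * dsv - s * dwv = (w * dsu - s * dwu) * ip A T.
Proof.
move=> r0 k1 k2 s1 s2 e1 e2 e3 e4 BT dqu_ dqv_.
have h : dqu * lor A.1 o + dwu * A.2 = dqv * lor B.1 o + dwv * B.2.
  by rewrite k1 k2 s1 s2.
have {}e1 : lor A.1 o = - (r * w * ip A T) by rewrite -e1 opprK.
have {}e3 : lor B.1 o = - (r * w) by rewrite -[LHS]opprK e3 BT mulr1.
rewrite e1 e3 e2 e4 BT mulr1 dqu_ dqv_ BT in h.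
apply/eqP; rewrite -subr_eq0; apply/eqP.
move/eqP: h; rewrite -subr_eq0 => /eqP h; rewrite -[RHS]h.
by field.
Qed.

Section Star.
Context {R : realType} {n : nat}.
Notation E := ('rV[R]_n.+1 * R)%type.
Variables (S : set E) (N : E -> E) (o : 'rV[R]_n.+1).
Hypotheses (n2 : (2 <= n)%N) (HS : hypersurface S) (HN : unit_normal S N).
Hypotheses (ho : hyp o)
  (rot : forall A, rotation_about o A -> forall p, S p -> S (p.1 *m A, p.2)).

(** [hgt] is [cosh rho], the time coordinate relative to [o], and not the vertical height. [rad] is
    [sinh rho], and [nvert], [nrad] are the components [w], [s] of the normal, [s] counted inwards;
    on the axis [nrad] is 0 by the convention for division by zero. *)
Definition hgt (p : E) : R := - lor p.1 o.
Definition rad (p : E) : R := Num.sqrt (hgt p ^+ 2 - 1).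
Definition nvert (p : E) : R := (N p).2.
Definition nrad (p : E) : R := lor (N p).1 o / rad p.
Definition ptan (p : E) : E :=
  ((nvert p / rad p) *: (hgt p *: p.1 - o), nrad p).

Let SH : S `<=` HxR. Proof. by case: HS. Qed.
Let oo : lor o o = -1. Proof. by case: ho. Qed.

Lemma hgt_ge1 p : S p -> 1 <= hgt p.
Proof. by move=> /SH hp; have [] := hyp_lor_le hp ho; rewrite /hgt; lra. Qed.

Lemma hgt_axis p : S p -> ~~ (1 < hgt p) -> p.1 = o.
Proof.
move=> Sp; rewrite -leNgt => h1; have h2 := hgt_ge1 Sp.
by apply: (hyp_lor_le (SH Sp) ho).2; rewrite /hgt in h1 h2; lra.
Qed.

Lemma rad2 p : S p -> rad p ^+ 2 = hgt p ^+ 2 - 1.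
Proof. by move=> /hgt_ge1 h; rewrite sqr_sqrtr//; nra. Qed.

Lemma rad_gt0 p : 1 < hgt p -> 0 < rad p.
Proof. by move=> h; rewrite sqrtr_gt0; nra. Qed.

Lemma normal_off_axis p : S p -> 1 < hgt p ->
  (N p).1 = - (nrad p / rad p) *: (hgt p *: p.1 - o) /\
  nrad p ^+ 2 + nvert p ^+ 2 = 1.
Proof.
move=> Sp y1; have hp := SH Sp; have [xx _] := hp.
have r0 := rad_gt0 y1; have r2 := rad2 Sp.
have [xN NN _] := HN.2 _ Sp.
set h := (N p).1 in xN *.
pose f := (rad p)^-1 *: (p.1 - hgt p *: o).
have of0 : lor o f = 0 by rewrite /f !lorlin oo [lor o p.1]lorC /hgt; ring.
have ff : lor f f = 1.
  rewrite /f !lorlin oo xx [lor o p.1]lorC.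
  transitivity ((rad p) ^- 2 * (hgt p ^+ 2 - 1)); first by rewrite /hgt; field; rewrite gt_eqF.
  by rewrite -r2 mulVf// expf_neq0// gt_eqF.
have xE : p.1 = hgt p *: o + rad p *: f.
  by rewrite /f scalerA divff ?gt_eqF// scale1r addrC subrK.
have fE : f = (rad p)^-1 *: (p.1 - hgt p *: o) by [].
clearbody f.
have eh e : lor e e = 1 -> lor o e = 0 -> lor e f = 0 -> lor e h = 0.
  move=> ee oe ef.
  (* The orbit of [p] under the rotations in the plane of [e] and [f] stays in [S]; its velocity at
     [p] is [rad p *: e], so the normal is orthogonal to every such [e]. *)
  pose g (t : R) : E := (p.1 + (cos t - 1) *: (rad p *: f) + sin t *: (rad p *: e), p.2).
  have gS t : S (g t).
    have := rot (rotmx_rotation ee ff ef oe of0 (cos2Dsin2 t)) Sp.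
    rewrite mul_rotmx /g.
    have -> : lor p.1 f = rad p by rewrite xE !lorlin of0 ff; ring.
    have -> : lor p.1 e = 0 by rewrite xE !lorlin oe lorC ef; ring.
    by rewrite !scale0r addr0 subr0.
  have gd : is_derive (0 : R) 1 g (rad p *: e, 0).
    apply/dif_curve.
    have c0 : is_derive (0 : R) 1 cos 0 by apply: is_derive_eq; rewrite sin0 oppr0.
    have s0 : is_derive (0 : R) 1 sin 1 by apply: is_derive_eq; rewrite cos0.
    move/dif_is_derive in c0; move/dif_is_derive in s0.
    have d1 := dif_scalel (rad p *: f) (difB c0 (dif_cst (1 : R) (0 : R))).
    have d2 := difD (difD (dif_cst p.1 (0 : R)) d1) (dif_scalel (rad p *: e) s0).
    apply: dif_eq (dif_pair d2 (dif_cst p.2 (0 : R))) _ => v /=.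
    by rewrite mulr0 subr0 scale0r !add0r mulr1; congr (_, _); rewrite /= /GRing.scale /= mulr0.
  have gS' : \forall t \near (0 : R), S (g t) by exact: filterE.
  have := curve_normal HS HN gd gS'.
  have -> : g 0 = p by rewrite /g cos0 sin0 subrr !scale0r !addr0; case: (p).
  rewrite /ip /= mul0r addr0 lorZl => /eqP; rewrite mulf_eq0 gt_eqF//= => /eqP.
  by [].
(* What is left of [h] after removing its components along [f] and [o]; were it nonzero, its
   normalization would contradict [eh]. *)
pose e := h - lor h f *: f + lor h o *: o.
have oe : lor o e = 0 by rewrite /e !lorlin oo of0 [lor o h]lorC; ring.
have ef : lor e f = 0 by rewrite /e !lorlin ff of0; ring.
have e0 : e = 0.
  have [e1 e2] := tangent_ge0 ho oe; apply/eqP; apply: contraT => ne0.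
  have ep : 0 < lor e e by rewrite lt_neqAle e1 andbT eq_sym; apply: contra_neq ne0 => /e2.
  have [a a0 aE] := normalize ep.
  have := eh (a *: e) aE; rewrite lorZr oe mulr0 lorZl ef mulr0 lorZl => /(_ erefl erefl) /eqP.
  rewrite mulf_eq0 gt_eqF//= => /eqP eh0.
  suff : lor e e = 0 by lra.
  rewrite -[lor e e]/(lor e (h - lor h f *: f + lor h o *: o)).
  by rewrite lorDr lorBr !lorZr eh0 ef [lor e o]lorC oe; ring.
have hE : h = lor h f *: f - lor h o *: o.
  apply/eqP; rewrite -subr_eq0; apply/eqP; rewrite -[RHS]e0 /e.
  by apply/rowP => i; rewrite !mxE; ring.
have hf : lor h f = - (hgt p * lor h o / rad p).
  apply: (@mulfI _ (rad p)); first by rewrite gt_eqF.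
  have := xN; rewrite {1}xE lorDl !lorZl lorC [lor f h]lorC => e1.
  transitivity (rad p * lor h f - (hgt p * lor h o + rad p * lor h f)); first by rewrite e1 subr0.
  by field; rewrite gt_eqF.
have N1 : h = - (nrad p / rad p) *: (hgt p *: p.1 - o).
  rewrite hE hf fE /nrad -/h; apply/rowP => i; rewrite !mxE.
  apply: (@mulfI _ (rad p ^+ 2)); first by rewrite expf_neq0// gt_eqF.
  transitivity (- lor h o * (hgt p * p.1 0 i - hgt p ^+ 2 * o 0 i + rad p ^+ 2 * o 0 i)).
    by field; rewrite gt_eqF.
  transitivity (- lor h o * (hgt p * p.1 0 i - o 0 i)); first by rewrite r2; ring.
  by field; rewrite gt_eqF.
split=> //; move: NN; rewrite /ip -/h -/(nvert p) N1 !lorlin oo xx [lor o _]lorC => NN.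
rewrite -[RHS]NN.
transitivity ((nrad p / rad p) ^+ 2 * (hgt p ^+ 2 - 1) + nvert p ^+ 2).
  by rewrite -r2; field; rewrite gt_eqF.
by rewrite /hgt; ring.
Qed.

(** Suppose the horizontal part [h] is nonzero and let [e] be a unit vector orthogonal to [o] and
    [h]. Then [e] is tangent to [S], and a quarter turn about [o] carries a curve with velocity [e]
    to one in [S] with velocity along [h], which cannot be orthogonal to the normal. *)
Lemma normal_axis p : S p -> p.1 = o -> (N p).1 = 0.
Proof.
move=> Sp po; have [xN NN _] := HN.2 _ Sp.
set h := (N p).1 in xN *; rewrite po in xN.
have [h1 h2] := tangent_ge0 ho xN; apply/eqP; apply: contraT => ne0.
have hp : 0 < lor h h by rewrite lt_neqAle h1 andbT eq_sym; apply: contra_neq ne0 => /h2.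
have [b b0 bE] := normalize hp; set f := b *: h in bE.
have [e [ee oe ef]] := unit_orthogonal f n2 ho.
have eh : lor e h = 0.
  by move: ef; rewrite /f lorZr => /eqP; rewrite mulf_eq0 gt_eqF//= => /eqP.
have of0 : lor o f = 0 by rewrite /f lorZr xN mulr0.
have [U [X [a [cX Ua XE]]]] := HS.2 _ Sp.
have [||||||u uE] := @span_tangent _ _ ('d X a) (X a).1 (N p) (chart_hyp SH cX Ua) _ _ _ NN _ (e, 0).
- by move=> v; exact: (chart_immersion cX).
- by move=> v; exact: (chart_tangent_d SH cX).
- by rewrite XE po.
- move=> v; rewrite (chart_diffE cX)//; have [_ _ h3] := HN.2 _ Sp.
  exact: (h3 U).
- by rewrite XE po.
- by rewrite /ip /= -/h eh mul0r addr0.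
have r1 : 0 ^+ 2 + 1 ^+ 2 = 1 :> R by rewrite expr0n expr1n add0r.
have rA := rotmx_rotation ee bE ef oe of0 r1; set A := rotmx e f 0 1 in rA.
pose g (t : R) : E := ((X (a + t *: u)).1 *m A, (X (a + t *: u)).2).
have g1 : dif (fun t : R => X (a + t *: u)) 0 (fun v => v *: (e, 0)).
  have hX : dif X (a + 0 *: u) (fun v => 'D_v X a).
    by rewrite scale0r addr0; exact: (chart_dif cX).
  apply/dif_curve; have := is_derive_line hX.
  by rewrite -(chart_diffE cX)// uE.
have gd : is_derive (0 : R) 1 g (- f, 0).
  apply/dif_curve.
  have hA : dif (fun t : R => (X (a + t *: u)).1 *m A) 0 (fun v => (v *: (e, 0 : R)).1 *m A).
    have lA : linear (fun x : 'rV[R]_n.+1 => x *m A) by move=> k x z; rewrite mulmxDl scalemxAl.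
    have dA x : dif (fun x : 'rV[R]_n.+1 => x *m A) x (fun x => x *m A).
      apply: dif_mx => i j.
      have e1 : (fun y : 'rV[R]_n.+1 => (y *m A) i j) =
        (fun y => \sum_(k <- index_enum 'I_n.+1) y i k * A k j).
        by apply/funext => y; rewrite mxE.
      rewrite e1; apply: dif_eq.
        apply: dif_sum => k; apply: difM (dif_cst _ _).
        exact: dif_coord (dif_id x).
      by move=> y /=; apply: eq_bigr => k _; rewrite mulr0 add0r mulrC.
    exact: dif_comp (dif_fst g1) (dA _).
  apply: dif_eq (dif_pair hA (dif_snd g1)) _ => v /=; congr (_, _).
  rewrite /= -scalemxAl /A mul_rotmx ee ef; congr (_ *: _).
  by apply/rowP => i; rewrite !mxE; ring.
have gS : \forall t \near (0 : R), S (g t).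
  have : {for (0 : R), continuous (fun t : R => a + t *: u)}.
    apply: (@dif_cont _ _ _ _ _ (fun v : R => 0 + v *: u)).
    exact: difD (dif_cst a _) (dif_scalel u (dif_id _)).
  have nU : nbhs (a + 0 *: u) U by rewrite scale0r addr0; exact: (chart_near cX Ua).
  move=> cc; have hU : \forall t \near (0 : R), U (a + t *: u) by exact: (cc U nU).
  apply: filterS hU => t /= Ut.
  by apply: rot; [exact: rA|exact: (chart_in cX)].
have := curve_normal HS HN gd gS.
have -> : g 0 = p.
  rewrite /g scale0r addr0 XE po; case: rA => _ _ ->.
  by rewrite -po; case: (p).
rewrite /ip /= -/h mul0r addr0 lorNl /f lorZl => /eqP.
by rewrite oppr_eq0 mulf_eq0 !gt_eqF.
Qed.

Lemma rad_axis p : p.1 = o -> rad p = 0.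
Proof. by move=> po; rewrite /rad /hgt po oo opprK expr1n subrr sqrtr0. Qed.

Lemma normal_continuous_chart U X a : chart S U X -> U a ->
  {for a, continuous (fun b => N (X b))}.
Proof.
move=> cX Ua; have Nc := (proj1 (subspace_continuousP _ _) HN.1) _ (chart_in cX Ua).
apply: cvg_trans Nc => A /= hA.
have Xc := dif_cont (chart_dif cX Ua).
have h1 : \forall b \near a, S (X b) -> A (N (X b)) := Xc _ hA.
have h2 : \forall b \near a, A (N (X b)).
  by apply: filterS2 h1 (chart_near cX Ua) => b h /(chart_in cX) /h.
exact: h2.
Qed.

Lemma off_axis_near U X a : chart S U X -> U a -> 1 < hgt (X a) ->
  \forall b \near a, U b /\ 1 < hgt (X b).
Proof.
move=> cX Ua y1.
have yd := difN (dif_lorl o (dif_fst (chart_dif cX Ua))).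
have h : \forall b \near a, 1 < hgt (X b) by exact: (cvgr_gt _ (dif_cont yd) _ y1).
exact: filterS2 (chart_near cX Ua) h.
Qed.

Lemma chart_relation U X a v : chart S U X -> U a -> 1 < hgt (X a) ->
  nrad (X a) / rad (X a) * lor ('D_v X a).1 o + nvert (X a) * ('D_v X a).2 = 0.
Proof.
move=> cX Ua y1; have Sp := chart_in cX Ua.
have [N1 _] := normal_off_axis Sp y1.
have [_ _ /(_ U X a v cX Ua erefl)] := HN.2 _ Sp.
have := chart_tangent SH cX v Ua; rewrite /ip N1 /nvert.
move: ('D_v X a) => A xA; rewrite !lorlin [lor A.1 (X a).1]lorC xA => h.
by rewrite -[RHS]h; ring.
Qed.

Lemma unit_profile p : S p -> 1 < hgt p ->
  (nrad p / rad p) ^+ 2 * ((- lor p.1 o) ^+ 2 - 1) + nvert p ^+ 2 = 1.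
Proof.
move=> Sp y1; have [_ h] := normal_off_axis Sp y1.
rewrite -/(hgt p) -(rad2 Sp) -[RHS]h; field.
by rewrite gt_eqF// rad_gt0.
Qed.

Lemma normal_pair p : S p -> 1 < hgt p ->
  N p = (- (nrad p / rad p) *: (- lor p.1 o *: p.1 - o), nvert p).
Proof.
move=> Sp y1; have [N1 _] := normal_off_axis Sp y1.
by rewrite [LHS]surjective_pairing N1.
Qed.

Lemma ptanE p : 1 < hgt p ->
  ptan p = ((nvert p / rad p) *: (- lor p.1 o *: p.1 - o), nrad p / rad p * rad p).
Proof. by move=> y1; rewrite divfK// gt_eqF// rad_gt0. Qed.

Section ChartProfile.
Variables (U : set 'rV[R]_n) (X : 'rV[R]_n -> E) (a : 'rV[R]_n).
Hypotheses (cX : chart S U X) (Ua : U a) (y1 : 1 < hgt (X a)).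
Let p := X a.
Let Sp : S p := chart_in cX Ua.
Let r0 : 0 < rad p := rad_gt0 y1.
Let n0 : (0 < n)%N := ltn_trans (ltn0Sn 0) n2.

Lemma chart_profile_dot b v : U b -> 1 < hgt (X b) ->
  - lor ('D_v X b).1 o = rad (X b) * nvert (X b) * ip ('D_v X b) (ptan (X b)) /\
  ('D_v X b).2 = nrad (X b) * ip ('D_v X b) (ptan (X b)).
Proof.
move=> Ub yb; have Sb := chart_in cX Ub.
have := profile_dot (rad_gt0 yb) (rad2 Sb) (unit_profile Sb yb)
  (chart_tangent SH cX v Ub) (chart_relation v cX Ub yb).
by rewrite /= -ptanE// divfK// gt_eqF// rad_gt0.
Qed.

Let relnear : \forall b \near a, forall v,
  nrad (X b) / rad (X b) * lor ('D_v X b).1 o + nvert (X b) * ('D_v X b).2 = 0.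
Proof.
by apply: filterS (off_axis_near cX Ua y1) => b [Ub yb] v; exact: (chart_relation v cX Ub yb).
Qed.

Lemma chart_profile_direction : exists u, 'D_u X a = ptan p.
Proof.
have [u uE] := @profile_direction _ _ _ _ _ _ SH cX Ua N o _ _ (normal_pair Sp y1) ho
  (unit_profile Sp y1) (fun b => nrad (X b) / rad (X b)) (fun b => nvert (X b))
  erefl erefl relnear _ r0 (rad2 Sp).
by exists u; rewrite uE /profile_tangent ptanE.
Qed.

Lemma ptan_unit : ip (ptan p) (ptan p) = 1.
Proof.
have := @profile_tangent_unit _ _ _ _ _ _ SH cX Ua o _ _ ho (unit_profile Sp y1) _ r0 (rad2 Sp).
by rewrite /profile_tangent -ptanE.
Qed.

Lemma rad_dif : dif (fun b => rad (X b)) a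
  (fun v => hgt p * nvert p * ip ('D_v X a) (ptan p)).
Proof.
have yd := difN (dif_lorl o (dif_fst (chart_dif cX Ua))).
have y2 := difB (difX 2 yd) (dif_cst (1 : R) a).
have pos : 0 < (- lor (X a).1 o) ^+ 2 - 1 by rewrite -/(hgt p) -(rad2 Sp) exprn_gt0.
apply: dif_eq (dif_comp1 y2 (is_derive1_sqrt pos)) _ => v.
rewrite subr0 expr1 -/(hgt _) -/(rad _) -/p.
have [-> _] := chart_profile_dot v Ua y1; rewrite -/p.
by field; rewrite gt_eqF.
Qed.

(** The normal is only assumed continuous. The field ['D_u X] is differentiable and its components
    in the vertical plane, [f1] and [f2], are [nvert] and [nrad] times a common factor [m]; dividing
    by their length recovers both, once [m > 0] is known. *)
Lemma normal_profile_dif : exists dw ds,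
  dif (fun b => nvert (X b)) a dw /\ dif (fun b => nrad (X b)) a ds.
Proof.
have [u uE] := chart_profile_direction.
have dDX : dif ('D_u X) a (fun v => 'D_v ('D_u X) a).
  exact: Ck_dif1 (Ck_derive _ (chart_smooth cX 2)) Ua.
pose f1 b := - lor ('D_u X b).1 o / rad (X b); pose f2 b := ('D_u X b).2.
pose m b := ip ('D_u X b) (ptan (X b)).
have d1 := difM (difN (dif_lorl o (dif_fst dDX))) (difV (f := fun b => rad (X b)) (lt0r_neq0 r0) rad_dif).
have d2 := dif_snd dDX.
have fE b : U b -> 1 < hgt (X b) -> f1 b = nvert (X b) * m b /\ f2 b = nrad (X b) * m b.
  move=> Ub yb; have [e1 e2] := chart_profile_dot u Ub yb.
  rewrite /f1 /f2 e1 e2; split=> //.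
  by rewrite mulrC mulrA mulrA mulVf ?mul1r// gt_eqF// rad_gt0.
have ma : m a = 1 by rewrite /m uE ptan_unit.
have [f1a f2a] := fE a Ua y1; rewrite ma !mulr1 in f1a f2a.
have unit b : U b -> 1 < hgt (X b) -> nrad (X b) ^+ 2 + nvert (X b) ^+ 2 = 1.
  by move=> Ub yb; have [_ ->] := normal_off_axis (chart_in cX Ub) yb.
have mE b : U b -> 1 < hgt (X b) ->
    m b = nvert (X b) * f1 b + nrad (X b) * f2 b /\ m b ^+ 2 = f1 b ^+ 2 + f2 b ^+ 2.
  move=> Ub yb; have [-> ->] := fE b Ub yb; have ub := unit b Ub yb.
  split; first by rewrite -[LHS]mul1r -ub; ring.
  by rewrite -[LHS]mul1r -ub; ring.
have Nc := normal_continuous_chart cX Ua.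
have wc : {for a, continuous (fun b => nvert (X b))}.
  by apply: (continuous_comp Nc); exact: cvg_snd.
have rc := dif_cont rad_dif.
have sc : {for a, continuous (fun b => nrad (X b))}.
  have lc := dif_cont (dif_lorl o (dif_fst (dif_id (N (X a))))).
  have := @continuous_comp _ _ _ (fun b => N (X b)) (fun y : E => lor y.1 o) a Nc lc.
  by move=> h; exact: cvgM h (cvgV (lt0r_neq0 r0) rc).
(* [m] itself involves the normal, so only its sign near [a] is used, obtained by continuity from
   [m a = 1]; the differentiable expression for it is [M]. *)
have mpos : \forall b \near a, 0 < m b.
  have h : {for a, continuous (fun b => nvert (X b) * f1 b + nrad (X b) * f2 b)}.
    exact: cvgD (cvgM wc (dif_cont d1)) (cvgM sc (dif_cont d2)).
  have h0 : 0 < nvert (X a) * f1 a + nrad (X a) * f2 a by have [<- _] := mE a Ua y1; rewrite ma.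
  have hn : \forall b \near a, 0 < nvert (X b) * f1 b + nrad (X b) * f2 b.
    exact: (cvgr_gt _ h _ h0).
  apply: filterS2 (off_axis_near cX Ua y1) hn => b [Ub yb].
  by have [<- _] := mE b Ub yb.
pose M b := Num.sqrt (f1 b ^+ 2 + f2 b ^+ 2).
have Ma : f1 a ^+ 2 + f2 a ^+ 2 = 1 by have [_ <-] := mE a Ua y1; rewrite ma expr1n.
have Mpos : 0 < f1 a ^+ 2 + f2 a ^+ 2 by rewrite Ma.
have dM := dif_comp1 (difD (difX 2 d1) (difX 2 d2)) (is_derive1_sqrt Mpos).
have M0 : M a != 0 by rewrite /M Ma sqrtr1 oner_eq0.
have ME : \forall b \near a, [/\ U b, 1 < hgt (X b), 0 < m b & M b = m b].
  apply: filterS2 (off_axis_near cX Ua y1) mpos => b [Ub yb] mb; split=> //.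
  by rewrite /M; have [_ <-] := mE b Ub yb; rewrite sqrtr_sqr gtr0_norm.
do 2 eexists; split.
  apply: dif_near (difM d1 (difV M0 dM)).
  apply: filterS ME => b [Ub yb mb]; rewrite -/(M b) => ->.
  by rewrite -/(f1 b); have [-> _] := fE b Ub yb; rewrite mulfK// gt_eqF.
apply: dif_near (difM d2 (difV M0 dM)).
apply: filterS ME => b [Ub yb mb]; rewrite -/(M b) => ->.
by rewrite -/(f2 b); have [_ ->] := fE b Ub yb; rewrite mulfK// gt_eqF.
Qed.

(* The form (v, v') -> < D_v D_v' X, N > is symmetric, so the rank one form
   d theta (x) l is symmetric, and d theta is a multiple of l. *)
Lemma chart_profile_curvature r c :
  (1 <= r <= n)%N ->
  (exists k : 'I_n -> R, char_poly (shape_mx N X a) = \prod_i ('X - (k i)%:P) /\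
     mean_curvature r k = c) ->
  exists kap, [/\
    n%:R * c = (n%:R - r%:R) * (nrad p / rad p * hgt p) ^+ r +
      r%:R * ((nrad p / rad p * hgt p) ^+ r.-1 * kap),
    dif (fun b => nvert (X b)) a (fun v => - nrad p * kap * ip ('D_v X a) (ptan p)) &
    dif (fun b => nrad (X b)) a (fun v => nvert p * kap * ip ('D_v X a) (ptan p))].
Proof.
move=> rn [ks [ksE ksc]].
have [u uE] := chart_profile_direction.
have [dw [ds [wd sd]]] := normal_profile_dif.
pose q b := nrad (X b) / rad (X b).
have qd := difM sd (difV (f := fun b => rad (X b)) (lt0r_neq0 r0) rad_dif).
set dq := (fun v => _ + _) in qd.
have off := @shape_off_axis _ _ _ _ _ _ n0 SH cX Ua N o _ _ (normal_pair Sp y1)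
  (unit_profile Sp y1) q (fun b => nvert (X b)) dq dw qd wd erefl erefl relnear _ r0 (rad2 Sp) u.
rewrite uE /profile_tangent ptanE// -/p in off; have {}off := off erefl.
have uu : ip ('D_u X a) (ptan p) = 1 by rewrite uE ptan_unit.
have swE v : nrad p * ds v + nvert p * dw v = 0.
  have h := difD (difX 2 sd) (difX 2 wd).
  have h0 : dif (fun b => nrad (X b) ^+ 2 + nvert (X b) ^+ 2) a (fun=> 0).
    apply: dif_near (dif_cst (1 : R) a); apply: filterS (off_axis_near cX Ua y1).
    by move=> b [Ub yb]; have [_ ->] := normal_off_axis (chart_in cX Ub) yb.
  have := dif_derive v h; rewrite (dif_derive v h0) !expr1 => e; rewrite /p.
  by apply: (@mulfI _ 2) => //; rewrite mulr0 [RHS]e; ring.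
have sw1 : nrad p ^+ 2 + nvert p ^+ 2 = 1 by have [_ ->] := normal_off_axis Sp y1.
(* With [(nrad, nvert) = (sin theta, cos theta)] this is d theta; its value in the profile direction
   will be the curvature [kap]. *)
pose th v := nvert p * ds v - nrad p * dw v.
have dqE v : dq v = (ds v - nrad p * hgt p * nvert p / rad p * ip ('D_v X a) (ptan p)) / rad p.
  by rewrite /dq -/p; field; rewrite gt_eqF.
have thE v : th v = th u * ip ('D_v X a) (ptan p).
  have key (v1 v2 : 'rV[R]_n) :
     dq v1 * lor ('D_v2 X a).1 o + dw v1 * ('D_v2 X a).2 =
     - (q a * lor ('D_v1 ('D_v2 X) a).1 o + nvert p * ('D_v1 ('D_v2 X) a).2).
    have dDX : dif ('D_v2 X) a (fun v => 'D_v ('D_v2 X) a).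
      exact: Ck_dif1 (Ck_derive _ (chart_smooth cX 2)) Ua.
    have h := difD (difM qd (dif_lorl o (dif_fst dDX))) (difM wd (dif_snd dDX)).
    have h0 : dif (fun b => q b * lor ('D_v2 X b).1 o + nvert (X b) * ('D_v2 X b).2) a (fun=> 0).
      by apply: dif_near (dif_cst (0 : R) a); apply: filterS relnear => b ->.
    have := dif_derive v1 h; rewrite (dif_derive v1 h0) -/(q a) -/p => e.
    move: e; move: ('D_v2 X a) (derive ('D_v2 X) a v1) (dq v1) (dw v1) (q a) => A B x1 x2 x3 e.
    by rewrite -[LHS]subr0 e; ring.
  have sym1 := chart_derive_sym_lor cX u v o Ua.
  have sym2 := chart_derive_sym_height cX u v Ua.
  have [e1 e2] := chart_profile_dot v Ua y1; have [e3 e4] := chart_profile_dot u Ua y1.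
  exact: (angle_proportional (lt0r_neq0 r0) (key u v) (key v u) sym1 sym2 e1 e2 e3 e4 uu (dqE u) (dqE v)).
exists (th u); split.
- rewrite -ksc; apply: (mean_curvature_two n0) => //; rewrite -ksE off.
  congr (_ * ('X - _%:P)); rewrite dqE uu /th.
  transitivity (nvert p * ds u - nrad p * dw u +
     nrad p / rad p * hgt p * (1 - (nrad p ^+ 2 + nvert p ^+ 2))).
    by rewrite /hgt; field; rewrite gt_eqF.
  by rewrite sw1 subrr mulr0 addr0.
- apply: dif_eq wd _ => v; rewrite -mulrA -thE /th.
  rewrite -[LHS]mul1r -sw1.
  transitivity (nrad p ^+ 2 * dw v + nvert p * (nrad p * ds v + nvert p * dw v)
     - nvert p * nrad p * ds v); first by ring.
  by rewrite swE; ring.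
- apply: dif_eq sd _ => v; rewrite -mulrA -thE /th.
  rewrite -[LHS]mul1r -sw1.
  transitivity (nvert p ^+ 2 * ds v + nrad p * (nrad p * ds v + nvert p * dw v)
     - nvert p * nrad p * dw v); first by ring.
  by rewrite swE; ring.
Qed.

End ChartProfile.

(** Translates the chart statements into statements on curves in [S], the form used in the sequel;
    the last clause supplies one curve in the profile direction. *)
Lemma profile_equations r c p : (1 <= r <= n)%N ->
  (exists k, principal_curvatures S N p k /\ mean_curvature r k = c) ->
  S p -> 1 < hgt p ->
  exists kap, [/\
    n%:R * c = (n%:R - r%:R) * (nrad p / rad p * hgt p) ^+ r +
      r%:R * ((nrad p / rad p * hgt p) ^+ r.-1 * kap),
    (forall (g : R -> E) (t : R) d, is_derive t 1 g d ->
       (\forall s \near t, S (g s)) -> g t = p ->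
       [/\ is_derive t 1 (fun s => hgt (g s)) (rad p * nvert p * ip d (ptan p)),
         is_derive t 1 (fun s => (g s).2) (nrad p * ip d (ptan p)),
         is_derive t 1 (fun s => nrad (g s)) (nvert p * kap * ip d (ptan p)) &
         is_derive t 1 (fun s => nvert (g s)) (- nrad p * kap * ip d (ptan p))]) &
    exists g : R -> E, [/\ is_derive (0 : R) 1 g (ptan p),
      (\forall s \near (0 : R), S (g s)) & g 0 = p]].
Proof.
move=> rn [k [[U [X [a [cX Ua Xp kE]]]] kc]] Sp y1; rewrite -Xp in Sp y1 *.
have ex : exists k : 'I_n -> R, char_poly (shape_mx N X a) = \prod_i ('X - (k i)%:P) /\
   mean_curvature r k = c by exists k.
have [kap [eqn wd sd]] := chart_profile_curvature cX Ua y1 rn ex.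
exists kap; split=> //.
- move=> g t d gd gS gt; set T := ptan (X a).
  have gdif : dif g t (fun v => v *: d) by apply/dif_curve.
  (* [f - m * ip _ T] has zero differential in the chart, so [lift_derive] applies to it. *)
  have transfer (f : E -> R) m : dif (fun b => f (X b)) a (fun v => m * ip ('D_v X a) T) ->
      is_derive t 1 (fun s => f (g s)) (m * ip d T).
    move=> fd.
    have h0 : dif (fun b => f (X b) - m * ip (X b) T) a (fun=> 0).
      apply: dif_eq (difB fd (difM (dif_cst m a) (dif_ipl T (chart_dif cX Ua)))) _ => v.
      by rewrite mulr0 addr0 subrr.
    have h1 := @lift_derive _ _ _ _ _ SH cX a g t d (fun z => f z - m * ip z T) Ua gd gS gt h0.
    apply/dif_is_derive; move/dif_is_derive: h1 => h1.
    have h2 := difD h1 (difM (dif_cst m t) (dif_ipl T gdif)).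
    have e : (fun s => f (g s) - m * ip (g s) T + m * ip (g s) T) = (fun s => f (g s)).
      by apply/funext => s; rewrite subrK.
    rewrite e in h2; apply: dif_eq h2 _ => v; rewrite ipZl; ring.
  split.
  + apply: transfer; apply: dif_eq (difN (dif_lorl o (dif_fst (chart_dif cX Ua)))) _ => v.
    by have [-> _] := chart_profile_dot cX v Ua y1.
  + apply: transfer; apply: dif_eq (dif_snd (chart_dif cX Ua)) _ => v.
    by have [_ ->] := chart_profile_dot cX v Ua y1.
  + exact: transfer sd.
  + exact: transfer wd.
have [u uE] := chart_profile_direction cX Ua y1.
exists (fun s => X (a + s *: u)).
have hX : dif X (a + 0 *: u) (fun v => 'D_v X a).
  by rewrite scale0r addr0; exact: (chart_dif cX).
have gd := is_derive_line hX; rewrite uE in gd.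
split=> //; last by rewrite scale0r addr0.
have cc : {for (0 : R), continuous (fun t : R => a + t *: u)}.
  apply: (@dif_cont _ _ _ _ _ (fun v : R => 0 + v *: u)).
  exact: difD (dif_cst a _) (dif_scalel u (dif_id _)).
have nU : nbhs (a + 0 *: u) U by rewrite scale0r addr0; exact: (chart_near cX Ua).
have hU : \forall t \near (0 : R), U (a + t *: u) by exact: (cc U nU).
by apply: filterS hU => t; exact: (chart_in cX).
Qed.

End Star.

(** * The profile functions *)

Section ProfileIntegral.
Context {R : realType}.
Implicit Types (p m : nat) (x v : R).
Local Notation mu := (@lebesgue_measure R).

Lemma dif_sqrtXV (V : normedModType R) m (f : V -> R) (a : V) (L : V -> R) : dif f a L -> 0 < f a ->
  dif (fun z => (Num.sqrt (f z) ^+ m)^-1) a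
    (fun w => - (m%:R / 2) / Num.sqrt (f a) ^+ m.+2 * L w).
Proof.
move=> hf f0; have s0 : Num.sqrt (f a) != 0 by rewrite gt_eqF// sqrtr_gt0.
have h := difX m (dif_comp1 hf (is_derive1_sqrt f0)).
have s1 := expf_neq0 m s0.
apply: dif_eq (@difV _ _ (fun y => Num.sqrt (f y) ^+ m) a _ s1 h) _ => v.
case: m {h s1} => [|m]; first by rewrite !mul0r oppr0 !mul0r.
rewrite /= !exprS expr0; move: (L v) (Num.sqrt (f a)) s0 => l s s0.
have := expf_neq0 m s0; move: (s ^+ m) => sm sm0.
by field; rewrite s0 sm0.
Qed.

(** The interval of integration is fixed, so [x] enters only through a kernel that is smooth for
    [x > -1]; that covers a neighbourhood of the axis [x = 0]. Two exponents are kept because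
    differentiation in [x] raises both by 2. *)
Definition kern p m x v : R := v ^+ p / Num.sqrt (1 + v ^+ 2 * x) ^+ m.
Definition kint p m x : R := \int[mu]_(v in `[0, 1]) kern p m x v.

Lemma kern_arg x v : -1 < x -> 0 <= v <= 1 -> 0 < 1 + v ^+ 2 * x.
Proof.
move=> x1 /andP[v0 v1].
have h1 : v ^+ 2 <= 1 by rewrite exprn_ile1.
have h0 : 0 <= v ^+ 2 by exact: sqr_ge0.
case: (leP 0 x) => x0; first by rewrite ltr_pwDl// mulr_ge0.
have : x <= v ^+ 2 * x by rewrite ler_niMl// ltW.
lra.
Qed.

Lemma kern_ge0 p m x v : 0 <= v -> 0 <= kern p m x v.
Proof. by move=> v0; rewrite /kern divr_ge0 ?exprn_ge0// sqrtr_ge0. Qed.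

Lemma kern_dx p m x v : 0 < 1 + v ^+ 2 * x ->
  is_derive x 1 (fun x => kern p m x v) (- (m%:R / 2) * kern p.+2 m.+2 x v).
Proof.
move=> pos; apply/dif_is_derive.
have h := difD (dif_cst (1 : R) x) (difM (dif_cst (v ^+ 2) x) (dif_id x)).
apply: dif_eq (difM (dif_cst (v ^+ p) x) (dif_sqrtXV m h pos)) _ => u /=.
rewrite /kern !exprS; ring.
Qed.

Lemma kern_dv p m x v : 0 < 1 + v ^+ 2 * x ->
  is_derive v 1 (kern p.+1 m x)
    (p.+1%:R * kern p m x v - m%:R * x * kern p.+2 m.+2 x v).
Proof.
move=> pos; apply/dif_is_derive.
have h := difD (dif_cst (1 : R) v) (difM (difX 2 (dif_id v)) (dif_cst x v)).
apply: dif_eq (difM (difX p.+1 (dif_id v)) (dif_sqrtXV m h pos)) _ => u /=.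
have s0 : Num.sqrt (1 + v ^+ 2 * x) != 0 by rewrite gt_eqF// sqrtr_gt0.
rewrite /kern; move: s0; rewrite !exprS expr0 => s0; field.
by rewrite s0 expf_neq0.
Qed.

Lemma kern_continuous p m x : -1 < x -> {within `[0, 1], continuous (kern p m x)}.
Proof.
move=> x1; apply: continuous_in_subspaceT => v; rewrite inE/= in_itv/= => v01.
have h := difD (dif_cst (1 : R) v) (difM (difX 2 (dif_id v)) (dif_cst x v)).
exact: dif_cont (difM (difX p (dif_id v)) (dif_sqrtXV m h (kern_arg x1 v01))).
Qed.

Lemma kern_integrable p m x : -1 < x -> mu.-integrable `[0, 1] (EFin \o kern p m x).
Proof.
move=> x1; apply: continuous_compact_integrable; last exact: kern_continuous.
exact: segment_compact.
Qed.

Lemma kern_le p m u x v : -1 < u -> u <= x -> 0 <= v <= 1 ->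
  kern p m x v <= (Num.sqrt (1 + Num.min u 0) ^+ m)^-1.
Proof.
move=> u1 ux /andP[v0 v1].
have m0 : 0 < 1 + Num.min u 0 by rewrite /Num.min; case: ifP => _; lra.
have h1 : v ^+ 2 <= 1 by rewrite exprn_ile1.
have h0 : 0 <= v ^+ 2 by exact: sqr_ge0.
have hm : 1 + Num.min u 0 <= 1 + v ^+ 2 * x.
  rewrite lerD2l; case: (leP 0 x) => x0.
    by apply: (@le_trans _ _ 0); rewrite ?ge_min ?lexx ?orbT// mulr_ge0.
  have : x <= v ^+ 2 * x by rewrite ler_niMl// ltW.
  by apply: le_trans; rewrite ge_min ux.
have hs : Num.sqrt (1 + Num.min u 0) ^+ m <= Num.sqrt (1 + v ^+ 2 * x) ^+ m.
  by rewrite lerXn2r ?nnegrE ?sqrtr_ge0// ler_wsqrtr.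
rewrite /kern ler_pdivrMr; last by rewrite exprn_gt0// sqrtr_gt0 (lt_le_trans m0).
apply: (@le_trans _ _ 1); first by rewrite exprn_ile1.
by rewrite mulrC ler_pdivlMr ?mul1r// exprn_gt0// sqrtr_gt0.
Qed.

Lemma kint_dx p m x : -1 < x ->
  is_derive x 1 (kint p m) (- (m%:R / 2) * kint p.+2 m.+2 x).
Proof.
move=> x1; pose f (x v : R) := kern p m x v.
(* [u] is the midpoint of [-1] and [x]: on []u, w[] the derivative of the kernel stays below a
   constant, as domination requires. *)
pose u := (x - 1) / 2; pose w := x + 1.
have u1 : -1 < u by rewrite /u; lra.
have ux : x \in `]u, w[ by rewrite in_itv/= /u /w; apply/andP; split; lra.
have up y : y \in `]u, w[ -> -1 < y by rewrite in_itv/= => /andP[]; lra.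
have mB : measurable (`[0, 1]%classic : set R) by exact: measurable_itv.
pose G (_ : R) := m%:R / 2 * (Num.sqrt (1 + Num.min u 0) ^+ m.+2)^-1.
have intf y : y \in `]u, w[ -> mu.-integrable `[0, 1] (EFin \o f y).
  by move=> /up; exact: kern_integrable.
have fd y v : y \in `]u, w[ -> (`[0, 1]%classic : set R) v -> derivable (f ^~ v) y 1.
  move=> /up y1; rewrite /= in_itv/= => v01.
  by have [] := kern_dx p m (kern_arg y1 v01).
have fE y v : y \in `]u, w[ -> (`[0, 1]%classic : set R) v ->
    (f ^~ v)^`()%classic y = - (m%:R / 2) * kern p.+2 m.+2 y v.
  move=> /up y1; rewrite /= in_itv/= => v01.
  by have [_ E] := kern_dx p m (kern_arg y1 v01); rewrite derive1E.
have G0 v : 0 <= G v by rewrite /G mulr_ge0// invr_ge0 exprn_ge0// sqrtr_ge0.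
have intG : mu.-integrable `[0, 1] (EFin \o G).
  apply: continuous_compact_integrable; first exact: segment_compact.
  by apply: continuous_subspaceT => z; exact: cvg_cst.
have dG y v : y \in `]u, w[ -> (`[0, 1]%classic : set R) v -> `|(f ^~ v)^`()%classic y| <= G v.
  move=> yI vB; rewrite fE//.
  have /andP[uy _] : u < y < w by move: yI; rewrite in_itv.
  have v01 : 0 <= v <= 1 by move: vB; rewrite /= in_itv.
  rewrite /G normrM normrN [`|m%:R / 2|]ger0_norm// ler_wpM2l// ger0_norm.
    exact: kern_le (ltW uy) v01.
  by apply: kern_ge0; case/andP: v01.
have D := @derivable_under_integral R _ _ mu f _ mB x u w ux intf fd G G0 intG dG.
have E := @differentiation_under_integral R _ _ mu f _ mB x u w ux intf fd G G0 intG dG.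
split; first exact: D.
rewrite -derive1E E -RintegralZl//; last exact: kern_integrable.
by apply: eq_Rintegral => v; rewrite inE => vB; exact: fE.
Qed.

(** The fundamental theorem of calculus for [v |-> v^(p+1) / (1 + v^2 x)^(m/2)] on [[0, 1]]. *)
Lemma kint_FTC p m x : -1 < x ->
  p.+1%:R * kint p m x - m%:R * x * kint p.+2 m.+2 x = (Num.sqrt (1 + x) ^+ m)^-1.
Proof.
move=> x1.
have mB : measurable (`[0, 1]%classic : set R) by exact: measurable_itv.
pose f v := p.+1%:R * kern p m x v - m%:R * x * kern p.+2 m.+2 x v.
have i1 := kern_integrable p m x1; have i2 := kern_integrable p.+2 m.+2 x1.
have cf : {within `[(0:R), 1], continuous f}.
  move=> v; apply: cvgB; apply: cvgM.
  - exact: cvg_cst.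
  - exact: kern_continuous.
  - exact: cvg_cst.
  - exact: kern_continuous.
have dk v : 0 <= v <= 1 -> is_derive v 1 (kern p.+1 m x) (f v).
  by move=> v01; exact: kern_dv (kern_arg x1 v01).
have H : derivable_oo_LRcontinuous (kern p.+1 m x) 0 1.
  split.
  - move=> v; rewrite in_itv/= => /andP[v0 v1].
    have h : 0 <= v <= 1 by rewrite !ltW.
    by case: (dk v h).
  - have h : 0 <= (0:R) <= 1 by rewrite lexx ler01.
    have /dif_is_derive/dif_cont c := dk 0 h.
    exact: cvg_at_right_filter c.
  - have h : 0 <= (1:R) <= 1 by rewrite lexx ler01.
    have /dif_is_derive/dif_cont c := dk 1 h.
    exact: cvg_at_left_filter c.
have D : {in `]0, 1[, (kern p.+1 m x)^`()%classic =1 f}.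
  move=> v; rewrite in_itv/= => /andP[v0 v1].
  have h : 0 <= v <= 1 by rewrite !ltW.
  by rewrite derive1E; case: (dk v h).
have := continuous_FTC2 ltr01 cf H D.
move=> /(congr1 fine); rewrite [X in X = _ -> _](_ : _ = \int[mu]_(v in `[0, 1]) f v)//.
rewrite RintegralB//; last 2 first.
- by apply: continuous_compact_integrable; [exact: segment_compact|
    move=> v; apply: cvgM; [exact: cvg_cst|exact: kern_continuous]].
- by apply: continuous_compact_integrable; [exact: segment_compact|
    move=> v; apply: cvgM; [exact: cvg_cst|exact: kern_continuous]].
rewrite !RintegralZl// => ->.
by rewrite /kern/= expr1n expr0n/= mul0r subr0 expr1n !mul1r.
Qed.

Lemma kint_shift p m x : -1 < x -> kint p m x = kint p m.+2 x + x * kint p.+2 m.+2 x.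
Proof.
move=> x1.
have mB : measurable (`[0, 1]%classic : set R) by exact: measurable_itv.
rewrite /kint -RintegralZl//; last exact: kern_integrable.
rewrite -RintegralD//; last 2 first.
- exact: kern_integrable.
- by apply: continuous_compact_integrable; [exact: segment_compact|
    move=> v; apply: cvgM; [exact: cvg_cst|exact: kern_continuous]].
apply: eq_Rintegral => v; rewrite inE/= in_itv/= => v01.
have pos := kern_arg x1 v01; rewrite /kern.
have s0 : Num.sqrt (1 + v ^+ 2 * x) != 0 by rewrite gt_eqF// sqrtr_gt0.
have s2 : Num.sqrt (1 + v ^+ 2 * x) ^+ 2 = 1 + v ^+ 2 * x by rewrite sqr_sqrtr// ltW.
have -> : v ^+ p / Num.sqrt (1 + v ^+ 2 * x) ^+ m.+2 +
  x * (v ^+ p.+2 / Num.sqrt (1 + v ^+ 2 * x) ^+ m.+2) =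
  v ^+ p * (1 + v ^+ 2 * x) / Num.sqrt (1 + v ^+ 2 * x) ^+ m.+2.
  by rewrite !exprS; ring.
rewrite -{2}s2; move: (Num.sqrt _) s0 => s s0.
by rewrite !exprS expr0; field; rewrite s0 expf_neq0.
Qed.

(** Comparison with [m = 0], where the integral is [1 / (p + 1)]; on the interval the denominator is
    at most [sqrt (1 + |x|) ^ m]. *)
Lemma kint_gt0 p m x : -1 < x -> 0 < kint p m x.
Proof.
move=> x1.
have mB : measurable (`[0, 1]%classic : set R) by exact: measurable_itv.
have k0 : p.+1%:R * kint p 0 x = 1.
  have := kint_FTC p 0 x1; rewrite !mul0r subr0 => ->; by rewrite expr0 invr1.
pose b := Num.sqrt (1 + `|x|) ^+ m.
have b0 : 0 < b.
  by rewrite exprn_gt0// sqrtr_gt0 ltr_pwDl.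
have h : b^-1 * kint p 0 x <= kint p m x.
  rewrite /kint -RintegralZl//; last exact: kern_integrable.
  apply: le_Rintegral => //.
  - by apply: continuous_compact_integrable; [exact: segment_compact|
      move=> v; apply: cvgM; [exact: cvg_cst|exact: kern_continuous]].
  - exact: kern_integrable.
  move=> v; rewrite /= in_itv/= => v01; have pos := kern_arg x1 v01.
  have /andP[v0 v1] := v01.
  rewrite /kern expr0 divr1 mulrC ler_wpM2l ?exprn_ge0// lef_pV2 ?posrE//; last first.
    by rewrite exprn_gt0// sqrtr_gt0.
  rewrite lerXn2r ?nnegrE ?sqrtr_ge0// ler_wsqrtr// lerD2l.
  have h1 : v ^+ 2 <= 1 by rewrite exprn_ile1.
  have h0 : 0 <= v ^+ 2 by exact: sqr_ge0.
  apply: le_trans (ler_norm _) _; rewrite normrM (ger0_norm h0).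
  by rewrite ler_piMl.
have k1 : 0 < kint p 0 x.
  by rewrite -(@pmulr_rgt0 _ p.+1%:R) ?k0.
by apply: lt_le_trans h; rewrite mulr_gt0 ?invr_gt0.
Qed.

Lemma Ck_kint k p m : Ck k [set x : R | -1 < x] (kint p m).
Proof.
elim: k p m => [|k IH] p m.
  by move=> x x1; have /dif_is_derive := kint_dx p m x1; exact: dif_cont.
have oD : open [set x : R | -1 < x] by exact: open_gt.
apply: (@Ck_derive1 _ k _ _ (fun x => - (m%:R / 2) * kint p.+2 m.+2 x)) => //.
- by move=> x x1; exact: kint_dx.
- by apply: CkM => //; exact: Ck_cst.
Qed.

End ProfileIntegral.

Lemma mean_value {R : realType} (f df : R -> R) (a b : R) : a <= b ->
  (forall z, a <= z <= b -> is_derive z 1 f (df z)) ->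
  exists2 z, a <= z <= b & f b - f a = df z * (b - a).
Proof.
move=> ab h.
have [||z zI E] := @MVT_segment R f df a b ab.
- by move=> z; rewrite in_itv/= => /andP[z0 z1]; apply: h; rewrite !ltW.
- apply: derivable_within_continuous => z; rewrite in_itv/= => zI.
  by case: (h z zI).
by exists z => //; move: zI; rewrite in_itv.
Qed.

Lemma bernoulli_le {R : realType} (u : R) k : 0 <= u <= 1 -> 1 - k%:R * u <= (1 - u) ^+ k.
Proof.
move=> /andP[u0 u1]; elim: k => [|k IH]; first by rewrite expr0 mul0r subr0.
have h : 0 <= k%:R * u ^+ 2 by rewrite mulr_ge0// sqr_ge0.
have h1 : (1 - u) * (1 - k%:R * u) <= (1 - u) ^+ k.+1.
  by rewrite exprS ler_wpM2l// subr_ge0.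
apply: le_trans h1; rewrite -natr1; move: h; rewrite expr2; lra.
Qed.

(** * Curvature functions of the profile in the variable x *)

Section ProfileFunctions.
Context {R : realType} (n r : nat) (c : R).
Hypotheses (n2 : (2 <= n)%N) (hr : (1 <= r <= n)%N) (c0 : 0 < c).
Implicit Types (x y : R).

(* With x = sinh^2 rho, the substitution v |-> sinh v / sinh rho turns x^(n/2) * pint x
   into \int_0^rho (sinh v)^(n-1) / (cosh v)^(r-1) dv. The radial component of the
   normal is qcur x * sinh rho. *)
Definition pint : R -> R := kint n.-1 r.
Definition pint1 : R -> R := kint n.-1 r.+2.
Definition qcur x := (n%:R * c * pint x) `^ r%:R^-1.
(** This is [ds / d rho] for [s = qcur * sinh rho] (see [qcur_derive]), in a closed form that is
    visibly positive. *)
Definition kapcur x := Num.sqrt (1 + x) * qcur x * pint1 x / pint x.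
Definition hcur x := x * qcur x ^+ 2.

Let n0 : (0 < n)%N. Proof. exact: ltn_trans n2. Qed.
Let r0 : (0 < r)%N. Proof. by case/andP: hr. Qed.
Let rn : (r <= n)%N. Proof. by case/andP: hr. Qed.
Let rR : 0 < r%:R :> R. Proof. by rewrite ltr0n. Qed.
Let nR : 0 < n%:R :> R. Proof. by rewrite ltr0n. Qed.

Lemma pint_gt0 x : -1 < x -> 0 < pint x. Proof. exact: kint_gt0. Qed.
Lemma pint1_gt0 x : -1 < x -> 0 < pint1 x. Proof. exact: kint_gt0. Qed.

Lemma pint_ode x : -1 < x -> exists2 d, is_derive x 1 pint d &
  2 * x * d = (Num.sqrt (1 + x) ^+ r)^-1 - n%:R * pint x.
Proof.
move=> x1; have h := kint_dx n.-1 r x1; exists (- (r%:R / 2) * kint n.-1.+2 r.+2 x) => //.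
by have := kint_FTC n.-1 r x1; rewrite prednK// -/pint => <-; rewrite /pint; field.
Qed.

(** Combines [kint_FTC] and [kint_shift]. Since [pint1 > 0], it bounds [(n - r) * pint] by
    [(cosh rho)^-r], which is the source of [hcur_lt1]; it also brings the curvature into the
    positive form [kapcur]. *)
Lemma pint_relation x : -1 < x ->
  r%:R * pint1 x = (Num.sqrt (1 + x) ^+ r)^-1 - (n%:R - r%:R) * pint x.
Proof.
move=> x1; have := kint_FTC n.-1 r x1; have := kint_shift n.-1 r x1.
rewrite prednK// -/pint -/pint1 => E <-; rewrite /pint /pint1 in E *.
rewrite {2}E; move: (kint _ _ _) (kint _ _ _) (kint _ _ _) E => A B D ->.
by ring.
Qed.

Lemma qcur_gt0 x : -1 < x -> 0 < qcur x.
Proof. by move=> x1; rewrite powR_gt0// !mulr_gt0// pint_gt0. Qed.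

Lemma kapcur_gt0 x : -1 < x -> 0 < kapcur x.
Proof.
move=> x1; rewrite divr_gt0 ?pint_gt0// mulr_gt0 ?pint1_gt0// mulr_gt0 ?qcur_gt0//.
by rewrite sqrtr_gt0; lra.
Qed.

Lemma qcurX x : -1 < x -> qcur x ^+ r = n%:R * c * pint x.
Proof.
move=> x1; rewrite /qcur -powR_mulrn ?powR_ge0// -powRrM mulVf ?gt_eqF// powRr1//.
by rewrite !mulr_ge0// ltW// pint_gt0.
Qed.

Lemma Ck_qcur k : Ck k [set x : R | -1 < x] qcur.
Proof.
have oD : open [set x : R | -1 < x] by exact: open_gt.
apply: (Ck_comp1 oD _ (Ck_powR k r%:R^-1)); last by move=> x x1 /=; rewrite !mulr_gt0// pint_gt0.
by apply: CkM => //; [exact: Ck_cst|exact: Ck_kint].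
Qed.

Lemma qcur_derive x : -1 < x ->
  exists2 d, is_derive x 1 qcur d & Num.sqrt (1 + x) * (qcur x + 2 * x * d) = kapcur x.
Proof.
move=> x1; have [dq _] := Ck_qcur 1 ; have /derivable1_diffP dqx := dq x x1.
exists ('D_1 qcur x); first by split.
have /dif_is_derive hq : is_derive x 1 qcur ('D_1 qcur x) by split.
move: ('D_1 qcur x) hq => d hq.
have [e he ode] := pint_ode x1; have rel := pint_relation x1.
have E : r%:R * qcur x ^+ r.-1 * d = n%:R * c * e.
  have oD : open [set x : R | -1 < x] by exact: open_gt.
  have h1 := difX r hq.
  have h2 := difM (dif_cst (n%:R * c) x) (proj1 (dif_is_derive _ _ _) he).
  have h3 : dif (fun x => qcur x ^+ r) x (fun v => n%:R * c * (v * e) + pint x * 0).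
    apply: dif_near h2; have hn := open_nbhs_nbhs (conj oD x1).
    by apply: filterS hn => y y1; rewrite qcurX.
  by have := dif_derive (1 : R) h3; rewrite (dif_derive (1 : R) h1) !mul1r mulr0 addr0.
have q0 := qcur_gt0 x1; have J0 := pint_gt0 x1.
have X := qcurX x1.
have E2 : r%:R * pint x * d = qcur x * e.
  have nc0 : n%:R * c != 0 by rewrite gt_eqF// mulr_gt0.
  apply: (mulfI nc0); have := congr1 ( *%R (qcur x)) E.
  have -> : qcur x * (r%:R * qcur x ^+ r.-1 * d) = r%:R * (qcur x * qcur x ^+ r.-1) * d by ring.
  rewrite -exprS prednK// X => h.
  by transitivity (r%:R * (n%:R * c * pint x) * d); [ring|rewrite h; ring].
have K0 : r%:R * pint x != 0 by rewrite gt_eqF// mulr_gt0.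
rewrite /kapcur; apply: (mulfI K0).
transitivity (Num.sqrt (1 + x) * (r%:R * pint x * qcur x + 2 * x * (r%:R * pint x * d))); first by ring.
rewrite E2.
transitivity (Num.sqrt (1 + x) * qcur x * (r%:R * pint x + 2 * x * e)); first by ring.
rewrite ode.
transitivity (Num.sqrt (1 + x) * qcur x * (r%:R * pint1 x)); first by rewrite rel; ring.
by field; rewrite gt_eqF.
Qed.

Lemma curvature_equation x : -1 < x ->
  (n%:R - r%:R) * (qcur x * Num.sqrt (1 + x)) ^+ r +
  r%:R * ((qcur x * Num.sqrt (1 + x)) ^+ r.-1 * kapcur x) = n%:R * c.
Proof.
move=> x1; have y0 : 0 < Num.sqrt (1 + x) by rewrite sqrtr_gt0; lra.
have J0 := pint_gt0 x1; have rel := pint_relation x1.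
have -> : r%:R * ((qcur x * Num.sqrt (1 + x)) ^+ r.-1 * kapcur x) =
    (qcur x * Num.sqrt (1 + x)) ^+ r * (r%:R * pint1 x) / pint x.
  have -> : (qcur x * Num.sqrt (1 + x)) ^+ r = (qcur x * Num.sqrt (1 + x)) ^+ r.-1 * (qcur x * Num.sqrt (1 + x)).
    by rewrite -exprSr prednK.
  by rewrite /kapcur; ring.
rewrite rel exprMn qcurX//.
move: (Num.sqrt _) y0 => y y0; have := expf_neq0 r (lt0r_neq0 y0).
move: (y ^+ r) => Y Y0; field; by rewrite Y0 gt_eqF.
Qed.

Lemma hcur_derive x : -1 < x ->
  is_derive x 1 hcur (qcur x * kapcur x / Num.sqrt (1 + x)).
Proof.
move=> x1; have [d /dif_is_derive hd <-] := qcur_derive x1.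
apply/dif_is_derive; apply: dif_eq (difM (dif_id x) (difX 2 hd)) _ => v /=.
have : Num.sqrt (1 + x) != 0 by rewrite gt_eqF// sqrtr_gt0; lra.
move: (Num.sqrt _) => y y0; rewrite expr1; field; exact: y0.
Qed.

Lemma Ck_hcur k : Ck k [set x : R | -1 < x] hcur.
Proof.
have oD : open [set x : R | -1 < x] by exact: open_gt.
apply: CkM => //; first by apply: (@Ck_linear _ _ _ k _ id) => // z; exact: cvg_id.
by apply: CkX => //; exact: Ck_qcur.
Qed.

(** Both integrals equal [1 / n] at [x = 0]: the axis points are umbilic, in agreement with
    [shape_axis]. *)
Lemma kapcur0 : kapcur 0 = qcur 0.
Proof.
have m1 : (-1 : R) < 0 by exact: ltrN10.
have E m : n%:R * kint n.-1 m (0 : R) = 1.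
  by have := kint_FTC n.-1 m m1; rewrite prednK// mulr0 mul0r subr0 addr0 sqrtr1 expr1n invr1.
have J0 := pint_gt0 m1.
have nn : n%:R != 0 :> R by rewrite gt_eqF.
have J1 : pint1 0 = pint 0 by apply: (mulfI nn); rewrite !E.
by rewrite /kapcur J1 addr0 sqrtr1 mul1r mulfK// gt_eqF.
Qed.

Lemma hcur0 : hcur 0 = 0. Proof. by rewrite /hcur mul0r. Qed.

Lemma hcur_incr x y : -1 < x -> x < y -> hcur x < hcur y.
Proof.
move=> x1 xy; rewrite -subr_gt0.
have [z /andP[xz zy] ->] := @mean_value _ hcur
    (fun x => qcur x * kapcur x / Num.sqrt (1 + x)) x y (ltW xy)
    (fun z xzy => hcur_derive (lt_le_trans x1 (proj1 (andP xzy)))).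
have z1 : -1 < z by exact: lt_le_trans xz.
have s0 : 0 < Num.sqrt (1 + z) by rewrite sqrtr_gt0; lra.
apply: mulr_gt0; last by rewrite subr_gt0.
by apply: divr_gt0 => //; apply: mulr_gt0; [exact: qcur_gt0|exact: kapcur_gt0].
Qed.

Lemma hcur_le x y : -1 < x -> x <= y -> hcur x <= hcur y.
Proof.
move=> x1; case: (eqVneq x y) => [-> _|xy xley]; first exact: lexx.
by apply/ltW/hcur_incr => //; rewrite lt_neqAle xy.
Qed.

(** For [x > 0], [pint_relation] and [n c <= n - r] give [q < 1 / cosh rho], so [h] stays below
    [tanh^2 rho]. *)
Lemma hcur_lt1 x : c <= (n%:R - r%:R) / n%:R -> -1 < x -> hcur x < 1.
Proof.
move=> hc x1; case: (leP x 0) => x0.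
  apply: le_lt_trans (ltr01); rewrite /hcur; apply: mulr_le0_ge0 => //; exact: sqr_ge0.
have nrJ : (n%:R - r%:R) * pint x < (Num.sqrt (1 + x) ^+ r)^-1.
  by have := pint1_gt0 x1; have := pint_relation x1 => E P; rewrite -subr_gt0 -E mulr_gt0.
have y0 : 0 < Num.sqrt (1 + x) by rewrite sqrtr_gt0; lra.
have q0 := qcur_gt0 x1; have J0 := pint_gt0 x1.
have h : qcur x ^+ r < ((Num.sqrt (1 + x))^-1) ^+ r.
  rewrite qcurX// exprVn; apply: le_lt_trans nrJ.
  rewrite ler_pM2r//; by move: hc; rewrite ler_pdivlMr// mulrC.
have {}h : qcur x < (Num.sqrt (1 + x))^-1.
  by move: h; rewrite ltr_pXn2r// nnegrE ltW// invr_gt0.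
have {}h : qcur x ^+ 2 < (1 + x)^-1.
  have -> : (1 + x)^-1 = ((Num.sqrt (1 + x))^-1) ^+ 2 by rewrite exprVn sqr_sqrtr//; lra.
  by rewrite ltr_pXn2r// nnegrE ltW// invr_gt0.
rewrite /hcur; apply: lt_trans (_ : x * (1 + x)^-1 < 1).
  by rewrite ltr_pM2l.
by rewrite ltr_pdivrMr; lra.
Qed.

(** Were [h < 1] throughout, the bound [x^(r/2) * n c * pint <= 1] would give [h' >= A / x] for
    large [x], and [h] would grow at least like a logarithm. *)
Lemma hcur_reaches1 : (n%:R - r%:R) / n%:R < c -> exists2 x, 0 < x & hcur x = 1.
Proof.
move=> hc; apply: contrapT => H.
have hcont x : -1 < x -> {for x, continuous hcur}.
  by move=> x1; have /dif_is_derive/dif_cont := hcur_derive x1.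
have lt1 x : 0 <= x -> hcur x < 1.
  move=> x0; rewrite ltNge; apply/negP => h1; apply: H.
  have h0 := hcur0.
  have [||z] := @IVT _ hcur 0 x 1 x0.
  - apply: continuous_in_subspaceT => z; rewrite inE/= in_itv/= => /andP[z0 _].
    by apply: hcont; apply: lt_le_trans z0; exact: ltrN10.
  - by rewrite h0 le_max ge_min ler01 h1 orbT.
  rewrite in_itv/= => /andP[z0 _] zE; exists z => //.
  by rewrite lt_neqAle z0 andbT; apply: contra_eq_neq zE => <-; rewrite h0 eq_sym oner_neq0.
(* [be < 1] is the hypothesis on [c], and [de] is half of the gap [1 - be]: one half is spent on
   comparing [x] with [1 + x], the other remains as a lower bound for [x^(r/2) * r * pint1]. *)
pose be := (n%:R - r%:R) / (n%:R * c); pose de := (1 - be) / 2.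
have nc0 : 0 < n%:R * c by exact: mulr_gt0.
have de0 : 0 < de.
  by rewrite /de divr_gt0// subr_gt0 /be ltr_pdivrMr// mul1r mulrC -ltr_pdivrMr.
(* Beyond [r / de], the Bernoulli inequality makes [(x / (1 + x))^r] at least [1 - de]. *)
pose x0 := r%:R / de.
have x00 : 0 < x0 by exact: divr_gt0.
have h00 : 0 < hcur x0 by rewrite -hcur0 hcur_incr// ltrN10.
pose A := hcur x0 * (de / r%:R * (n%:R * c)).
have A0 : 0 < A by apply: mulr_gt0 => //; apply: mulr_gt0 => //; exact: divr_gt0.
have key x : x0 <= x -> A / x <= qcur x * kapcur x / Num.sqrt (1 + x).
  move=> hx; have xp : 0 < x by exact: lt_le_trans hx.
  have x1 : -1 < x by lra.
  have s0 : 0 < Num.sqrt x by rewrite sqrtr_gt0.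
  have y0 : 0 < Num.sqrt (1 + x) by rewrite sqrtr_gt0; lra.
  have q0 := qcur_gt0 x1; have J0 := pint_gt0 x1; have J10 := pint1_gt0 x1.
  have hJ : Num.sqrt x ^+ r * (n%:R * c * pint x) <= 1.
    have sq0 : 0 <= Num.sqrt x * qcur x by rewrite mulr_ge0// ltW.
    rewrite -qcurX// -exprMn exprn_ile1//.
    rewrite -(@expr_le1 _ 2)// exprMn sqr_sqrtr; last exact: ltW.
    exact: ltW (lt1 _ (ltW xp)).
  have hr1 : 1 - de <= (Num.sqrt x / Num.sqrt (1 + x)) ^+ r.
    have sy : Num.sqrt x / Num.sqrt (1 + x) <= 1.
      by rewrite ler_pdivrMr// mul1r ler_wsqrtr//; lra.
    have sy0 : 0 <= Num.sqrt x / Num.sqrt (1 + x) by rewrite divr_ge0// ltW.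
    have p1 : 0 < 1 + x by lra.
    pose u := (1 + x)^-1.
    have u01 : 0 <= u <= 1 by rewrite invr_ge0 ltW//= invf_le1//; lra.
    have E : (Num.sqrt x / Num.sqrt (1 + x)) ^+ 2 = 1 - u.
      by rewrite expr_div_n !sqr_sqrtr ?ltW// /u; field; rewrite gt_eqF.
    have ru : r%:R * u <= de.
      rewrite ler_pdivrMr// mulrC -ler_pdivrMr//; apply: le_trans hx _; lra.
    apply: le_trans (_ : 1 - r%:R * u <= _); first by rewrite lerD2l lerN2.
    apply: le_trans (bernoulli_le r u01) _; rewrite -E -exprM mulnC exprM expr2.
    by rewrite ler_piMr ?exprn_ge0// exprn_ile1.
  have hM : de <= Num.sqrt x ^+ r * (r%:R * pint1 x).
    rewrite pint_relation// mulrBr; rewrite expr_div_n in hr1.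
    have : Num.sqrt x ^+ r * ((n%:R - r%:R) * pint x) <= be.
      rewrite /be ler_pdivlMr//.
      have -> : Num.sqrt x ^+ r * ((n%:R - r%:R) * pint x) * (n%:R * c) =
        (n%:R - r%:R) * (Num.sqrt x ^+ r * (n%:R * c * pint x)) by ring.
      by rewrite ler_piMr// subr_ge0 ler_nat.
    by move: hr1; rewrite /de; lra.
  have -> : qcur x * kapcur x / Num.sqrt (1 + x) = hcur x / x * (pint1 x / pint x).
    by rewrite /kapcur /hcur; field; rewrite !gt_eqF.
  have h1 : hcur x0 <= hcur x.
    by apply: hcur_le hx; apply: lt_trans x00; exact: ltrN10.
  have h2 : de / r%:R * (n%:R * c) <= pint1 x / pint x.
    rewrite ler_pdivlMr//.
    have -> : de / r%:R * (n%:R * c) * pint x = de * (n%:R * c) * pint x / r%:R by ring.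
    rewrite ler_pdivrMr//.
    have P : 0 < Num.sqrt x ^+ r by rewrite exprn_gt0.
    rewrite -(ler_pM2l P); apply: le_trans (_ : de <= _).
      have -> : Num.sqrt x ^+ r * (de * (n%:R * c) * pint x) = de * (Num.sqrt x ^+ r * (n%:R * c * pint x)) by ring.
      by rewrite ler_piMr// ltW.
    by rewrite [pint1 x * _]mulrC.
  have c1 : 0 <= hcur x0 / x by exact: ltW (divr_gt0 h00 xp).
  have c2 : 0 <= de / r%:R * (n%:R * c) by exact: ltW (mulr_gt0 (divr_gt0 de0 rR) nc0).
  have c3 : hcur x0 / x <= hcur x / x by rewrite ler_pM2r ?invr_gt0.
  rewrite /A mulrAC; exact: ler_pM c1 c2 c3 h2.
(* Chosen so that [A * ln x] exceeds [A * ln x0] by exactly 1, which forces [h x >= 1 + h x0]. *)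
pose x := x0 * expR A^-1.
have x0x : x0 <= x.
  by rewrite /x ler_peMr ?(ltW x00)// -expR0 ler_expR invr_ge0 ltW.
pose d z := qcur z * kapcur z / Num.sqrt (1 + z) - A * z^-1.
have hd z : x0 <= z <= x -> is_derive z 1 (fun z => hcur z - A * ln z) (d z).
  move=> /andP[z0 _]; have zp : 0 < z by exact: lt_le_trans z0.
  apply: is_deriveB; first by apply: hcur_derive; lra.
  by have := is_deriveZ A (is_derive1_ln zp).
have [z /andP[z0 _] E] := mean_value x0x hd.
have dz : 0 <= d z by rewrite subr_ge0 key.
have h2 : 0 <= d z * (x - x0) by rewrite mulr_ge0// subr_ge0.
have h1 : hcur x < 1 by rewrite lt1// (le_trans _ x0x)// ltW.
have lnx : A * ln x = A * ln x0 + 1.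
  by rewrite /x lnM ?posrE ?expR_gt0// expRK mulrDr mulfV// gt_eqF.
rewrite -E lnx in h2; move: h1 h2 h00.
move: (hcur x) (hcur x0) (A * ln x0) => u1 u2 u3.
have -> : u1 - (u3 + 1) - (u2 - u3) = u1 - 1 - u2 by ring.
move=> h1; rewrite subr_ge0 => h2 /lt_le_trans/(_ h2).
by rewrite subr_gt0 => /(lt_trans h1); rewrite ltxx.
Qed.

End ProfileFunctions.

(** * The model surfaces *)

Local Opaque qcur kapcur hcur.

Section Model.
Context {R : realType} (n r : nat) (c : R).
Notation E := ('rV[R]_n.+1 * R)%type.
Variables (S : set E) (o : 'rV[R]_n.+1) (Wf : E -> R).
Hypotheses (n2 : (2 <= n)%N) (hr : (1 <= r <= n)%N) (c0 : 0 < c).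
Hypotheses (HS : hypersurface S) (ho : hyp o).

Definition sq_radius (p : E) : R := hgt o p ^+ 2 - 1.

(** Covers both models. All that the geometry asks of [Wf] is in the hypotheses below; the last,
    [dw = - kappa dt], is formulated with the height because it then holds on the axis too, where
    the radial direction degenerates. *)
Definition model_normal (p : E) : E :=
  (- qcur n r c (sq_radius p) *: (hgt o p *: p.1 - o), Wf p).

Hypothesis Wfc : forall p, S p -> {for p, continuous Wf}.
Hypothesis Wf_unit : forall p, S p -> Wf p ^+ 2 + hcur n r c (sq_radius p) = 1.
Hypothesis Wf_rel : forall U X a v, chart S U X -> U a ->
  qcur n r c (sq_radius (X a)) * lor ('D_v X a).1 o + Wf (X a) * ('D_v X a).2 = 0.
Hypothesis Wf_dif : forall U X a, chart S U X -> U a ->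
  dif (fun b => Wf (X b)) a
    (fun v => - kapcur n r c (sq_radius (X a)) * ('D_v X a).2).

Let SH : S `<=` HxR. Proof. by case: HS. Qed.
Let n0 : (0 < n)%N. Proof. exact: ltn_trans n2. Qed.

Lemma hgt_hyp (p : E) : hyp p.1 -> 1 <= hgt o p.
Proof. by move=> hp; have [] := hyp_lor_le hp ho; rewrite /hgt; lra. Qed.

Lemma sq_radius_ge0 (p : E) : hyp p.1 -> 0 <= sq_radius p.
Proof. by move=> /hgt_hyp h; rewrite /sq_radius subr_ge0 expr_ge1// (le_trans ler01). Qed.

Lemma sq_radius_gtN1 (p : E) : hyp p.1 -> -1 < sq_radius p.
Proof. by move=> /sq_radius_ge0; apply: lt_le_trans; exact: ltrN10. Qed.

Lemma sqrt_sq_radius (p : E) : hyp p.1 -> Num.sqrt (1 + sq_radius p) = hgt o p.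
Proof.
move=> /hgt_hyp h; rewrite /sq_radius addrC subrK sqrtr_sqr ger0_norm//.
exact: le_trans ler01 h.
Qed.

Lemma sq_radius_dif (V : normedModType R) (X : V -> E) a L : dif X a L ->
  dif (fun b => sq_radius (X b)) a (fun v => - (2 * hgt o (X a) * lor (L v).1 o)).
Proof.
move=> hX; have yd := difN (dif_lorl o (dif_fst hX)).
by apply: dif_eq (difB (difX 2 yd) (dif_cst (1 : R) a)) _ => v; rewrite /hgt; ring.
Qed.

Lemma qcur_dif (V : normedModType R) (X : V -> E) a L : hyp (X a).1 -> dif X a L ->
  exists d, dif (fun b => qcur n r c (sq_radius (X b))) a
     (fun v => - (2 * hgt o (X a) * lor (L v).1 o) * d) /\
   hgt o (X a) * (qcur n r c (sq_radius (X a)) + 2 * sq_radius (X a) * d) =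
     kapcur n r c (sq_radius (X a)).
Proof.
move=> hXa hX; have [d hd dE] := qcur_derive n2 hr c0 (sq_radius_gtN1 hXa).
exists d; split; last by rewrite -dE sqrt_sq_radius.
exact: (dif_comp1 (sq_radius_dif hX) hd).
Qed.

Lemma model_unit p : S p ->
  qcur n r c (sq_radius p) ^+ 2 * (hgt o p ^+ 2 - 1) + Wf p ^+ 2 = 1.
Proof.
by move=> Sp; rewrite -[RHS](Wf_unit Sp) -/(sq_radius p) addrC [_ * sq_radius p]mulrC.
Qed.

Lemma model_unit_normal : unit_normal S model_normal.
Proof.
have oo : lor o o = -1 by case: ho.
split.
  apply: continuous_in_subspaceT => p; rewrite inE => Sp.
  have hp := SH Sp.
  have [d [qd _]] := qcur_dif hp (dif_id p).
  have qc := dif_cont qd.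
  have hc : {for p, continuous (hgt o)}.
    exact: dif_cont (difN (dif_lorl o (dif_fst (dif_id p)))).
  have h1 : (- qcur n r c (sq_radius z) *: (hgt o z *: z.1 - o)) @[z --> p] -->
      - qcur n r c (sq_radius p) *: (hgt o p *: p.1 - o).
    apply: cvgZ; first exact: cvgN qc.
    apply: cvgB; last exact: cvg_cst.
    apply: cvgZ; first exact: hc.
    exact: cvg_fst.
  exact: cvg_pair h1 (Wfc Sp).
move=> p Sp; have [pp _] : hyp p.1 := SH Sp.
split.
- by rewrite /model_normal /= !lorlin pp /hgt; ring.
- rewrite /ip /model_normal /= !lorlin pp oo -[RHS](model_unit Sp) [lor o _]lorC /hgt; ring.
- move=> U X a v cX Ua XE; have := Wf_rel v cX Ua; rewrite XE.
  have := chart_tangent SH cX v Ua; rewrite XE /ip /model_normal.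
  move: ('D_v X a) => A xA rel /=.
  by rewrite !lorlin [lor A.1 p.1]lorC xA -[RHS]rel; ring.
Qed.

Lemma model_char_poly U X a : chart S U X -> U a ->
  char_poly (shape_mx model_normal X a) =
  ('X - (qcur n r c (sq_radius (X a)) * hgt o (X a))%:P) ^+ n.-1 *
  ('X - (kapcur n r c (sq_radius (X a)))%:P).
Proof.
move=> cX Ua; have Sp := chart_in cX Ua; have hp : hyp (X a).1 := SH Sp.
have [d [qd dE]] := qcur_dif hp (chart_dif cX Ua).
have uN := model_unit Sp.
have rel : \forall b \near a, forall v,
    qcur n r c (sq_radius (X b)) * lor ('D_v X b).1 o + Wf (X b) * ('D_v X b).2 = 0.
  by apply: filterS (chart_near cX Ua) => b Ub v; exact: Wf_rel cX Ub.
(* On the axis [y = 1] and [shape_axis] gives the eigenvalue [q] throughout; this agrees with the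
   claim because [kapcur] and [qcur] coincide at 0. *)
have := hgt_hyp hp; rewrite le_eqVlt => /predU1P[h1|h1].
  have [_ po] := hyp_lor_le hp ho.
  have {}po : (X a).1 = o by apply: po; move: h1; rewrite /hgt; lra.
  rewrite (shape_axis n0 SH cX Ua (q := qcur n r c (sq_radius (X a))) _ ho uN qd (Wf_dif cX Ua) _ _ rel)//.
  by rewrite -h1 mulr1 /sq_radius -h1 expr1n subrr kapcur0.
have s0 := rad_gt0 h1.
have s2 : rad o (X a) ^+ 2 = hgt o (X a) ^+ 2 - 1.
  by rewrite sqr_sqrtr//; exact: sq_radius_ge0.
have NE : model_normal (X a) = (- qcur n r c (sq_radius (X a)) *: (- lor (X a).1 o *: (X a).1 - o), Wf (X a)) by [].
have [u uT] := profile_direction SH cX Ua NE ho uN (erefl _) (erefl _) rel s0 s2.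
have [e1 e2] := profile_tangent_dot SH cX Ua uN (erefl _) (erefl _) rel s0 s2 u.
have TT := profile_tangent_unit SH cX Ua ho uN s0 s2.
rewrite (shape_off_axis n0 SH cX Ua NE uN qd (Wf_dif cX Ua) (erefl _) (erefl _) rel s0 s2 uT).
move: e1 e2; rewrite {2 4}uT TT !mulr1 => e1 e2.
have {}e1 : lor ('D_u X a).1 o = - (rad o (X a) * Wf (X a)) by rewrite -e1 opprK.
congr (_ * ('X - _%:P)); rewrite e1 e2.
rewrite -/(hgt o (X a)) -dE -s2 in uN *.
move: (qcur n r c (sq_radius (X a))) uN => q uN.
have -> : sq_radius (X a) = rad o (X a) ^+ 2 by rewrite s2.
move: (rad o _) (hgt o _) (Wf _) uN => s y w uN.
transitivity (y * q + 2 * y * d * s ^+ 2 * (q ^+ 2 * s ^+ 2 + w ^+ 2)); first by ring.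
by rewrite uN; ring.
Qed.

Lemma model_curvature p k : S p -> principal_curvatures S model_normal p k ->
  mean_curvature r k = c /\ forall i, 0 < k i.
Proof.
move=> Sp [U [X [a [cX Ua XE]]]]; rewrite (model_char_poly cX Ua) XE => kE.
have hp : hyp p.1 := SH Sp; have x1 := sq_radius_gtN1 hp.
split.
  have nn : n%:R != 0 :> R by rewrite pnatr_eq0 -lt0n.
  apply: (mulfI nn); rewrite (mean_curvature_two n0 hr (esym kE)).
  by rewrite -sqrt_sq_radius// curvature_equation.
move=> i; have [->|->] := two_curvatures_cases n0 i (esym kE).
  by rewrite mulr_gt0 ?qcur_gt0// (lt_le_trans ltr01 (hgt_hyp hp)).
exact: kapcur_gt0.
Qed.

Lemma model_convex : strictly_convex S model_normal.
Proof. by move=> p k Sp /(model_curvature Sp)[]. Qed.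

Lemma model_Hr : Hr_hypersurface r c S model_normal.
Proof.
split=> //; first exact: model_unit_normal.
move=> p Sp; have [U [X [a [cX Ua XE]]]] := proj2 HS p Sp.
exists (two_curvatures n0 (qcur n r c (sq_radius p) * hgt o p) (kapcur n r c (sq_radius p))).
have h : principal_curvatures S model_normal p
   (two_curvatures n0 (qcur n r c (sq_radius p) * hgt o p) (kapcur n r c (sq_radius p))).
  by exists U, X, a; split=> //; rewrite (model_char_poly cX Ua) XE prod_two_curvatures.
by split=> //; exact: (proj1 (model_curvature Sp h)).
Qed.

End Model.

(** * Primitives and inverse functions of one variable *)

Section OneVariable.
Context {R : realType}.
Local Notation mu := (@lebesgue_measure R).

Definition primitive (a : R) (f : R -> R) (x : R) : R := \int[mu]_(t in `[a, x]) f t.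

Lemma primitive_derive (a b x : R) (f : R -> R) : a < x -> x < b ->
  (forall t, a <= t <= b -> {for t, continuous f}) ->
  is_derive x 1 (primitive a f) (f x).
Proof.
move=> ax xb fc.
have fi : mu.-integrable `[a, b] (EFin \o f).
  apply: continuous_compact_integrable; first exact: segment_compact.
  by apply: continuous_in_subspaceT => t; rewrite inE/= in_itv/= => /fc.
have fx : {for x, continuous f} by apply: fc; rewrite !ltW.
have [h1 h2] := continuous_FTC1_closed xb fi ax fx.
split; first exact: h1.
by rewrite -derive1E; exact: h2.
Qed.

Section Inverse.
Variables (f df : R -> R) (a b : R).
Hypotheses (ab : a < b) (fd : forall x, a <= x <= b -> is_derive x 1 f (df x)).
Hypothesis df0 : forall x, a <= x <= b -> 0 < df x.

(** The inverse by choice, with values in the open interval; outside []f a, f b[] it takes the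
    default value 0. *)
Definition inverse_on (s : R) : R := xget 0 [set x | a < x < b /\ f x = s].
Let g := inverse_on.

Lemma deriv_incr x y : a <= x -> x < y -> y <= b -> f x < f y.
Proof.
move=> ax xy yb; rewrite -subr_gt0.
have h z : x <= z <= y -> a <= z <= b.
  by move=> /andP[h1 h2]; rewrite (le_trans ax h1) (le_trans h2 yb).
have [z zI ->] := mean_value (ltW xy) (fun z zI => fd (h z zI)).
by rewrite mulr_gt0 ?df0 ?subr_gt0// h.
Qed.

Lemma deriv_inj x y : a <= x <= b -> a <= y <= b -> f x = f y -> x = y.
Proof.
move=> /andP[ax xb] /andP[ay yb] e; case: (ltgtP x y) => // h.
  by have := deriv_incr ax h yb; rewrite e ltxx.
by have := deriv_incr ay h xb; rewrite e ltxx.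
Qed.

Lemma inverse_onP s : f a < s < f b -> a < g s < b /\ f (g s) = s.
Proof.
move=> /andP[as_ sb].
have [||x] := @IVT _ f a b s (ltW ab).
- apply: continuous_in_subspaceT => x; rewrite inE/= in_itv/= => xI.
  by have /dif_is_derive/dif_cont := fd xI.
- by rewrite ge_min le_max (ltW as_) (ltW sb) orbT.
rewrite in_itv/= => /andP[ax xb] fx.
have h : [set x | a < x < b /\ f x = s] x.
  split=> //; rewrite !lt_neqAle ax xb !andbT; apply/andP; split.
    by apply/eqP => e; move: as_; rewrite e fx ltxx.
  by apply/eqP => e; move: sb; rewrite -e fx ltxx.
exact: (xgetPex 0 (ex_intro _ x h)).
Qed.

Lemma inverse_onK x : a < x < b -> g (f x) = x.
Proof.
move=> /andP[ax xb].
have [|/andP[h1 h2] h3] := @inverse_onP (f x).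
  by rewrite !deriv_incr// ltW.
by apply: deriv_inj => //; rewrite !ltW.
Qed.

Lemma inverse_on_derive s : f a < s < f b -> is_derive s 1 g (df (g s))^-1.
Proof.
move=> sI; have [gI gE] := inverse_onP sI.
have gc : a <= g s <= b by case/andP: gI => h1 h2; rewrite !ltW.
have nI : \forall x \near g s, a < x < b.
  have oI : open [set x : R | a < x < b].
    rewrite (_ : [set x | _] = [set x | a < x] `&` [set x | x < b]).
      by apply: openI; [exact: open_gt|exact: open_lt].
    by apply/seteqP; split=> x /= => [/andP//|[-> ->]].
  exact: open_nbhs_nbhs (conj oI gI).
have c1 : {near g s, cancel f g}.
  by apply: filterS nI => x xI; exact: inverse_onK.
have c2 : {near g s, continuous f}.
  apply: filterS nI => x /andP[h1 h2].
  have xI : a <= x <= b by rewrite !ltW.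
  by have /dif_is_derive/dif_cont := fd xI.
have := is_derive_inverse c1 c2 (fd gc) (lt0r_neq0 (df0 gc)).
by rewrite gE.
Qed.

Lemma open_oo (u v : R) : open [set x : R | u < x < v].
Proof.
rewrite (_ : [set x | _] = [set x | u < x] `&` [set x | x < v]).
  by apply: openI; [exact: open_gt|exact: open_lt].
by apply/seteqP; split=> x /= => [/andP//|[-> ->]].
Qed.

(** Bootstrapping on [g' = 1 / df(g)]: if [g] is C^k, then so is the right side. *)
Lemma Ck_inverse_on k : (forall k, Ck k [set x | a < x < b] df) ->
  Ck k [set s | f a < s < f b] g.
Proof.
move=> hdf; elim: k => [|k IH].
  move=> s sI; have /dif_is_derive := inverse_on_derive sI; exact: dif_cont.
have oD : open [set s | f a < s < f b] by exact: open_oo.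
have H := @Ck_derive1 R k [set s | f a < s < f b] g (fun s => (df (g s))^-1) oD inverse_on_derive.
apply: H.
apply: CkV => //; last first.
  have H2 := @Ck_comp1 R R k _ _ g df oD IH (hdf k).
  by apply: H2 => s sI; exact: (proj1 (inverse_onP sI)).
move=> s sI; have [/andP[h1 h2] _] := inverse_onP sI.
by rewrite gt_eqF// df0// !ltW.
Qed.

End Inverse.
End OneVariable.

(** * Construction of charts and coordinates on the hyperboloid *)

Section Charts.
Context {R : realType} {n : nat}.
Notation E := ('rV[R]_n.+1 * R)%type.

(** A linear left inverse [p] settles the remaining chart conditions: it inverts the differential,
    gives injectivity, and describes the image of [U'] as the part of [S] in [W0] and in the open
    preimage of [U'] under [p]. *)
Lemma chart_of_left_inverse (S : set E) (D : set 'rV[R]_n) (X : 'rV[R]_n -> E)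
  (p : {linear E -> 'rV[R]_n}) (W0 : set E) :
  open D -> smooth_on D X -> continuous p -> (forall a, D a -> p (X a) = a) ->
  open W0 -> X @` D = S `&` W0 -> chart S D X.
Proof.
move=> oD sX pc pX oW XD; split=> //.
- move=> a v Da Xv.
  have h1 : dif (fun b => p (X b)) a (fun v => p ('D_v X a)).
    exact: dif_comp (Ck_dif1 (sX 1) Da) (dif_lin _ pc).
  have h2 : dif (fun b => p (X b)) a id.
    by apply: dif_near (dif_id a); apply: filterS (open_nbhs_nbhs (conj oD Da)) => b Db; rewrite pX.
  by have := dif_derive v h2; rewrite (dif_derive v h1) Xv linear0.
- move=> a b; rewrite !inE => Da Db e; by rewrite -(pX a Da) e pX.
- move=> U' oU' U'D; exists (W0 `&` p @^-1` U'); split.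
    by apply: openI => //; apply: open_comp => // z _; exact: pc.
  apply/seteqP; split=> [_ [a Ua <-]|z [Sz [Wz pz]]].
    have [h1 h2] : (S `&` W0) (X a) by rewrite -XD; exists a => //; exact: U'D.
    by split=> //; split=> //=; rewrite pX//; exact: U'D.
  have : (X @` D) z by rewrite XD.
  by case=> a Da aE; exists a => //; move: pz; rewrite /= -aE pX.
Qed.

Definition normsq (a : 'rV[R]_n) : R := \sum_(i < n) a 0 i ^+ 2.

Lemma normsq_ge0 a : 0 <= normsq a.
Proof. by apply: sumr_ge0 => i _; exact: sqr_ge0. Qed.

Lemma Ck_normsq k (U : set 'rV[R]_n) : open U -> Ck k U normsq.
Proof.
move=> oU; apply: Ck_sum => // i _; apply: CkX => //.
by apply: Ck_coord => //; apply: (@Ck_linear _ _ _ k U id) => // z; exact: cvg_id.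
Qed.

Definition hpoint (y : R) (a : 'rV[R]_n) : 'rV[R]_n.+1 :=
  \row_j if unlift ord0 j is Some i then a 0 i else y.

Definition spatial (x : 'rV[R]_n.+1) : 'rV[R]_n := \row_i x 0 (lift ord0 i).

Lemma hpoint0 y a : hpoint y a 0 0 = y.
Proof. by rewrite mxE unlift_none. Qed.

Lemma hpointS y a i : hpoint y a 0 (lift ord0 i) = a 0 i.
Proof. by rewrite mxE liftK. Qed.

Lemma spatial_hpoint y a : spatial (hpoint y a) = a.
Proof. by apply/rowP => i; rewrite mxE hpointS. Qed.

Lemma hpoint_spatial (x : 'rV[R]_n.+1) : hpoint (x 0 0) (spatial x) = x.
Proof.
by apply/rowP => j; rewrite mxE; case: unliftP => [i ->|->] //; rewrite mxE.
Qed.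

Lemma hyp_hpoint y a : hyp (hpoint y a) <-> 0 < y /\ y ^+ 2 = 1 + normsq a.
Proof.
rewrite /hyp /lor /= hpoint0 (_ : \sum_(i < n) _ = normsq a); last first.
  by apply: eq_bigr => i _; rewrite hpointS expr2.
by rewrite -expr2; split=> -[h1 h2]; split=> //; move: h1 h2; lra.
Qed.

Lemma hyp_spatial (x : 'rV[R]_n.+1) : hyp x <-> 0 < x 0 0 /\ x 0 0 ^+ 2 = 1 + normsq (spatial x).
Proof. by rewrite -{1}(hpoint_spatial x) hyp_hpoint. Qed.

Lemma Ck_hpoint k (V : normedModType R) (U : set V) (y : V -> R) (f : V -> 'rV[R]_n) :
  open U -> Ck k U y -> Ck k U f -> Ck k U (fun b => hpoint (y b) (f b)).
Proof.
move=> oU cy cf; apply: Ck_mx => // i j.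
case: (unliftP ord0 j) => [l ->|->].
  apply: (@Ck_ext _ _ _ k U (fun b => f b 0 l)) => //.
    by move=> b _; rewrite ord1 hpointS.
  exact: Ck_coord.
by apply: (@Ck_ext _ _ _ k U y) => // b _; rewrite ord1 hpoint0.
Qed.

End Charts.

Local Opaque primitive.

(** * The entire graph *)

Section GraphModel.
Context {R : realType} (n r : nat) (c : R).
Notation E := ('rV[R]_n.+1 * R)%type.
Hypotheses (n2 : (2 <= n)%N) (hr : (1 <= r <= n)%N) (c0 : 0 < c).
Hypothesis hc : c <= (n%:R - r%:R) / n%:R.
Let o : 'rV[R]_n.+1 := base_point.

(** This is [dt/dx]: along the profile [dt/d rho = s / w] with [s = q sinh rho], [w = sqrt (1 - h)],
    and [dx = 2 sinh rho cosh rho d rho]. *)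
Definition slope (x : R) : R :=
  qcur n r c x / (2 * Num.sqrt (1 + x) * Num.sqrt (1 - hcur n r c x)).
(** The base point lies strictly to the left of the axis value 0, so that the profile is smooth in a
    neighbourhood of 0 and the graph is smooth at the axis. *)
Definition graph_profile : R -> R := primitive (- 2^-1) slope.
Definition graph_surface : set E :=
  [set p | hyp p.1 /\ p.2 = graph_profile (sq_radius o p)].
Definition graph_wf (p : E) : R := Num.sqrt (1 - hcur n r c (sq_radius o p)).

Let ho : hyp o := hyp_base.

Let h1 (x : R) : -1 < x -> 0 < 1 - hcur n r c x.
Proof. by move=> x1; rewrite subr_gt0 hcur_lt1. Qed.

Lemma Ck_slope k : Ck k [set x : R | -1 < x] slope.
Proof.
have oD : open [set x : R | -1 < x] by exact: open_gt.
have idC : Ck k [set x : R | -1 < x] id by apply: Ck_linear => // z; exact: cvg_id.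
apply: CkM => //; first exact: Ck_qcur.
apply: CkV => //; last first.
  apply: CkM => //; first apply: CkM => //; first exact: Ck_cst.
    apply: (@Ck_comp1 R R k _ _ (fun x : R => 1 + x) Num.sqrt oD _ (Ck_sqrt k)).
      by apply: CkD => //; exact: Ck_cst.
    by move=> x /= x1; lra.
  apply: (@Ck_comp1 R R k _ _ (fun x : R => 1 - hcur n r c x) Num.sqrt oD _ (Ck_sqrt k)).
    by apply: CkB => //; [exact: Ck_cst|exact: Ck_hcur].
  by move=> x /h1.
move=> x x1; have s1 := h1 x1; have s2 : 0 < 1 + x by move: x1 => /=; lra.
by rewrite gt_eqF// !mulr_gt0// sqrtr_gt0.
Qed.

Lemma graph_profile_derive (x : R) : - 2^-1 < x -> is_derive x 1 graph_profile (slope x).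
Proof.
move=> x1; apply: (@primitive_derive _ _ (x + 1)) => //; first by rewrite ltrDl.
move=> t /andP[t1 _]; have := Ck_slope 0; apply; apply: lt_le_trans t1; lra.
Qed.

Lemma Ck_graph_profile k : Ck k [set x : R | - 2^-1 < x] graph_profile.
Proof.
have oD : open [set x : R | - 2^-1 < x] by exact: open_gt.
apply: CkS_Ck; apply: (@Ck_derive1 _ k _ _ slope) => //; first exact: graph_profile_derive.
by apply: Ck_sub (Ck_slope k) => x /=; lra.
Qed.

Lemma hgt_base (p : E) : hgt o p = p.1 0 0.
Proof. by rewrite /hgt lor_base opprK. Qed.

Lemma sq_radius_hpoint y a (t : R) : y ^+ 2 = 1 + normsq a ->
  sq_radius o (hpoint y a, t) = normsq a.
Proof. by rewrite /sq_radius hgt_base /= hpoint0 => ->; ring. Qed.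

Definition graph_chart (a : 'rV[R]_n) : E :=
  (hpoint (Num.sqrt (1 + normsq a)) a, graph_profile (normsq a)).

Let s1 (a : 'rV[R]_n) : 0 < 1 + normsq a. Proof. by rewrite ltr_pwDl// normsq_ge0. Qed.

Lemma spatial_linear : linear (fun p : E => spatial p.1).
Proof. by move=> k u v; apply/rowP => i; rewrite !mxE. Qed.

Lemma spatial_continuous : continuous (fun p : E => spatial p.1).
Proof.
move=> p; apply: (@dif_cont _ _ _ _ _ (fun v : E => spatial v.1)).
apply: dif_mx => i j.
have h := dif_coord 0 (lift ord0 j) (dif_fst (dif_id p)).
rewrite (_ : (fun y : E => spatial y.1 i j) = (fun y : E => y.1 0 (lift ord0 j))).
  exact: h.
by apply/funext => y; rewrite mxE.
Qed.

Lemma Ck_hyp_height k (U : set 'rV[R]_n) : open U ->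
  Ck k U (fun a => Num.sqrt (1 + normsq a)).
Proof.
move=> oU; apply: (@Ck_comp1 _ _ k U _ (fun a => 1 + normsq a) _ oU _ (Ck_sqrt k)).
  by apply: CkD => //; [exact: Ck_cst|exact: Ck_normsq].
by move=> a _; exact: s1.
Qed.

Lemma graph_chart_image : graph_chart @` setT = graph_surface.
Proof.
apply/seteqP; split=> [_ [a _ <-]|[z t] [/= /hyp_spatial[z0 z2] ->]].
  split=> /=.
    by apply/hyp_hpoint; rewrite sqrtr_gt0 s1 sqr_sqrtr// ltW.
  by rewrite sq_radius_hpoint// sqr_sqrtr// ltW.
exists (spatial z) => //; rewrite /graph_chart -z2 sqrtr_sqr ger0_norm ?ltW//.
rewrite hpoint_spatial; congr (_, graph_profile _).
by rewrite /sq_radius hgt_base /= z2; ring.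
Qed.

Lemma graph_chartP : chart graph_surface setT graph_chart.
Proof.
pose L : {linear E -> 'rV[R]_n} := HB.pack (fun p : E => spatial p.1)
  (GRing.isLinear.Build R E 'rV[R]_n *:%R _ spatial_linear).
apply: (@chart_of_left_inverse _ _ _ _ _ L setT) => //.
- exact: openT.
- move=> k; apply: Ck_pair; [exact: openT| |].
    apply: Ck_hpoint; [exact: openT|by apply: Ck_hyp_height; exact: openT|].
    by apply: Ck_linear; [exact: openT| |move=> z; exact: cvg_id].
  apply: (@Ck_comp1 _ _ k _ _ normsq _ openT (Ck_normsq k openT) (Ck_graph_profile k)).
  by move=> a _ /=; apply: lt_le_trans (normsq_ge0 a); lra.
- exact: spatial_continuous.
- by move=> a _; exact: spatial_hpoint.
- exact: openT.
by rewrite setIT graph_chart_image.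
Qed.

Lemma graph_hypersurface : hypersurface graph_surface.
Proof.
split=> [p [] //|p Sp]; exists setT, graph_chart.
have [a _ aE] : (graph_chart @` setT) p by rewrite graph_chart_image.
by exists a; split=> //; exact: graph_chartP.
Qed.

Lemma graph_entire : entire_graph graph_surface.
Proof.
exists (fun z => graph_profile (z 0 0 ^+ 2 - 1)); split; last first.
  by apply/seteqP; split=> p [h e]; split=> //; rewrite e /sq_radius hgt_base.
move=> x /hyp_spatial[x0 x2].
exists [set z : 'rV[R]_n.+1 | - 2^-1 < z 0 0 ^+ 2 - 1], (fun z => graph_profile (z 0 0 ^+ 2 - 1)).
have idC k : Ck k setT (fun z : 'rV[R]_n.+1 => z 0 0 ^+ 2 - 1).
  apply: CkB; [exact: openT| |exact: Ck_cst openT].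
  apply: CkX; first exact: openT.
  apply: Ck_coord; first exact: openT.
  by apply: Ck_linear; [exact: openT| |move=> z; exact: cvg_id].
have oW : open [set z : 'rV[R]_n.+1 | - 2^-1 < z 0 0 ^+ 2 - 1].
  apply: (@open_comp _ _ (fun z : 'rV[R]_n.+1 => z 0 0 ^+ 2 - 1) [set x | - 2^-1 < x]).
    by move=> z _; exact: (idC 0%N z I).
  exact: open_gt.
split=> //.
- rewrite /= x2; have := normsq_ge0 (spatial x); lra.
- move=> k; apply: (@Ck_comp1 _ _ k _ _ (fun z : 'rV[R]_n.+1 => z 0 0 ^+ 2 - 1) _ oW _ (Ck_graph_profile k)).
    exact: Ck_sub (idC k).
  by [].
Qed.

Lemma graph_rotational : rotational graph_surface.
Proof.
exists o; split=> // A [Aiso _ oA] p [hp pE]; split=> /=.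
  by apply: (isometry_hyp Aiso ho) => //; rewrite oA.
by rewrite pE /sq_radius /hgt /= -{2}oA Aiso.
Qed.

Let rel U X a v : chart graph_surface U X -> U a ->
  graph_wf (X a) * ('D_v X a).2 = - (qcur n r c (sq_radius o (X a)) * lor ('D_v X a).1 o).
Proof.
move=> cX Ua; have SH := proj1 graph_hypersurface.
have hp := chart_hyp SH cX Ua; have x0 := sq_radius_ge0 ho hp.
have x1 := sq_radius_gtN1 ho hp; have w1 := h1 x1.
have xh : - 2^-1 < sq_radius o (X a) by apply: lt_le_trans x0; lra.
have hd := dif_comp1 (sq_radius_dif o (chart_dif cX Ua)) (graph_profile_derive xh).
have hd2 : dif (fun b => (X b).2) a (fun v =>
    - (2 * hgt o (X a) * lor ('D_v X a).1 o) * slope (sq_radius o (X a))).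
  apply: dif_near hd; apply: filterS (chart_near cX Ua) => b Ub.
  by have [_ ->] := chart_in cX Ub.
have -> := etrans (esym (dif_derive v (dif_snd (chart_dif cX Ua)))) (dif_derive v hd2).
have s0 : Num.sqrt (1 + sq_radius o (X a)) != 0 by rewrite gt_eqF// sqrtr_gt0; lra.
have w0 : graph_wf (X a) != 0 by rewrite gt_eqF// sqrtr_gt0.
rewrite /slope -/(graph_wf (X a)) -(sqrt_sq_radius ho hp).
move: ('D_v X a) (graph_wf _) (Num.sqrt _) s0 w0 => V w y y0 w0.
by field; rewrite y0 w0.
Qed.

Lemma graph_wf_dif (V : normedModType R) (X : V -> E) (a : V) (L : V -> E) : hyp (X a).1 -> dif X a L ->
  dif (fun b => graph_wf (X b)) a (fun w =>
   qcur n r c (sq_radius o (X a)) * kapcur n r c (sq_radius o (X a))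
     * lor (L w).1 o / graph_wf (X a)).
Proof.
move=> hp hX; have x1 := sq_radius_gtN1 ho hp; have w1 := h1 x1.
have hd := dif_comp1 (sq_radius_dif o hX) (hcur_derive n2 hr c0 x1).
have s0 : Num.sqrt (1 + sq_radius o (X a)) != 0 by rewrite gt_eqF// sqrtr_gt0; lra.
have w0 : graph_wf (X a) != 0 by rewrite gt_eqF// sqrtr_gt0.
apply: dif_eq (dif_comp1 (difB (dif_cst (1 : R) a) hd) (is_derive1_sqrt w1)) _ => v.
rewrite -/(graph_wf (X a)) -(sqrt_sq_radius ho hp).
move: (L v) (graph_wf _) (Num.sqrt _) s0 w0 => A w y y0 w0.
by field; rewrite y0 w0.
Qed.

Definition graph_normal : E -> E := model_normal r c o graph_wf.

Lemma graph_model : entire_rotational_Hr_graph r c graph_surface graph_normal /\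
  strictly_convex graph_surface graph_normal.
Proof.
have HS := graph_hypersurface; have SH := proj1 HS.
have Wc p : graph_surface p -> {for p, continuous graph_wf}.
  by move=> /SH hp; exact: dif_cont (graph_wf_dif hp (dif_id p)).
have Wu p : graph_surface p -> graph_wf p ^+ 2 + hcur n r c (sq_radius o p) = 1.
  move=> /SH hp; have w1 := h1 (sq_radius_gtN1 ho hp).
  by rewrite sqr_sqrtr ?subrK// ltW.
have Wr U X a v : chart graph_surface U X -> U a ->
    qcur n r c (sq_radius o (X a)) * lor ('D_v X a).1 o + graph_wf (X a) * ('D_v X a).2 = 0.
  by move=> cX Ua; rewrite (rel v cX Ua) addrN.
have Wd U X a : chart graph_surface U X -> U a -> dif (fun b => graph_wf (X b)) a
    (fun v => - kapcur n r c (sq_radius o (X a)) * ('D_v X a).2).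
  move=> cX Ua; have hp := chart_hyp SH cX Ua.
  have w1 := h1 (sq_radius_gtN1 ho hp).
  have w0 : graph_wf (X a) != 0 by rewrite gt_eqF// sqrtr_gt0.
  apply: dif_eq (graph_wf_dif hp (chart_dif cX Ua)) _ => v.
  apply: (mulIf w0); rewrite divfK//; have := rel v cX Ua.
  move: ('D_v X a) (graph_wf (X a)) (qcur _ _ _ _) (kapcur _ _ _ _) => V w q k H.
  by transitivity (- k * (w * V.2)); [rewrite H; ring|ring].
split; last exact: (model_convex n2 hr c0 HS ho Wu Wr Wd).
split; [exact: model_Hr|exact: graph_entire|exact: graph_rotational].
Qed.

End GraphModel.

Local Opaque inverse_on.

(** * The closed profile curve *)

Section CompactProfile.
Context {R : realType} (n r : nat) (c xs : R).
Hypotheses (n2 : (2 <= n)%N) (hr : (1 <= r <= n)%N) (c0 : 0 < c).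
Hypotheses (xs0 : 0 < xs) (hxs : hcur n r c xs = 1).
Local Notation h := (hcur n r c).
Local Notation kap := (kapcur n r c).
Local Notation q := (qcur n r c).

Let dh (x : R) : R := q x * kap x / Num.sqrt (1 + x).
(** [[lo, hi]] leaves room on both sides of [[0, xs]], so that the poles [x = 0] and the equator
    [x = xs] are interior points for the inverse function [chi]. *)
Let lo : R := - 2^-1.
Let hi : R := xs + 1.

Let lo1 (x : R) : lo <= x -> -1 < x.
Proof. by apply: lt_le_trans; rewrite /lo; lra. Qed.

Let hd (x : R) : lo <= x <= hi -> is_derive x 1 h (dh x).
Proof. by move=> /andP[/lo1 x1 _]; exact: hcur_derive. Qed.

Let dh0 (x : R) : lo <= x <= hi -> 0 < dh x.
Proof.
move=> /andP[/lo1 x1 _]; have s0 : 0 < Num.sqrt (1 + x) by rewrite sqrtr_gt0; lra.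
by apply: divr_gt0 => //; apply: mulr_gt0; [exact: qcur_gt0|exact: kapcur_gt0].
Qed.

Let lohi : lo < hi. Proof. by move: xs0; rewrite /lo /hi; lra. Qed.

Lemma Ck_kapcur k : Ck k [set x : R | -1 < x] kap.
Proof.
have oD : open [set x : R | -1 < x] by exact: open_gt.
apply: CkM => //; last first.
  by apply: CkV => //; [move=> x x1; rewrite gt_eqF// pint_gt0|exact: Ck_kint].
apply: CkM => //; last exact: Ck_kint.
apply: CkM => //; last exact: Ck_qcur.
apply: (@Ck_comp1 R R k _ _ (fun x : R => 1 + x) Num.sqrt oD _ (Ck_sqrt k)).
  apply: CkD => //; first exact: Ck_cst.
  by apply: Ck_linear => // z; exact: cvg_id.
by move=> x /= x1; lra.
Qed.

Let Ck_dh k : Ck k [set x : R | lo < x < hi] dh.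
Proof.
have oD : open [set x : R | -1 < x] by exact: open_gt.
apply: (@Ck_sub _ _ _ _ [set x : R | -1 < x]) => [x /= /andP[/ltW/lo1 //]|].
apply: CkM => //; first by apply: CkM => //; [exact: Ck_qcur|exact: Ck_kapcur].
apply: CkV => //.
  by move=> x x1; rewrite gt_eqF// sqrtr_gt0; move: x1 => /=; lra.
apply: (@Ck_comp1 R R k _ _ (fun x : R => 1 + x) Num.sqrt oD _ (Ck_sqrt k)).
  apply: CkD => //; first exact: Ck_cst.
  by apply: Ck_linear => // z; exact: cvg_id.
by move=> x /= x1; lra.
Qed.

(* The profile of the compact surface is parametrized by the vertical component w
   of its normal: h x = 1 - w^2 gives x, and dt / dw = - 1 / kapcur x gives t. *)
Definition chi : R -> R := inverse_on h lo hi.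

Let hlo : h lo < 0.
Proof. by rewrite -(hcur0 n r c); apply: hcur_incr => //; rewrite /lo; lra. Qed.

Let hhi : 1 < h hi.
Proof. by rewrite -hxs; apply: hcur_incr => //; move: xs0; rewrite /hi; lra. Qed.

Lemma hcur_le1 (x : R) : 0 <= x -> h x <= 1 -> x <= xs.
Proof.
move=> x0 hx; rewrite leNgt; apply/negP => xx.
have : h xs < h x by apply: hcur_incr => //; move: xs0; lra.
by rewrite hxs ltNge hx.
Qed.

Lemma chiK (x : R) : 0 <= x -> h x <= 1 -> chi (h x) = x.
Proof.
move=> x0 /(hcur_le1 x0) xx; apply: (inverse_onK lohi hd dh0).
by rewrite /lo /hi; apply/andP; split; lra.
Qed.

(** The range of [w] must exceed [[-1, 1]] for smoothness at the poles; [|w| <= bb] still keeps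
    [1 - w^2] above [h lo / 2], hence inside the range where [chi] inverts [h]. *)
Let bb : R := Num.sqrt (1 - h lo / 2).
Definition wmax : R := (1 + bb) / 2.

Let bb1 : 1 < bb.
Proof.
rewrite -[ltLHS]sqrtr1 ltr_sqrt; move: hlo; move: (h lo) => u u0; lra.
Qed.

Lemma wmax_gt1 : 1 < wmax. Proof. by rewrite /wmax; move: bb1; move: bb => u; lra. Qed.

Let wmax_bb : wmax < bb. Proof. by rewrite /wmax; move: bb1; move: bb => u; lra. Qed.

Let chidom (w : R) : - bb <= w <= bb -> h lo < 1 - w ^+ 2 < h hi.
Proof.
move=> wb; have w2 : w ^+ 2 <= 1 - h lo / 2.
  have <- : bb ^+ 2 = 1 - h lo / 2.
    by rewrite sqr_sqrtr//; move: hlo; move: (h lo) => u u0; lra.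
  by rewrite -[w ^+ 2]real_normK ?num_real// lerXn2r ?nnegrE ?sqrtr_ge0// ler_norml.
have := sqr_ge0 w; move: hlo hhi w2; move: (h lo) (h hi) (w ^+ 2) => u v z.
by move=> *; apply/andP; split; lra.
Qed.

Let chiP (w : R) : - bb <= w <= bb -> lo < chi (1 - w ^+ 2) < hi /\ h (chi (1 - w ^+ 2)) = 1 - w ^+ 2.
Proof. by move=> /chidom; exact: (inverse_onP lohi hd). Qed.

Let wbb (w : R) : - wmax <= w <= wmax -> - bb <= w <= bb.
Proof.
move=> /andP[w1 w2]; have := wmax_bb; move: wmax bb w1 w2 => u v w1 w2 uv.
by apply/andP; split; lra.
Qed.

Lemma chi_gtN1 (w : R) : - wmax <= w <= wmax -> -1 < chi (1 - w ^+ 2).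
Proof. by move=> /wbb /chiP[/andP[/ltW/lo1]]. Qed.

Lemma hcur_chi (w : R) : - wmax <= w <= wmax -> h (chi (1 - w ^+ 2)) = 1 - w ^+ 2.
Proof. by move=> /wbb /chiP[]. Qed.

Let oB : open [set w : R | - bb < w < bb]. Proof. exact: open_oo. Qed.

Let Ck_chibb k : Ck k [set w : R | - bb < w < bb] (fun w => chi (1 - w ^+ 2)).
Proof.
have H := @Ck_comp1 R R k _ _ (fun w : R => 1 - w ^+ 2) chi oB _ (Ck_inverse_on lohi hd dh0 k Ck_dh).
apply: H.
  apply: CkB => //; first exact: Ck_cst.
  by apply: CkX => //; apply: (@Ck_linear _ _ _ _ _ id) => // z; exact: cvg_id.
by move=> w /andP[w1 w2]; apply: chidom; rewrite !ltW.
Qed.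

Let rate (w : R) : R := (kap (chi (1 - w ^+ 2)))^-1.

Let Ck_rate k : Ck k [set w : R | - bb < w < bb] rate.
Proof.
apply: CkV => //.
  move=> w /andP[w1 w2]; have wI : - bb <= w <= bb by rewrite !ltW.
  have [/andP[/ltW/lo1 h1 _] _] := chiP wI.
  by rewrite gt_eqF// kapcur_gt0.
have H := @Ck_comp1 R R k _ _ (fun w : R => chi (1 - w ^+ 2)) kap oB (Ck_chibb k) (Ck_kapcur k).
apply: H => w /andP[w1 w2]; have wI : - bb <= w <= bb by rewrite !ltW.
by have [/andP[/ltW/lo1 h1 _] _] := chiP wI.
Qed.

(** Strictly between [wmax] and [bb], so that [- wmax] is an interior point for the primitive
    [height_of]. *)
Let mid : R := (wmax + bb) / 2.

Definition height_of : R -> R := primitive (- mid) rate.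

Lemma height_of_derive (w : R) : - wmax <= w <= wmax ->
  is_derive w 1 height_of (kap (chi (1 - w ^+ 2)))^-1.
Proof.
move=> /andP[w1 w2]; apply: (@primitive_derive _ _ mid) => //.
- by move: wmax_bb w1; rewrite /mid; move: wmax bb => u v; lra.
- by move: wmax_bb w2; rewrite /mid; move: wmax bb => u v; lra.
move=> t /andP[t1 t2]; apply: (Ck_rate 0); move: wmax_bb t1 t2; rewrite /mid /=.
by move: wmax bb => u v *; apply/andP; split; lra.
Qed.

Lemma Ck_chi k : Ck k [set w : R | - wmax < w < wmax] (fun w => chi (1 - w ^+ 2)).
Proof.
apply: Ck_sub (Ck_chibb k) => w /= /andP[w1 w2]; move: wmax_bb w1 w2.
by move: wmax bb => u v *; apply/andP; split; lra.
Qed.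

Let Ck_rate' k : Ck k [set w : R | - wmax < w < wmax] rate.
Proof.
apply: Ck_sub (Ck_rate k) => w /= /andP[w1 w2]; move: wmax_bb w1 w2.
by move: wmax bb => u v *; apply/andP; split; lra.
Qed.

Lemma Ck_height_of k : Ck k [set w : R | - wmax < w < wmax] height_of.
Proof.
have oD : open [set w : R | - wmax < w < wmax] by exact: open_oo.
apply: CkS_Ck; apply: (@Ck_derive1 _ k _ _ rate) => //.
by move=> w /andP[w1 w2]; apply: height_of_derive; rewrite !ltW.
Qed.

Let rate0 (w : R) : - wmax <= w <= wmax -> 0 < rate w.
Proof. by move=> /chi_gtN1 h1; rewrite invr_gt0 kapcur_gt0. Qed.

Let wmax_oo : - wmax < wmax.
Proof. by have := wmax_gt1; move: wmax => u; lra. Qed.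

Lemma height_of_incr (w z : R) : - wmax <= w -> w < z -> z <= wmax -> height_of w < height_of z.
Proof. exact: (deriv_incr height_of_derive rate0). Qed.

(** Recovers the component [w] of the normal from the height, which makes [w] a function on the
    ambient space ([compact_wf]). *)
Definition angle_of : R -> R := inverse_on height_of (- wmax) wmax.

Lemma angle_ofK (w : R) : - wmax < w < wmax -> angle_of (height_of w) = w.
Proof. exact: (inverse_onK wmax_oo height_of_derive rate0). Qed.

Lemma angle_ofP (t : R) : height_of (- wmax) < t < height_of wmax ->
  - wmax < angle_of t < wmax /\ height_of (angle_of t) = t.
Proof. exact: (inverse_onP wmax_oo height_of_derive). Qed.

Lemma angle_of_derive (t : R) : height_of (- wmax) < t < height_of wmax ->
  is_derive t 1 angle_of (kap (chi (1 - angle_of t ^+ 2))).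
Proof.
move=> /(inverse_on_derive wmax_oo height_of_derive rate0) H.
by apply: is_derive_eq H _; rewrite invrK.
Qed.

Lemma Ck_angle_of k :
  Ck k [set t : R | height_of (- wmax) < t < height_of wmax] angle_of.
Proof. exact: (Ck_inverse_on wmax_oo height_of_derive rate0 k Ck_rate'). Qed.

Lemma chi0 : chi 0 = 0.
Proof. by rewrite -{1}(hcur0 n r c) chiK// hcur0. Qed.

Lemma chi1 : chi 1 = xs.
Proof. by rewrite -{1}hxs chiK// ?hxs// ltW. Qed.

Lemma chi_ge0 (w : R) : -1 <= w <= 1 -> 0 <= chi (1 - w ^+ 2).
Proof.
move=> /andP[w1 w2].
have wm : - wmax <= w <= wmax.
  by have := wmax_gt1; move: wmax => u *; apply/andP; split; lra.
have hE := hcur_chi wm; have c1 := chi_gtN1 wm.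
rewrite leNgt; apply/negP => cn.
have : h (chi (1 - w ^+ 2)) < h 0 by exact: hcur_incr.
rewrite hE hcur0 ltNge subr_ge0 => /negP; apply.
by rewrite -real_normK ?num_real// exprn_ile1// ler_norml w1 w2.
Qed.

End CompactProfile.

Local Opaque chi wmax height_of angle_of.

(** * An atlas for the compact model *)

Section CompactModel.
Context {R : realType} (n r : nat) (c xs : R).
Notation E := ('rV[R]_n.+1 * R)%type.
Hypotheses (n2 : (2 <= n)%N) (hr : (1 <= r <= n)%N) (c0 : 0 < c).
Hypotheses (xs0 : 0 < xs) (hxs : hcur n r c xs = 1).
Local Notation h := (hcur n r c).
Local Notation kap := (kapcur n r c).
Local Notation chi := (chi n r c xs).
Local Notation wm := (wmax n r c).
Local Notation P := (height_of n r c xs).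
Local Notation V := (angle_of n r c xs).
Let o : 'rV[R]_n.+1 := base_point.
Let ho : hyp o := hyp_base.

(** Both signs of [w] are allowed at a given radius, which yields the lower half ([w > 0]) and the
    upper half. The minus sign in the height makes the normal with vertical component [w] point
    inwards. *)
Definition compact_surface : set E := [set p | hyp p.1 /\
  exists w, w ^+ 2 + h (sq_radius o p) = 1 /\ p.2 = - P w].
Definition compact_wf (p : E) : R := V (- p.2).

Let dom : set R := [set t | P (- wm) < t < P wm].

Let wm1 : 1 < wm. Proof. exact: wmax_gt1. Qed.

Lemma wmax_lt (w : R) : -1 <= w <= 1 -> - wm < w < wm.
Proof. by move: wm1; move: wm => u; move=> ? /andP[? ?]; apply/andP; split; lra. Qed.

Lemma wmax_le (w : R) : -1 <= w <= 1 -> - wm <= w <= wm.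
Proof. by move=> /wmax_lt/andP[? ?]; rewrite !ltW. Qed.

Lemma hcur_ge0 (x : R) : 0 <= x -> 0 <= h x.
Proof. by move=> x0; rewrite -(hcur0 n r c); apply: hcur_le => //; exact: ltrN10. Qed.

Let sqr_le1 (w : R) : w ^+ 2 <= 1 -> -1 <= w <= 1.
Proof. by rewrite -real_normK ?num_real// expr_le1// ler_norml. Qed.

Lemma height_of_dom (w : R) : -1 <= w <= 1 -> dom (P w).
Proof.
move=> /wmax_lt/andP[w1 w2]; have wl := ltW w1; have wr := ltW w2; rewrite /dom /=.
by rewrite !(height_of_incr n2 hr c0 xs0 hxs).
Qed.

Lemma compact_surfaceP p : compact_surface p -> [/\ -1 <= compact_wf p <= 1,
  compact_wf p ^+ 2 + h (sq_radius o p) = 1, p.2 = - P (compact_wf p),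
  sq_radius o p = chi (1 - compact_wf p ^+ 2) & dom (- p.2)].
Proof.
move=> [hp [w [w2 pE]]].
have x0 := sq_radius_ge0 ho hp; have h0 := hcur_ge0 x0.
have w1 : -1 <= w <= 1.
  by apply: sqr_le1; move: w2 h0; move: (h _) (w ^+ 2) => u v; lra.
have wE : compact_wf p = w.
  rewrite /compact_wf pE opprK; exact: (angle_ofK n2 hr c0 xs0 hxs (wmax_lt w1)).
rewrite wE; split=> //; last by rewrite pE opprK; exact: height_of_dom.
have -> : 1 - w ^+ 2 = h (sq_radius o p) by rewrite -w2 addrC addKr.
rewrite (chiK n2 hr c0 xs0 hxs)//.
by move: w2 (sqr_ge0 w); move: (h _) (w ^+ 2) => u v; lra.
Qed.

Lemma compact_surface_in y a w : 0 < y -> y ^+ 2 = 1 + normsq a ->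
  w ^+ 2 + h (normsq a) = 1 -> compact_surface (hpoint y a, - P w).
Proof.
move=> y0 y2 w2; split; first exact/hyp_hpoint.
by exists w; rewrite sq_radius_hpoint.
Qed.

Let y_gt0 (a : 'rV[R]_n) : 0 < Num.sqrt (1 + normsq a).
Proof. by rewrite sqrtr_gt0 ltr_pwDl// normsq_ge0. Qed.

Let y_sqr (a : 'rV[R]_n) : Num.sqrt (1 + normsq a) ^+ 2 = 1 + normsq a.
Proof. by rewrite sqr_sqrtr// addr_ge0// normsq_ge0. Qed.

Lemma hyp_hpointE (p : E) : hyp p.1 -> [/\ Num.sqrt (1 + normsq (spatial p.1)) = p.1 0 0,
  sq_radius o p = normsq (spatial p.1) &
  hpoint (Num.sqrt (1 + normsq (spatial p.1))) (spatial p.1) = p.1].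
Proof.
move=> /hyp_spatial[z0 z2]; rewrite -z2 sqrtr_sqr ger0_norm ?ltW// hpoint_spatial.
by split=> //; rewrite /sq_radius hgt_base z2; ring.
Qed.

(* The caps where w > 0 or w < 0 are graphs over a ball. Elsewhere x > 0, and some
   spatial coordinate can be replaced by t. *)
Section Cap.
Variable ep : R.
Hypothesis ep1 : ep = 1 \/ ep = -1.

Let ep2 : ep ^+ 2 = 1.
Proof. by case: ep1 => ->; rewrite ?expr1n// sqrrN expr1n. Qed.

Lemma height_sign (w : R) : -1 <= w <= 1 -> (0 < ep * (P w - P 0)) = (0 < ep * w).
Proof.
have i0 : -1 <= (0:R) <= 1 by apply/andP; split; lra.
have incr := height_of_incr n2 hr c0 xs0 hxs.
move=> wI; have /andP[w1 w2] := wmax_le wI; have /andP[z1 z2] := wmax_le i0.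
case: (ltgtP 0 w) => w0.
- have := incr 0 w z1 w0 w2; case: ep1 => ->; move: (P w) (P 0) => u v uv.
    by rewrite !mul1r subr_gt0 uv w0.
  by rewrite !mulN1r !oppr_gt0 subr_lt0 !ltNge !ltW.
- have := incr w 0 w1 w0 z2; case: ep1 => ->; move: (P w) (P 0) => u v uv.
    by rewrite !mul1r subr_gt0 !ltNge !ltW.
  by rewrite !mulN1r !oppr_gt0 subr_lt0 uv w0.
- by rewrite -w0 subrr.
Qed.

Definition cap_dom : set 'rV[R]_n := [set a | normsq a < xs].
Definition cap_chart (a : 'rV[R]_n) : E :=
  (hpoint (Num.sqrt (1 + normsq a)) a, - P (ep * Num.sqrt (1 - h (normsq a)))).

Let oC : open cap_dom.
Proof.
apply: (@open_comp _ _ (@normsq R n) [set x | x < xs]); last exact: open_lt.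
by move=> a _; apply: (Ck_normsq 0 openT) => //.
Qed.

Let hlt1 (x : R) : 0 <= x -> x < xs -> h x < 1.
Proof. by move=> x0 xx; rewrite -hxs; apply: hcur_incr => //; lra. Qed.

Let capw (x : R) : 0 <= x -> x < xs -> -1 <= ep * Num.sqrt (1 - h x) <= 1.
Proof.
move=> x0 xx; apply: sqr_le1; have l := hlt1 x0 xx; have g := hcur_ge0 x0.
by rewrite exprMn ep2 mul1r sqr_sqrtr; move: l g; move: (h x) => u; lra.
Qed.

Lemma cap_image : cap_chart @` cap_dom =
  compact_surface `&` [set p | 0 < ep * (- p.2 - P 0)].
Proof.
apply/seteqP; split=> [_ [a /= aD <-]|p [Sp /= pW]].
  have a0 := normsq_ge0 a; have l := hlt1 a0 aD.
  have u0 : 0 < 1 - h (normsq a) by rewrite subr_gt0.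
  split.
    apply: compact_surface_in => //.
    by rewrite exprMn ep2 mul1r sqr_sqrtr ?subrK// ltW.
  rewrite /= opprK height_sign; last exact: capw.
  by rewrite mulrA -expr2 ep2 mul1r sqrtr_gt0.
have [hp _] := Sp; have [w1 w2 pE _ _] := compact_surfaceP Sp.
have [yy xE pp] := hyp_hpointE hp; rewrite xE in w2.
move: pW; rewrite pE opprK height_sign// => ew.
have wn : compact_wf p != 0 by apply: contraTneq ew => ->; rewrite mulr0 ltxx.
have hl : h (normsq (spatial p.1)) < 1.
  have : 0 < compact_wf p ^+ 2 by rewrite exprn_even_gt0.
  by move: w2; move: (h _) (_ ^+ 2) => u v; lra.
exists (spatial p.1).
  rewrite /cap_dom /= ltNge; apply/negP => xx.
  have : h xs <= h (normsq (spatial p.1)) by apply: hcur_le => //; move: xs0; lra.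
  by rewrite hxs leNgt hl.
rewrite /cap_chart pp.
have -> : 1 - h (normsq (spatial p.1)) = (ep * compact_wf p) ^+ 2.
  by rewrite exprMn ep2 mul1r -w2 addrK.
rewrite sqrtr_sqr (gtr0_norm ew) mulrA -expr2 ep2 mul1r -pE.
by case: p {Sp pp yy xE hp w1 w2 ew wn hl pE}.
Qed.

Lemma cap_chartP : chart compact_surface cap_dom cap_chart.
Proof.
pose L : {linear E -> 'rV[R]_n} := HB.pack (fun p : E => spatial p.1)
  (GRing.isLinear.Build R E 'rV[R]_n *:%R _ (@spatial_linear R n)).
apply: (@chart_of_left_inverse _ _ _ _ _ L _ oC _ _ _ _ cap_image).
- move=> k; apply: Ck_pair => //.
    apply: Ck_hpoint => //; first exact: Ck_hyp_height.
    by apply: Ck_linear => // z; exact: cvg_id.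
  apply: CkN => //.
  have H := @Ck_comp1 R _ k cap_dom _ (fun a => ep * Num.sqrt (1 - h (normsq a))) P oC _ (Ck_height_of n2 hr c0 xs0 hxs k).
  apply: H; last by move=> a aD; apply/wmax_lt/capw => //; exact: normsq_ge0.
  apply: CkM => //; first exact: Ck_cst.
  apply: (@Ck_comp1 R _ k cap_dom _ (fun a => 1 - h (normsq a)) Num.sqrt oC _ (Ck_sqrt k)).
    apply: CkB => //; first exact: Ck_cst.
    have H2 := @Ck_comp1 R _ k cap_dom _ (@normsq R n) h oC (Ck_normsq k oC) (Ck_hcur r n2 c0 k).
    apply: H2; by move=> a _ /=; apply: lt_le_trans (normsq_ge0 a); exact: ltrN10.
  by move=> a aD; rewrite /= subr_gt0 hlt1// normsq_ge0.
- exact: spatial_continuous.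
- by move=> a _; exact: spatial_hpoint.
- apply: (@open_comp _ _ (fun p : E => ep * (- p.2 - P 0)) [set x | 0 < x]); last exact: open_gt.
  move=> p _; apply: (@dif_cont _ _ _ _ _ _ (difM (dif_cst ep p) (difB (difN (dif_snd (dif_id p))) (dif_cst (P 0) p)))).
Qed.

End Cap.

Section Band.
Variables (ep : R) (i : 'I_n).
Hypothesis ep1 : ep = 1 \/ ep = -1.

Let ep2 : ep ^+ 2 = 1.
Proof. by case: ep1 => ->; rewrite ?expr1n// sqrrN expr1n. Qed.

(** A band chart stores the height in the coordinate [i]. Then [inner] is the squared radius [x] at
    that height, and [gap] is the square of the replaced spatial coordinate, whose sign is [ep]. *)
Let inner (a : 'rV[R]_n) : R := chi (1 - V (- a 0 i) ^+ 2).
Let gap (a : 'rV[R]_n) : R := inner a - \sum_(j < n | j != i) a 0 j ^+ 2.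
Let bdom0 : set 'rV[R]_n := [set a : 'rV[R]_n | dom (- a 0 i)].
Definition band_dom : set 'rV[R]_n := [set a : 'rV[R]_n | dom (- a 0 i) /\ 0 < gap a].
Definition band_spatial (a : 'rV[R]_n) : 'rV[R]_n :=
  \row_j if j == i then ep * Num.sqrt (gap a) else a 0 j.
Definition band_chart (a : 'rV[R]_n) : E :=
  (hpoint (Num.sqrt (1 + inner a)) (band_spatial a), a 0 i).
Definition band_inverse (p : E) : 'rV[R]_n :=
  \row_j if j == i then p.2 else p.1 0 (lift ord0 j).

Let Ck_coordi k (U : set 'rV[R]_n) j : open U -> Ck k U (fun a : 'rV[R]_n => a 0 j).
Proof.
move=> oU; apply: Ck_coord => //; apply: (@Ck_linear _ _ _ k U id) => // z; exact: cvg_id.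
Qed.

Let ob0 : open bdom0.
Proof.
apply: (@open_comp _ _ (fun a : 'rV[R]_n => - a 0 i) dom); last exact: open_oo.
by move=> a _; apply: (CkN openT (Ck_coordi 0 i openT)).
Qed.

Let Ck_inner k : Ck k bdom0 inner.
Proof.
have h1 := @Ck_comp1 R _ k bdom0 _ (fun a => - a 0 i) V ob0 (CkN ob0 (Ck_coordi k i ob0)) (Ck_angle_of n2 hr c0 xs0 hxs k).
have h2 := @Ck_comp1 R _ k bdom0 _ (fun a => V (- a 0 i)) (fun w => chi (1 - w ^+ 2)) ob0 (h1 _) (Ck_chi n2 hr c0 xs0 hxs k).
by apply: h2 => // a aD; have [] := angle_ofP n2 hr c0 xs0 hxs aD.
Qed.

Let Ck_gap k : Ck k bdom0 gap.
Proof.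
apply: CkB => //; apply: Ck_sum => // j _; apply: CkX => //; exact: Ck_coordi.
Qed.

Let ob : open band_dom.
Proof.
rewrite openE => a [aD ga].
have h1 : \forall b \near a, bdom0 b by exact: open_nbhs_nbhs (conj ob0 aD).
have gc : {for a, continuous gap} := Ck_gap 0%N a aD.
have h2 : \forall b \near a, 0 < gap b by exact: (cvgr_gt _ gc _ ga).
exact: filterS2 h1 h2.
Qed.

Let bsub : band_dom `<=` bdom0. Proof. by move=> a []. Qed.

Let gapE a : band_dom a -> normsq (band_spatial a) = inner a.
Proof.
move=> [aD ga]; rewrite /normsq (bigD1 i)//= mxE eqxx exprMn ep2 mul1r sqr_sqrtr ?ltW//.
rewrite (eq_bigr (fun j => a 0 j ^+ 2)); first by rewrite /gap subrK.
by move=> j /negbTE ji; rewrite mxE ji.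
Qed.

Lemma band_inverse_linear : linear band_inverse.
Proof. by move=> k u v; apply/rowP => j; rewrite !mxE; case: ifP => // _; rewrite !mxE. Qed.

Lemma band_inverse_continuous : continuous band_inverse.
Proof.
move=> p; apply: (@dif_cont _ _ _ _ _ band_inverse).
apply: dif_mx => k j; case: (eqVneq j i) => ji.
  have h := dif_snd (dif_id p).
  rewrite (_ : (fun y => band_inverse y k j) = (fun y => y.2)).
    exact: h.
  by apply/funext => y; rewrite mxE ji eqxx.
have h := dif_coord 0 (lift ord0 j) (dif_fst (dif_id p)).
rewrite (_ : (fun y => band_inverse y k j) = (fun y => y.1 0 (lift ord0 j))).
  exact: h.
by apply/funext => y; rewrite mxE (negbTE ji).
Qed.

Lemma band_chartK a : band_inverse (band_chart a) = a.
Proof.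
apply/rowP => j; rewrite mxE; case: eqVneq => [->//|ji].
by rewrite /= hpointS mxE (negbTE ji).
Qed.

Lemma band_image : band_chart @` band_dom = compact_surface `&`
  [set p : E | dom (- p.2) /\ 0 < ep * p.1 0 (lift ord0 i)].
Proof.
apply/seteqP; split=> [_ [a aB <-]|p [Sp /= [pd pi]]].
  have [aD ga] := aB; have nE := gapE aB.
  have [/andP[v1 v2] vE] := angle_ofP n2 hr c0 xs0 hxs aD.
  have vI : - wm <= V (- a 0 i) <= wm by rewrite !ltW.
  split; last first.
    by split=> //=; rewrite hpointS mxE eqxx mulrA -expr2 ep2 mul1r sqrtr_gt0.
  rewrite /band_chart -nE -[a 0 i]opprK -vE; apply: compact_surface_in => //.
  by rewrite nE (hcur_chi n2 hr c0 xs0 hxs)// addrC subrK.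
have [hp _] := Sp; have [w1 w2 pE xE _] := compact_surfaceP Sp.
have [yy xE' pp] := hyp_hpointE hp.
have bE : band_inverse p 0 i = p.2 by rewrite mxE eqxx.
have iE : inner (band_inverse p) = normsq (spatial p.1).
  by rewrite /inner bE -xE' xE.
have gE : gap (band_inverse p) = p.1 0 (lift ord0 i) ^+ 2.
  rewrite /gap iE /normsq (bigD1 i)//= !mxE [X in _ + X - _](_ : _ = \sum_(j < n | j != i) band_inverse p 0 j ^+ 2).
    by rewrite addrK.
  by apply: eq_bigr => j /negbTE ji; rewrite !mxE ji.
have pi0 : p.1 0 (lift ord0 i) != 0 by apply: contraTneq pi => ->; rewrite mulr0 ltxx.
exists (band_inverse p).
  by split; rewrite ?bE// gE exprn_even_gt0.
have bs : band_spatial (band_inverse p) = spatial p.1.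
  apply/rowP => j; rewrite mxE gE; case: eqVneq => [->|/negbTE ji]; last by rewrite !mxE ji.
  have -> : p.1 0 (lift ord0 i) ^+ 2 = (ep * p.1 0 (lift ord0 i)) ^+ 2 by rewrite exprMn ep2 mul1r.
  by rewrite sqrtr_sqr gtr0_norm// mulrA -expr2 ep2 mul1r mxE.
by rewrite /band_chart bs bE iE pp; case: p {Sp pd pi hp w1 w2 pE xE yy xE' pp bE iE gE pi0 bs}.
Qed.

Lemma band_chartP : chart compact_surface band_dom band_chart.
Proof.
pose L : {linear E -> 'rV[R]_n} := HB.pack band_inverse
  (GRing.isLinear.Build R E 'rV[R]_n *:%R _ band_inverse_linear).
apply: (@chart_of_left_inverse _ _ _ _ _ L _ ob _ _ _ _ band_image).
- move=> k; apply: Ck_pair => //; last exact: Ck_coordi.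
  have ci := Ck_sub bsub (Ck_inner k).
  apply: Ck_hpoint => //.
    apply: (@Ck_comp1 R _ k band_dom _ (fun a => 1 + inner a) Num.sqrt ob _ (Ck_sqrt k)).
      by apply: CkD => //; exact: Ck_cst.
    by move=> a aB /=; rewrite -gapE// ltr_pwDl// normsq_ge0.
  apply: Ck_mx => // u j; case: (eqVneq j i) => ji.
    apply: (@Ck_ext _ _ _ k _ (fun a => ep * Num.sqrt (gap a))) => //.
      by move=> a _; rewrite mxE ji eqxx.
    apply: CkM => //; first exact: Ck_cst.
    apply: (@Ck_comp1 R _ k band_dom _ gap Num.sqrt ob _ (Ck_sqrt k)).
      exact: Ck_sub bsub (Ck_gap k).
    by move=> a [].
  apply: (@Ck_ext _ _ _ k _ (fun a : 'rV[R]_n => a 0 j)) => //; last exact: Ck_coordi.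
  by move=> a _; rewrite mxE (negbTE ji).
- exact: band_inverse_continuous.
- by move=> a _; exact: band_chartK.
- rewrite (_ : [set p | _] = (fun p : E => - p.2) @^-1` dom `&`
    (fun p : E => ep * p.1 0 (lift ord0 i)) @^-1` [set x | 0 < x])//.
  apply: openI; apply: open_comp.
  + by move=> p _; exact: dif_cont (difN (dif_snd (dif_id p))).
  + exact: open_oo.
  + move=> p _.
    exact: dif_cont (difM (dif_cst ep p) (dif_coord 0 (lift ord0 i) (dif_fst (dif_id p)))).
  + exact: open_gt.
Qed.

End Band.

Lemma sign_cases (x : R) : x != 0 -> exists ep : R, (ep = 1 \/ ep = -1) /\ 0 < ep * x.
Proof.
move=> x0; case: (ltP 0 x) => xp; first by exists 1; split; [left|rewrite mul1r].
exists (-1); split; first by right.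
by rewrite mulN1r oppr_gt0 lt_neqAle x0.
Qed.

Lemma compact_hypersurface : hypersurface compact_surface.
Proof.
split=> [p [] //|p Sp]; have [hp _] := Sp.
have [w1 w2 pE xE pd] := compact_surfaceP Sp.
case: (eqVneq (compact_wf p) 0) => [w0|/sign_cases[ep [ep1 ew]]]; last first.
  have [a aD aE] : (cap_chart ep @` cap_dom) p.
    rewrite (cap_image ep1); split=> //=.
    by rewrite pE opprK height_sign.
  by exists cap_dom, (cap_chart ep), a; split; [exact: cap_chartP|exact: aD|exact: aE].
have xx : sq_radius o p = xs by rewrite xE w0 expr0n/= subr0 (chi1 n2 hr c0 xs0 hxs).
have [_ xE' _] := hyp_hpointE hp.
have [i /sign_cases[ep [ep1 ei]]] : exists i, p.1 0 (lift ord0 i) != 0.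
  apply: contrapT => H; have : normsq (spatial p.1) = 0.
    rewrite /normsq big1// => j _; rewrite mxE.
    have -> : p.1 0 (lift ord0 j) = 0 by apply: contrapT => /eqP hj; apply: H; exists j.
    by rewrite expr0n.
  by rewrite -xE' xx => xx0; move: xs0; rewrite xx0 ltxx.
have [a aD aE] : (band_chart ep i @` band_dom i) p by rewrite (band_image i ep1).
by exists (band_dom i), (band_chart ep i), a; split; [exact: band_chartP|exact: aD|exact: aE].
Qed.

Lemma compact_surface_rotational : rotational compact_surface.
Proof.
exists o; split; first exact: ho.
move=> A [Aiso _ oA] p [hp [w [w2 pE]]].
have xE : sq_radius o (p.1 *m A, p.2) = sq_radius o p.
  by rewrite /sq_radius /hgt /= -{1}oA Aiso.
have oh : hyp (o *m A) by rewrite oA; exact: ho.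
split; first exact: isometry_hyp Aiso ho oh hp.
by exists w; rewrite xE.
Qed.

End CompactModel.

Section Sphere.
Context {R : realType} {n : nat}.

Lemma sphere_compact : compact [set a : 'rV[R]_n | normsq a = 1].
Proof.
apply: (@subclosed_compact _ _ [set v : 'rV[R]_n | forall i, `[-1, 1]%classic (v ord0 i)]).
- apply: (@preimage_closed _ _ (@normsq R n) [set x | x = 1]); last exact: closed_eq.
  by move=> a _; apply: (Ck_normsq 0%N openT) => //.
- have h := @rV_compact R n (fun=> `[-1, 1]%classic) (fun=> @segment_compact R (-1) 1).
  exact: h.
move=> a a1 i; rewrite /= in_itv /= -ler_norml -(@expr_le1 _ 2)// real_normK ?num_real//.
rewrite -a1 /normsq (bigD1 i)//= lerDl; apply: sumr_ge0 => j _; exact: sqr_ge0.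
Qed.

Lemma unit_direction (a : 'rV[R]_n) : (0 < n)%N ->
  exists2 b, normsq b = 1 & Num.sqrt (normsq a) *: b = a.
Proof.
move=> n0; case: (eqVneq (normsq a) 0) => a0.
  exists (delta_mx 0 (Ordinal n0)).
    rewrite /normsq (bigD1 (Ordinal n0))//= mxE !eqxx expr1n big1 ?addr0// => j /negbTE j0.
    by rewrite mxE eqxx j0 expr0n.
  rewrite a0 sqrtr0 scale0r; apply/rowP => i; rewrite mxE; apply/esym/eqP.
  rewrite -sqrf_eq0; move: a0; rewrite /normsq => /eqP.
  by rewrite psumr_eq0 => [|j _]; [move=> /allP/(_ i (mem_index_enum _))/implyP/(_ isT)|exact: sqr_ge0].
have p0 : 0 < normsq a by rewrite lt_neqAle eq_sym a0 normsq_ge0.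
have s0 : Num.sqrt (normsq a) != 0 by rewrite gt_eqF// sqrtr_gt0.
exists ((Num.sqrt (normsq a))^-1 *: a); last by rewrite scalerA mulfV// scale1r.
rewrite /normsq; under eq_bigr do rewrite mxE exprMn.
by rewrite -mulr_sumr -/(normsq a) exprVn sqr_sqrtr ?mulVf// ltW.
Qed.

End Sphere.

(** * Curvature and topology of the compact model *)

Section CompactModelTopology.
Context {R : realType} (n r : nat) (c xs : R).
Notation E := ('rV[R]_n.+1 * R)%type.
Hypotheses (n2 : (2 <= n)%N) (hr : (1 <= r <= n)%N) (c0 : 0 < c).
Hypotheses (xs0 : 0 < xs) (hxs : hcur n r c xs = 1).
Local Notation h := (hcur n r c).
Local Notation kap := (kapcur n r c).
Local Notation q := (qcur n r c).
Local Notation chi := (chi n r c xs).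
Local Notation wm := (wmax n r c).
Local Notation P := (height_of n r c xs).
Local Notation V := (angle_of n r c xs).
Local Notation S := (@compact_surface R n r c xs).
Local Notation Wf := (@compact_wf R n r c xs).
Let o : 'rV[R]_n.+1 := base_point.
Let ho : hyp o := hyp_base.
Let HS : hypersurface S := compact_hypersurface n2 hr c0 xs0 hxs.
Let SH : S `<=` HxR := proj1 HS.

Definition compact_normal : E -> E := model_normal r c o Wf.

Let wf_derive p : S p -> is_derive (- p.2) 1 V (kap (sq_radius o p)).
Proof.
move=> Sp; have [_ _ _ -> pd] := compact_surfaceP n2 hr c0 xs0 hxs Sp.
exact: angle_of_derive.
Qed.

Let wf_dif (W : normedModType R) (X : W -> E) (a : W) (L : W -> E) : dif X a L -> S (X a) ->
  dif (fun b => Wf (X b)) a (fun w => - kap (sq_radius o (X a)) * (L w).2).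
Proof.
move=> hX Sp.
apply: dif_eq (dif_comp1 (difN (dif_snd hX)) (wf_derive Sp)) _ => v.
by rewrite mulNr mulrC mulNr.
Qed.

Lemma compact_model_geometry : Hr_hypersurface r c S compact_normal /\
  strictly_convex S compact_normal.
Proof.
have Wc p : S p -> {for p, continuous Wf}.
  by move=> Sp; exact: dif_cont (wf_dif (dif_id p) Sp).
have Wu p : S p -> Wf p ^+ 2 + h (sq_radius o p) = 1.
  by move=> Sp; have [] := compact_surfaceP n2 hr c0 xs0 hxs Sp.
have Wd U X a : chart S U X -> U a -> dif (fun b => Wf (X b)) a
    (fun v => - kap (sq_radius o (X a)) * ('D_v X a).2).
  by move=> cX Ua; exact: wf_dif (chart_dif cX Ua) (chart_in cX Ua).
(* Differentiating [w^2 + h x = 1] and inserting [dw = - kappa dt] gives the relation times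
   [-2 kappa], a factor that is then cancelled. *)
have Wr U X a v : chart S U X -> U a ->
    q (sq_radius o (X a)) * lor ('D_v X a).1 o + Wf (X a) * ('D_v X a).2 = 0.
  move=> cX Ua; have hp := chart_hyp SH cX Ua; have x1 := sq_radius_gtN1 ho hp.
  have d1 := difX 2 (Wd _ _ _ cX Ua).
  have d2 := dif_comp1 (sq_radius_dif o (chart_dif cX Ua)) (hcur_derive n2 hr c0 x1).
  have d3 : dif (fun b => Wf (X b) ^+ 2 + h (sq_radius o (X b))) a (fun=> 0).
    apply: dif_near (dif_cst (1 : R) a).
    by apply: filterS (chart_near cX Ua) => b Ub; rewrite (Wu _ (chart_in cX Ub)).
  have := etrans (esym (dif_derive v (difD d1 d2))) (dif_derive v d3).
  have s0 : Num.sqrt (1 + sq_radius o (X a)) != 0 by rewrite gt_eqF// sqrtr_gt0; lra.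
  have k0 : kap (sq_radius o (X a)) != 0 by rewrite gt_eqF// kapcur_gt0.
  rewrite -(sqrt_sq_radius ho hp) expr1.
  move: ('D_v X a) (Wf _) (Num.sqrt _) (kap _) (q _) s0 k0 => A w y k u y0 k0 H.
  apply: (mulfI k0); rewrite mulr0; apply: (mulfI (_ : -2 != 0 :> R)).
    by rewrite oppr_eq0 pnatr_eq0.
  by rewrite mulr0 -[RHS]H; field.
split; [exact: model_Hr|exact: (model_convex n2 hr c0 HS ho Wu Wr Wd)].
Qed.

(** Exhibits the surface as a continuous image of [[-1, 1]] times the unit sphere, with the sphere
    collapsed to a point at [w = 1] and at [w = -1]. *)
Let Phi (u : R * 'rV[R]_n) : E :=
  (hpoint (Num.sqrt (1 + chi (1 - u.1 ^+ 2))) (Num.sqrt (chi (1 - u.1 ^+ 2)) *: u.2), - P u.1).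

Let K : set (R * 'rV[R]_n) := `[-1, 1]%classic `*` [set a | normsq a = 1].

Let Phi_continuous (u : R * 'rV[R]_n) : -1 <= u.1 <= 1 -> {for u, continuous Phi}.
Proof.
move=> uI; pose D : set (R * 'rV[R]_n) := [set u | - wm < u.1 < wm].
have uD : D u by exact: wmax_lt.
have c1 : Ck 0 setT (fun u : R * 'rV[R]_n => u.1).
  by move=> z _; exact: cvg_fst.
have oD : open D.
  apply: (@open_comp _ _ (fun u : R * 'rV[R]_n => u.1) [set w | - wm < w < wm]); last exact: open_oo.
  by move=> z _; exact: cvg_fst.
have {}c1 : Ck 0 D (fun u : R * 'rV[R]_n => u.1) := Ck_sub (@subsetT _ D) c1.
have c2 := @Ck_comp1 R _ 0 D _ (fun u : R * 'rV[R]_n => u.1) (fun w => chi (1 - w ^+ 2)) oD c1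
  (Ck_chi n2 hr c0 xs0 hxs 0) (fun u uD => uD).
have c3 := @Ck_comp1 R _ 0 D _ (fun u : R * 'rV[R]_n => u.1) P oD c1
  (Ck_height_of n2 hr c0 xs0 hxs 0) (fun u uD => uD).
have cs : Ck 0 setT (@Num.sqrt R) by move=> z _; exact: sqrt_continuous.
have c4 := CkD oD (Ck_cst 0 (1 : R) oD) c2.
have c5 := @Ck_comp1 R _ 0 D setT _ Num.sqrt oD c4 cs (fun _ _ => I).
have c6 := @Ck_comp1 R _ 0 D setT _ Num.sqrt oD c2 cs (fun _ _ => I).
suff : Ck 0 D Phi by move=> /(_ u uD).
apply: (Ck_pair oD); last exact: (CkN oD c3).
apply: (Ck_hpoint oD).
  exact: c5.
apply: (Ck_mx oD) => i j; apply: (@Ck_ext _ _ _ 0 D (fun u => Num.sqrt (chi (1 - u.1 ^+ 2)) * u.2 0 j) _ oD).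
  by move=> z _; rewrite mxE ord1.
apply: (CkM oD).
  exact: c6.
by apply: (Ck_coord _ _ oD) => z _; exact: cvg_snd.
Qed.

Let Phi_image : Phi @` K = S.
Proof.
apply/seteqP; split=> [_ [[w a] [/= wI a1] <-]|p Sp].
  move: wI; rewrite in_itv/= => wI; have wW := wmax_le n2 hr c0 wI.
  have x0 := chi_ge0 n2 hr c0 xs0 hxs wI.
  have nE : normsq (Num.sqrt (chi (1 - w ^+ 2)) *: a) = chi (1 - w ^+ 2).
    rewrite /normsq; under eq_bigr do rewrite mxE exprMn.
    by rewrite -mulr_sumr -/(normsq a) a1 mulr1 sqr_sqrtr.
  apply: compact_surface_in.
  - by rewrite sqrtr_gt0 ltr_pwDl.
  - by rewrite nE sqr_sqrtr// addr_ge0.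
  - by rewrite nE (hcur_chi n2 hr c0 xs0 hxs)// addrC subrK.
have [w1 w2 pE xE _] := compact_surfaceP n2 hr c0 xs0 hxs Sp.
have [_ xE' pp] := hyp_hpointE (SH Sp).
have [b b1 bE] := unit_direction (spatial p.1) (ltnW n2).
exists (Wf p, b); first by split; rewrite //= in_itv.
rewrite /Phi /= -xE xE' bE pp -pE.
by case: p {Sp w1 w2 pE xE xE' pp bE}.
Qed.

Lemma compact_surface_compact : compact S.
Proof.
rewrite -Phi_image; apply: continuous_compact.
  apply: continuous_in_subspaceT => u; rewrite inE => -[/=]; rewrite in_itv/= => uI _.
  exact: Phi_continuous.
by apply: compact_setX; [exact: segment_compact|exact: sphere_compact].
Qed.

(** The surface is a union of meridians, each an image of [[-1, 1]], all passing through the pole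
    [w = 1]. *)
Lemma compact_surface_connected : connected S.
Proof.
have -> : S = \bigcup_(a in [set a | normsq a = 1]) ((fun w => Phi (w, a)) @` `[-1, 1]%classic).
  rewrite -Phi_image; apply/seteqP; split=> [_ [[w a] [/= wI a1] <-]|_ [a a1 [w wI <-]]].
    by exists a => //; exists w.
  by exists (w, a).
apply: bigcup_connected => [|a _].
  exists (hpoint 1 0, - P 1) => a _; exists 1; first by rewrite /= in_itv/=; apply/andP; split; lra.
  by rewrite /Phi /= expr1n subrr (chi0 n2 hr c0 xs0 hxs) addr0 sqrtr1 sqrtr0 scale0r.
apply: connected_continuous_connected.
  exact: segment_connected.
apply: continuous_in_subspaceT => w; rewrite inE/= in_itv/= => wI.
have c1 : {for w, continuous (fun w : R => (w, a))}.
  exact: dif_cont (dif_pair (dif_id w) (dif_cst a w)).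
exact: (@continuous_comp _ _ _ (fun w : R => (w, a)) Phi w c1 (@Phi_continuous (w, a) wI)).
Qed.

Lemma compact_model : compact_rotational_Hr_hypersurface r c S compact_normal /\
  strictly_convex S compact_normal.
Proof.
have [h1 h2] := compact_model_geometry; split=> //; split=> //.
- exact: compact_surface_compact.
- exact: compact_surface_connected.
- have [a a1 _] := unit_direction (0 : 'rV[R]_n) (ltnW n2).
  have : (Phi @` K) (Phi (0, a)).
    by exists (0, a) => //; split=> //=; rewrite in_itv/=; apply/andP; split; lra.
  by rewrite Phi_image => h; exists (Phi (0, a)).
- exact: compact_surface_rotational.
Qed.

End CompactModelTopology.

(** * Functions that are stationary off the axis *)

Section LineConstancy.
Context {R : realType}.

Lemma segment_const (V : normedModType R) (f : V -> R) (a b : V) :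
  (forall t : R, 0 <= t <= 1 ->
    is_derive (0 : R) 1 (fun s : R => f (a + t *: (b - a) + s *: (b - a))) 0) ->
  f a = f b.
Proof.
move=> H.
have hd (t : R) : 0 <= t <= 1 -> is_derive t 1 (fun s : R => f (a + s *: (b - a))) 0.
  move=> /H/dif_is_derive h; apply/dif_is_derive.
  have sh : dif (fun s : R => s - t) t id.
    by apply: dif_eq (difB (dif_id t) (dif_cst t t)) _ => u; rewrite subr0.
  have h' : dif (fun s : R => f (a + t *: (b - a) + s *: (b - a))) (t - t) (fun v => v * 0).
    by rewrite subrr.
  rewrite (_ : (fun s : R => f (a + s *: (b - a))) =
    (fun s : R => f (a + t *: (b - a) + (s - t) *: (b - a)))).
    exact: dif_comp sh h'.
  by apply/funext => s; congr f; rewrite -addrA -scalerDl [t + _]addrC subrK.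
have [z _] := MVT0 ltr01 hd.
by rewrite mulr0 scale1r scale0r addr0 [a + _]addrC subrK => /eqP; rewrite subr_eq0 => /eqP.
Qed.

Lemma segmentE (V : lmodType R) (a b c : V) (t : R) :
  b + t *: (c - b) - a = (1 - t) *: (b - a) + t *: (c - a).
Proof.
have E : (c - a) - (b - a) = c - b by rewrite opprB addrA subrK.
by rewrite scalerBl scale1r -[RHS]addrA [X in _ = _ + X]addrC -scalerBr E addrAC.
Qed.

Lemma segment_ball (V : normedModType R) (a b c : V) (e t : R) : 0 <= t <= 1 ->
  `|b - a| < e -> `|c - a| < e -> `|b + t *: (c - b) - a| < e.
Proof.
move=> /andP[t0 t1] hb hc; rewrite segmentE.
apply: le_lt_trans (ler_normD _ _) _.
rewrite !normrZ (ger0_norm t0) ger0_norm ?subr_ge0//.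
pose m := Num.max `|b - a| `|c - a|.
have me : m < e by rewrite gt_max hb hc.
apply: le_lt_trans me.
have h1 : (1 - t) * `|b - a| <= (1 - t) * m by rewrite ler_wpM2l ?subr_ge0// le_max lexx.
have h2 : t * `|c - a| <= t * m by rewrite ler_wpM2l// le_max lexx orbT.
by apply: le_trans (lerD h1 h2) _; rewrite -mulrDl subrK mul1r.
Qed.

Lemma nonparallel n (v : 'rV[R]_n) : (2 <= n)%N -> v != 0 ->
  exists u : 'rV[R]_n, forall k : R, u != k *: v.
Proof.
move=> n2 v0.
have [i vi] : exists i, v 0 i != 0.
  apply: contrapT => H; move/eqP: v0; apply; apply/rowP => i; rewrite mxE.
  by apply: contrapT => /eqP h; apply: H; exists i.
have [j ji] : exists j : 'I_n, j != i.
  case: n n2 v v0 i vi => [//|[//|n]] _ v _ i _.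
  by case: (eqVneq i ord0) => [->|h]; [exists ord_max|exists ord0; rewrite eq_sym].
exists (delta_mx 0 j) => k; apply/eqP => /rowP H.
have := H i; rewrite !mxE eqxx eq_sym (negbTE ji) => /esym/eqP.
rewrite mulf_eq0 (negbTE vi) orbF => /eqP k0.
by have /eqP := H j; rewrite !mxE !eqxx k0 mul0r oner_eq0.
Qed.

(** If the segment from [b] to [c] misses [a], the function is constant along it; otherwise [b - a]
    and [c - a] are parallel, and a detour through [a + d] with [d] not parallel to them uses two
    segments that miss [a]. *)
Lemma punctured_const n (f : 'rV[R]_n -> R) (a : 'rV[R]_n) (e : R) : (2 <= n)%N -> 0 < e ->
  (forall b, `|b - a| < e -> b != a ->
    forall v, is_derive (0 : R) 1 (fun s : R => f (b + s *: v)) 0) ->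
  forall b c, `|b - a| < e -> b != a -> `|c - a| < e -> c != a -> f b = f c.
Proof.
move=> n2 e0 H.
have direct b c : `|b - a| < e -> `|c - a| < e ->
    (forall t : R, 0 <= t <= 1 -> (1 - t) *: (b - a) + t *: (c - a) != 0) -> f b = f c.
  move=> be ce h; apply: segment_const => t tI; apply: H; first exact: segment_ball.
  by rewrite -subr_eq0 segmentE h.
have skew b d : `|b - a| < e -> b != a -> (forall k : R, d != k *: (b - a)) ->
    `|d| < e -> f b = f (a + d).
  move=> be ba dk de; have dE : a + d - a = d by rewrite addrC addKr.
  apply: direct; rewrite ?dE// => t tI.
  case: (eqVneq t 0) => [->|t0].
    by rewrite subr0 scale1r scale0r addr0 subr_eq0.
  apply: contra (dk (- (t^-1 * (1 - t)))) => /eqP E.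
  rewrite scaleNr -scalerA -(scalerK t0 d); apply/eqP.
  by rewrite -[RHS]scalerN; congr (_ *: _); apply/eqP; rewrite -addr_eq0 addrC E.
move=> b c be ba ce ca.
have [|/existsNP[t /not_implyP[tI /negP/negPn/eqP hit]]] :=
  pselect (forall t : R, 0 <= t <= 1 -> (1 - t) *: (b - a) + t *: (c - a) != 0).
  exact: direct.
have t0 : t != 0.
  apply: contraNneq ba => t0; rewrite -subr_eq0.
  by move: hit; rewrite t0 subr0 scale1r scale0r addr0 => ->.
have cE : c - a = - (t^-1 * (1 - t)) *: (b - a).
  rewrite scaleNr -scalerA -[LHS](scalerK t0) -scalerN; congr (_ *: _).
  by apply/eqP; rewrite -addr_eq0 addrC hit.
have [u uP] : exists u : 'rV[R]_n, forall k : R, u != k *: (b - a).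
  by apply: nonparallel => //; rewrite subr_eq0.
have u0 : `|u| != 0 by rewrite normr_eq0; have := uP 0; rewrite scale0r.
have up : 0 < `|u| by rewrite lt_neqAle eq_sym u0 normr_ge0.
pose d := (e / (2 * `|u|)) *: u.
have d0 : e / (2 * `|u|) != 0 by rewrite gt_eqF// divr_gt0// mulr_gt0.
have de : `|d| < e.
  rewrite normrZ ger0_norm; last by rewrite divr_ge0 ?mulr_ge0 ?(ltW e0).
  have -> : e / (2 * `|u|) * `|u| = e / 2 by field.
  by move: e0; clear; lra.
have dP k : d != k *: (b - a).
  apply: contra (uP ((e / (2 * `|u|))^-1 * k)) => /eqP dE.
  by rewrite -scalerA -dE /d scalerA mulVf// scale1r.
have dP' k : d != k *: (c - a) by rewrite cE scalerA.
by rewrite (skew b d be ba dP de) (skew c d ce ca dP' de).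
Qed.

Lemma near_neq n (a : 'rV[R]_n) (P : set 'rV[R]_n) : (0 < n)%N ->
  (\forall b \near a, P b) -> exists2 b, b != a & P b.
Proof.
move=> n0 /nbhs_ballP[e e0 he].
pose u : 'rV[R]_n := delta_mx 0 (Ordinal n0).
have u0 : u != 0.
  apply/eqP => /rowP/(_ (Ordinal n0)); rewrite !mxE !eqxx => /eqP.
  by rewrite oner_eq0.
have up : 0 < `|u| by rewrite normr_gt0.
have k0 : 0 < e / (2 * `|u|) by rewrite divr_gt0// mulr_gt0.
exists (a + (e / (2 * `|u|)) *: u).
  by rewrite -subr_eq0 addrC addKr scaler_eq0 negb_or u0 gt_eqF.
apply: he; rewrite -ball_normE /= opprD addrA subrr add0r normrN normrZ gtr0_norm//.
have -> : e / (2 * `|u|) * `|u| = e / 2 by field; rewrite gt_eqF.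
by rewrite ltr_pdivrMr// ltr_pMr// ltr1n.
Qed.

End LineConstancy.

(** * Propagation of constants from chart to chart *)

Section OffAxis.
Context {R : realType} {n : nat}.
Notation E := ('rV[R]_n.+1 * R)%type.
Variables (S : set E) (N : E -> E) (o : 'rV[R]_n.+1).
Hypotheses (n2 : (2 <= n)%N) (HS : hypersurface S) (HN : unit_normal S N).
Hypotheses (ho : hyp o)
  (rot : forall A, rotation_about o A -> forall p, S p -> S (p.1 *m A, p.2)).

Let SH : S `<=` HxR := proj1 HS.
Let n0 : (0 < n)%N := ltnW n2.

(** An axis point has a horizontal tangent plane, so [G], which retains only the horizontal
    displacement from [o], has the identity as differential at [a] and vanishes at no other nearby
    point; but it would vanish at every axis point. *)
Lemma axis_isolated U X a : chart S U X -> U a ->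
  \forall b \near a, U b /\ (b != a -> 1 < hgt o (X b)).
Proof.
move=> cX Ua; have [y1|y1] := boolP (1 < hgt o (X a)).
  have h := off_axis_near cX Ua y1.
  by apply: filterS h => b [Ub yb].
have Xo := hgt_axis HS ho (chart_in cX Ua) y1.
have N0 := normal_axis n2 HS HN ho rot (chart_in cX Ua) Xo.
have [_ NN Nt] := proj2 HN _ (chart_in cX Ua).
have Nv0 : (N (X a)).2 != 0.
  apply/eqP => h; move: NN; rewrite /ip N0 lor0l h mulr0 addr0 => /eqP.
  by rewrite eq_sym oner_eq0.
have D2 v : ('D_v X a).2 = 0.
  have := Nt U X a v cX Ua erefl; rewrite /ip N0 lor0r add0r => /eqP.
  by rewrite mulf_eq0 (negbTE Nv0) orbF => /eqP.
pose La := left_inverse ('d X a).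
have LaK v : La ('d X a v) = v.
  apply: (left_inverseK (chart_hyp SH cX Ua)) => w.
    by move=> w0; exact: (chart_immersion cX Ua w0).
  exact: (chart_tangent_d SH cX).
pose G (b : 'rV[R]_n) := La ((X b).1 - o, 0 : R).
have Gd : dif G a id.
  have h1 := dif_pair (difB (dif_fst (chart_dif cX Ua)) (dif_cst o a)) (dif_cst (0 : R) a).
  apply: dif_eq (dif_comp h1 (left_inverse_dif _ _)) _ => v.
  rewrite -[RHS]LaK (chart_diffE cX)// /La subr0; congr left_inverse.
  by have := D2 v; case: ('D_v X a) => u w /= ->.
have Ga : G a = 0 by rewrite /G Xo subrr /La /left_inverse; apply/rowP => j;
  rewrite !mxE big1// => i _; rewrite !mxE /ip lor0l mul0r addr0 mul0r.
have e0 : (0 : R) < 2^-1 by rewrite invr_gt0.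
have near1 : \forall b \near a, `|G b - G a - (b - a)| <= 2^-1 * `|b - a| by exact: dif_eps Gd _ e0.
apply: filterS2 near1 (chart_near cX Ua) => b hb Ub; split=> // ba.
rewrite ltNge; apply/negP => yb.
have Xbo : (X b).1 = o by apply: (hgt_axis HS ho (chart_in cX Ub)); rewrite -leNgt.
have Gb : G b = 0 by rewrite -Ga /G Xo Xbo.
move: hb; rewrite Ga Gb subrr sub0r normrN leNgt => /negP; apply.
by rewrite gtr_pMl ?normr_gt0 ?subr_eq0// invf_lt1// ltr1n.
Qed.

Lemma off_axis_dense p (W : set E) : S p -> open W -> W p ->
  exists q, [/\ S q, W q & 1 < hgt o q].
Proof.
move=> Sp oW Wp; have [U [X [a [cX Ua XE]]]] := proj2 HS p Sp.
have h1 : \forall b \near a, W (X b).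
  by apply: (dif_cont (chart_dif cX Ua)); rewrite XE; exact: open_nbhs_nbhs.
have [b ba [Wb [Ub yb]]] := near_neq n0 (filterI h1 (axis_isolated cX Ua)).
by exists (X b); split; [exact: (chart_in cX Ub)|exact: Wb|exact: yb].
Qed.

Definition stationary (f : E -> R) := forall (g : R -> E) d,
  is_derive (0 : R) 1 g d -> (\forall s \near (0 : R), S (g s)) -> 1 < hgt o (g 0) ->
  is_derive (0 : R) 1 (fun s => f (g s)) 0.

Lemma stationary_chart f U X b v : stationary f -> chart S U X -> U b ->
  1 < hgt o (X b) -> is_derive (0 : R) 1 (fun s : R => f (X (b + s *: v))) 0.
Proof.
move=> sf cX Ub yb; have b0 : b + (0 : R) *: v = b by rewrite scale0r addr0.
have hX : dif X (b + (0 : R) *: v) (fun u => 'D_u X b) by rewrite b0; exact: (chart_dif cX Ub).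
have hid : dif id (b + (0 : R) *: v) id by exact: dif_id.
apply: (sf (fun s : R => X (b + s *: v)) ('D_v X b)); last by rewrite b0.
  exact: is_derive_line hX.
have /dif_curve/dif_cont lc := is_derive_line hid.
have hU : \forall s \near (0 : R), U (b + s *: v).
  have nU : nbhs (b + (0 : R) *: v) U by rewrite b0; exact: (chart_near cX Ub).
  exact: (lc U nU).
by apply: filterS hU => s Us; exact: (chart_in cX Us).
Qed.

Lemma stationary_locally f p : stationary f -> S p -> exists W, [/\ open W, W p &
  forall q q', S q -> W q -> 1 < hgt o q -> S q' -> W q' -> 1 < hgt o q' -> f q = f q'].
Proof.
move=> sf Sp; have [U [X [a [cX Ua XE]]]] := proj2 HS p Sp.
have /nbhs_ballP[e e0 he] := axis_isolated cX Ua.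
have [_ _ _ _ img] := cX.
have oB : open (ball a e) by exact: ball_open.
have BU : ball a e `<=` U by move=> b /he[].
have [W [oW WE]] := img _ oB BU.
have dB b : ball a e b -> `|b - a| < e by rewrite -ball_normE /= distrC.
have dB' b : `|b - a| < e -> ball a e b by rewrite -ball_normE /= distrC.
have fd b : `|b - a| < e -> 1 < hgt o (X b) ->
    forall v, is_derive (0 : R) 1 (fun s : R => f (X (b + s *: v))) 0.
  by move=> be yb v; apply: (stationary_chart v sf cX) yb; exact: BU (dB' _ be).
exists W; split=> //.
  have : (X @` ball a e) p by exists a => //; exact: ballxx.
  by rewrite WE => -[].
move=> q q' Sq Wq yq Sq' Wq' yq'.
have [b Bb bE] : (X @` ball a e) q by rewrite WE.
have [b' Bb' bE'] : (X @` ball a e) q' by rewrite WE.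
rewrite -bE -bE' in yq yq' *; move: (dB _ Bb) (dB _ Bb') => {}Bb {}Bb'.
have [y1|y1] := boolP (1 < hgt o (X a)).
  have all_off c : `|c - a| < e -> 1 < hgt o (X c).
    by case: (eqVneq c a) => [->//|ca] ce; exact: (proj2 (he _ (dB' _ ce))).
  apply: (@segment_const _ _ (fun b => f (X b))) => t tI.
  have ce := segment_ball tI Bb Bb'.
  exact: fd ce (all_off _ ce) _.
have ba : b != a by apply: contraNneq y1 => <-.
have ba' : b' != a by apply: contraNneq y1 => <-.
apply: (@punctured_const _ _ (fun b => f (X b)) a e n2 e0 _ b b' Bb ba Bb' ba') => c ce ca v.
by apply: fd => //; exact: (proj2 (he _ (dB' _ ce))).
Qed.

(** Connectedness is given for [S], not for its part off the axis. The sets of points near which [f]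
    takes the value [f p], respectively avoids it, at off-axis points are open and cover [S]; they
    are disjoint on [S] because off-axis points are dense. *)
Lemma off_axis_const f p q : connected S -> stationary f ->
  S p -> 1 < hgt o p -> S q -> 1 < hgt o q -> f p = f q.
Proof.
move=> cS sf Sp yp Sq yq.
pose good (b : Prop) W := open W /\ forall z, S z -> W z -> 1 < hgt o z -> (f z = f p <-> b).
pose A b := \bigcup_(W in good b) W.
have oA b : open (A b) by apply: bigcup_open => W [].
have cover z : S z -> A True z \/ A False z.
  move=> Sz; have [W [oW Wz hW]] := stationary_locally sf Sz.
  have [z' [Sz' Wz' yz']] := off_axis_dense Sz oW Wz.
  have [e|e] := pselect (f z' = f p).
    left; exists W => //; split=> // u Su Wu yu; split=> // _.
    by rewrite -e; exact: hW.
  right; exists W => //; split=> // u Su Wu yu; split=> // uE; apply: e.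
  by rewrite -uE; exact: hW.
have disj z : S z -> A True z -> ~ A False z.
  move=> Sz [W [oW hW] Wz] [W' [oW' hW'] Wz'].
  have [u [Su [Wu Wu'] yu]] := off_axis_dense Sz (openI oW oW') (conj Wz Wz').
  exact: (proj1 (hW' u Su Wu' yu) (proj2 (hW u Su Wu yu) I)).
have SA : S `&` A True = S.
  apply: cS.
  - exists p; split=> //; case: (cover p Sp) => // -[W [_ hW] Wp].
    by have [/(_ erefl)] := hW p Sp Wp yp.
  - by exists (A True).
  - exists (~` A False); first exact: open_closedC.
    apply/seteqP; split=> z [Sz zA]; split=> //; first exact: disj.
    by case: (cover z Sz).
have [_ [W [_ hW] Wq]] : (S `&` A True) q by rewrite SA.
exact/esym/(proj2 (hW q Sq Wq yq)).
Qed.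

Lemma axis_extend (f : E -> R) (k : R) :
  (forall U X a, chart S U X -> U a -> {for a, continuous (fun b => f (X b))}) ->
  (forall p, S p -> 1 < hgt o p -> f p = k) -> forall p, S p -> f p = k.
Proof.
move=> fc fk p Sp; have [U [X [a [cX Ua XE]]]] := proj2 HS p Sp.
apply: contrapT => /eqP pk; rewrite -XE in pk.
have h1 : \forall b \near a, f (X b) != k.
  have nb : nbhs (f (X a)) [set x : R | x != k] by apply: open_nbhs_nbhs; split; [exact: open_neq|exact: pk].
  exact: (fc U X a cX Ua _ nb).
have [b ba [/eqP h [Ub yb]]] := near_neq n0 (filterI h1 (axis_isolated cX Ua)).
by apply: h; apply: fk; [exact: (chart_in cX Ub)|exact: yb].
Qed.

End OffAxis.

(** * The first integral *)

Local Opaque pint.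

Section FirstIntegral.
Context {R : realType} {n : nat}.
Notation E := ('rV[R]_n.+1 * R)%type.
Variables (S : set E) (N : E -> E) (o : 'rV[R]_n.+1) (r : nat) (c : R).
Hypotheses (n2 : (2 <= n)%N) (HS : hypersurface S) (HN : unit_normal S N).
Hypotheses (ho : hyp o)
  (rot : forall A, rotation_about o A -> forall p, S p -> S (p.1 *m A, p.2)).
Hypotheses (hr : (1 <= r <= n)%N) (c0 : 0 < c).
Hypothesis HC : forall p, S p -> exists k,
  principal_curvatures S N p k /\ mean_curvature r k = c.

Let SH : S `<=` HxR := proj1 HS.
Let n0 : (0 < n)%N := ltnW n2.
Let nc0 : 0 < n%:R * c :> R. Proof. by rewrite mulr_gt0// ltr0n. Qed.
Let profile_at p (Sp : S p) (y1 : 1 < hgt o p) := profile_equations n2 HS HN ho rot hr (HC Sp) Sp y1.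

Definition first_integral (p : E) : R :=
  nrad N o p ^+ r * rad o p ^+ (n - r) - n%:R * c * rad o p ^+ n * pint n r (rad o p ^+ 2).

Let sqrt_rad p : S p -> Num.sqrt (1 + rad o p ^+ 2) = hgt o p.
Proof.
move=> Sp; rewrite (rad2 HS ho Sp) addrC subrK sqrtr_sqr ger0_norm//.
exact: le_trans ler01 (hgt_ge1 HS ho Sp).
Qed.

Let rad2_gtN1 p : -1 < rad o p ^+ 2.
Proof. by apply: lt_le_trans (sqr_ge0 _); exact: ltrN10. Qed.

Lemma rad_curve (g : R -> E) (t m : R) : 1 < hgt o (g t) ->
  is_derive t 1 (fun s => hgt o (g s)) (rad o (g t) * m) ->
  is_derive t 1 (fun s => rad o (g s)) (hgt o (g t) * m).
Proof.
move=> y1 /dif_is_derive hd; apply/dif_is_derive.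
have r0 := rad_gt0 y1.
have pos : 0 < hgt o (g t) ^+ 2 - 1 by rewrite -sqrtr_gt0.
apply: dif_eq (dif_comp1 (difB (difX 2 hd) (dif_cst (1 : R) t)) (is_derive1_sqrt pos)) _ => v.
by rewrite -/(rad o (g t)); field; rewrite gt_eqF.
Qed.

(** In the application [m = n - r] and [a] is its value. For [m = 0] the identity
    [sg * sg ^+ m.-1 = sg ^+ m] fails, but it only occurs multiplied by [a], which is then 0. *)
Let balance (s sg y w k l J d nc a : R) (m r' : nat) : sg != 0 -> y != 0 ->
  nc = a * (s / sg * y) ^+ r'.+1 + r'.+1%:R * ((s / sg * y) ^+ r' * k) ->
  a * (sg * sg ^+ m.-1) = a * sg ^+ m ->
  2 * sg ^+ 2 * d + n%:R * J = (y ^+ r'.+1)^-1 ->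
  n = (m + r'.+1)%N ->
  s ^+ r'.+1 * (a * sg ^+ m.-1 * (y * (w * l))) +
    sg ^+ m * (r'.+1%:R * s ^+ r' * (w * k * l)) -
  (nc * sg ^+ n * (2 * sg * (y * (w * l)) * d) +
   J * (nc * (n%:R * sg ^+ n.-1 * (y * (w * l))))) = 0.
Proof.
move=> sg0 y0 ncE aE dE nE; apply: (mulfI sg0); rewrite mulr0.
have sn : sg * sg ^+ n.-1 = sg ^+ n by rewrite -exprS prednK.
transitivity (w * l * y * s ^+ r'.+1 * (a * (sg * sg ^+ m.-1)) +
  w * l * sg * sg ^+ m * r'.+1%:R * s ^+ r' * k
  - w * l * nc * y * (sg ^+ n * (2 * sg ^+ 2 * d) + (sg * sg ^+ n.-1) * (n%:R * J))).
  by ring.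
rewrite aE sn -mulrDr dE {1}ncE nE exprD !exprS !exprMn exprVn.
have := expf_neq0 r' sg0; have := expf_neq0 r' y0.
move: (sg ^+ r') (y ^+ r') (s ^+ r') (sg ^+ m) => B C A M C0 B0.
by field; rewrite sg0 y0 B0 C0.
Qed.

(** Times [(sinh rho)^(n-1) / (cosh rho)^(r-1)], the curvature equation has on its left the
    derivative of [s^r (sinh rho)^(n-r)] in [rho], because [kappa = ds / d rho], and on its right
    [n c] times the integrand. [balance] is this computation along a curve. *)
Lemma first_integral_stationary : stationary S o first_integral.
Proof.
move=> g d gd gS y1; have Sp := nbhs_singleton gS.
have [k [eqn crv _]] := profile_at Sp y1.
have [hd _ /dif_is_derive sd _] := crv g 0 d gd gS erefl.
rewrite -mulrA in hd.
have /dif_is_derive rd := rad_curve y1 hd.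
have [dJ hJ dJE] := pint_ode r n2 (rad2_gtN1 (g 0)).
rewrite (sqrt_rad Sp) in dJE.
have r0 := rad_gt0 y1; have rn0 : rad o (g 0) != 0 by rewrite gt_eqF.
have yn0 : hgt o (g 0) != 0 by rewrite gt_eqF// (lt_trans ltr01).
apply/dif_is_derive.
have D1 := difM (difX r sd) (difX (n - r) rd).
have D2 := difM (difM (dif_cst (n%:R * c) 0) (difX n rd)) (dif_comp1 (difX 2 rd) hJ).
apply: dif_eq (difB D1 D2) _ => v; rewrite mulr0 /=.
have [r' rE] : exists r', r = r'.+1 by exists r.-1; rewrite prednK//; case/andP: hr.
have nrE : n = ((n - r) + r'.+1)%N by rewrite -rE subnK//; case/andP: hr.
have aE : (n - r)%:R * (rad o (g 0) * rad o (g 0) ^+ (n - r).-1) =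
    (n - r)%:R * rad o (g 0) ^+ (n - r) :> R.
  by case: (n - r)%N => [|m]; rewrite ?mul0r// -exprS.
have dE : 2 * rad o (g 0) ^+ 2 * dJ + n%:R * pint n r (rad o (g 0) ^+ 2) = (hgt o (g 0) ^+ r'.+1)^-1.
  by rewrite dJE rE subrK.
rewrite -natrB in eqn; last by case/andP: hr.
rewrite {2 3 4}rE in eqn.
have B := @balance (nrad N o (g 0)) _ _ (nvert N (g 0)) k (ip d (ptan N o (g 0))) _ _ _ _ _ _
  rn0 yn0 eqn aE dE nrE.
have rp : r.-1 = r' by rewrite rE.
rewrite rp {1 5}rE; apply: (etrans _ (congr1 ( *%R v) B)).
by rewrite expr1; ring.
Qed.

Lemma nrad_sqr p : S p -> 1 < hgt o p -> nrad N o p ^+ 2 + nvert N p ^+ 2 = 1.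
Proof. by move=> Sp y1; have [] := normal_off_axis HS HN ho rot Sp y1. Qed.

Lemma nvert_axis p : S p -> p.1 = o -> nvert N p ^+ 2 = 1.
Proof.
move=> Sp po; have N0 := normal_axis n2 HS HN ho rot Sp po.
have [_ + _] := proj2 HN _ Sp.
by rewrite /ip N0 lor0l add0r -expr2.
Qed.

Lemma nvert_continuous_chart U X a : chart S U X -> U a ->
  {for a, continuous (fun b => nvert N (X b))}.
Proof.
move=> cX Ua; have h := normal_continuous_chart HN cX Ua.
exact: (@continuous_comp _ _ _ (fun b => N (X b)) (fun z : E => z.2) a h (@cvg_snd _ _ _ _ _)).
Qed.

Lemma rad_continuous_chart U X a : chart S U X -> U a ->
  {for a, continuous (fun b => rad o (X b))}.
Proof.
move=> cX Ua.
have yd := difN (dif_lorl o (dif_fst (chart_dif cX Ua))).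
have h := dif_cont (difB (difX 2 yd) (dif_cst (1 : R) a)).
exact: (@continuous_comp _ _ _ (fun b => (- lor (X b).1 o) ^+ 2 - 1) Num.sqrt a h (@sqrt_continuous R _)).
Qed.

(** [nrad] is defined by division by [rad] and gives no direct limit at the axis, and for [r = n] no
    power of [rad] multiplies it. So [|first_integral|] is bounded by an expression [B] in [nvert]
    and [rad], continuous in the chart and 0 at the axis point, while the integral is constant off
    the axis. *)
Lemma first_integral_zero p0 p : connected S -> S p0 -> p0.1 = o -> S p -> 1 < hgt o p ->
  first_integral p = 0.
Proof.
move=> cS Sp0 p0o Sp y1; apply: contrapT => /eqP K0.
have Kp : 0 < `|first_integral p| by rewrite normr_gt0.
have Fc q : S q -> 1 < hgt o q -> first_integral q = first_integral p.
  move=> Sq yq; exact: (off_axis_const n2 HS HN ho rot cS first_integral_stationary Sq yq Sp y1).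
have [U [X [a [cX Ua XE]]]] := proj2 HS p0 Sp0.
(* The first term comes from [|nrad|^r <= |nrad| = sqrt (1 - w^2)], as [|nrad| <= 1] and
   [r >= 1]. *)
pose B (w s : R) : R := Num.sqrt (1 - w ^+ 2) * s ^+ (n - r) + n%:R * c * s ^+ n * pint n r (s ^+ 2).
have bound q : S q -> 1 < hgt o q -> `|first_integral q| <= B (nvert N q) (rad o q).
  move=> Sq yq; have u := nrad_sqr Sq yq; have s0 := ltW (rad_gt0 yq).
  have J0 := ltW (pint_gt0 n r (rad2_gtN1 q)).
  apply: le_trans (ler_normB _ _) _; apply: lerD; last first.
    by rewrite ger0_norm// mulr_ge0// mulr_ge0 ?exprn_ge0// ltW.
  rewrite normrM [`|rad o q ^+ _|]ger0_norm ?exprn_ge0// ler_wpM2r ?exprn_ge0//.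
  have -> : 1 - nvert N q ^+ 2 = nrad N o q ^+ 2 by rewrite -u addrK.
  rewrite sqrtr_sqr normrX.
  have [r' ->] : exists r', r = r'.+1 by exists r.-1; rewrite prednK//; case/andP: hr.
  have l1 : `|nrad N o q| <= 1.
    by rewrite -(@expr_le1 _ 2)// real_normK ?num_real// -u lerDl sqr_ge0.
  by rewrite exprS ler_piMr// exprn_ile1.
have Bc : {for a, continuous (fun b => B (nvert N (X b)) (rad o (X b)))}.
  have wc := nvert_continuous_chart cX Ua; have rc := rad_continuous_chart cX Ua.
  have rX m : {for a, continuous (fun b => rad o (X b) ^+ m)}.
    elim: m => [|m IH].
      have -> : (fun b => rad o (X b) ^+ 0) = (fun=> 1) by apply/funext => b; rewrite expr0.
      exact: (dif_cont (dif_cst (1 : R) a)).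
    rewrite (_ : (fun b => _) = (fun b => rad o (X b) * rad o (X b) ^+ m)); last first.
      by apply/funext => b; rewrite exprS.
    exact: cvgM rc IH.
  have h1 : {for a, continuous (fun b => 1 - nvert N (X b) ^+ 2)}.
    have wd := dif_cont (difB (dif_cst (1 : R) _) (difX 2 (dif_id (nvert N (X a))))).
    exact: (@continuous_comp _ _ _ (fun b => nvert N (X b)) (fun w : R => 1 - w ^+ 2) a wc wd).
  have h2 := @continuous_comp _ _ _ (fun b => 1 - nvert N (X b) ^+ 2) Num.sqrt a h1 (@sqrt_continuous R _).
  have [dJ /dif_is_derive/dif_cont hJ _] := pint_ode r n2 (rad2_gtN1 (X a)).
  have h3 := @continuous_comp _ _ _ (fun b => rad o (X b) ^+ 2) (pint n r) a (rX 2) hJ.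
  have cc : {for a, continuous (fun=> n%:R * c : R)} := dif_cont (dif_cst (n%:R * c) a).
  exact: (cvgD (cvgM h2 (rX (n - r)%N)) (cvgM (cvgM cc (rX n)) h3)).
have Xo : (X a).1 = o by rewrite XE.
have Ba : B (nvert N (X a)) (rad o (X a)) = 0.
  rewrite /B (nvert_axis (chart_in cX Ua) Xo) (rad_axis ho Xo) subrr sqrtr0 mul0r.
  by rewrite expr0n eqn0Ngt n0 mulr0 mul0r addr0.
have near1 : \forall b \near a, B (nvert N (X b)) (rad o (X b)) < `|first_integral p|.
  by apply: (cvgr_lt _ Bc); rewrite Ba.
have [b ba [lt [Ub /(_ ba) yb]]] := near_neq n0 (filterI near1 (axis_isolated n2 HS HN ho rot cX Ua)).
have := bound _ (chart_in cX Ub) yb.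
by rewrite (Fc _ (chart_in cX Ub) yb) leNgt lt.
Qed.

Lemma sq_radius_rad p : S p -> sq_radius o p = rad o p ^+ 2.
Proof. by move=> Sp; rewrite (rad2 HS ho Sp). Qed.

Section Zero.
Hypothesis F0 : forall p, S p -> 1 < hgt o p -> first_integral p = 0.

Lemma nrad_expr p : S p -> 1 < hgt o p ->
  nrad N o p ^+ r = (qcur n r c (sq_radius o p) * rad o p) ^+ r.
Proof.
move=> Sp y1; have s0 := rad_gt0 y1; have x1 := rad2_gtN1 p.
have /andP[r0 rn] := hr; rewrite sq_radius_rad//.
have sn0 m : rad o p ^+ m != 0 by rewrite expf_neq0// gt_eqF.
rewrite [RHS]exprMn (qcurX hr c0 x1); apply: (mulIf (sn0 (n - r)%N)).
rewrite -[RHS]mulrA -exprD subnKC//; have := F0 Sp y1; rewrite /first_integral => /eqP.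
by rewrite subr_eq0 => /eqP ->; ring.
Qed.

Let Q_gt0 p : S p -> 1 < hgt o p -> 0 < qcur n r c (sq_radius o p) * rad o p.
Proof.
by move=> Sp y1; rewrite mulr_gt0 ?rad_gt0// qcur_gt0// sq_radius_rad.
Qed.

Lemma nrad_norm p : S p -> 1 < hgt o p ->
  `|nrad N o p| = qcur n r c (sq_radius o p) * rad o p.
Proof.
move=> Sp y1; have Q0 := Q_gt0 Sp y1; have /andP[r0 rn] := hr.
apply/eqP; rewrite -(@eqrXn2 _ r)// ?(ltW Q0)//.
by rewrite -normrX nrad_expr// ger0_norm// exprn_ge0// ltW.
Qed.

Lemma nvert_hcur p : S p -> nvert N p ^+ 2 + hcur n r c (sq_radius o p) = 1.
Proof.
move=> Sp; have [y1|y1] := boolP (1 < hgt o p).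
  have hE : hcur n r c (sq_radius o p) = nrad N o p ^+ 2.
    rewrite -[RHS]real_normK ?num_real// nrad_norm// sq_radius_rad// exprMn.
    by rewrite [RHS]mulrC.
  by rewrite hE addrC nrad_sqr.
have po := hgt_axis HS ho Sp y1.
by rewrite sq_radius_rad// (rad_axis ho po) nvert_axis// expr0n/= hcur0 addr0.
Qed.

Lemma nrad_neq0 p : S p -> 1 < hgt o p -> nrad N o p != 0.
Proof.
move=> Sp y1; rewrite -normr_gt0 nrad_norm// mulr_gt0 ?rad_gt0//.
by rewrite sq_radius_rad// qcur_gt0.
Qed.

(** For even [r] the sign [e] of [s] is free. Since [e^r = 1], the curvature equation gives
    [kappa = e * kapcur]: the product [s kappa], hence the formula for [w], is the same for both
    signs, and [e] shows only in the formula for the height. *)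
Lemma profile_curve (g : R -> E) (t : R) d : is_derive t 1 g d ->
  (\forall s \near t, S (g s)) -> 1 < hgt o (g t) ->
  let p := g t in let l := ip d (ptan N o p) in let x := sq_radius o p in
  let q := qcur n r c x in
  [/\ is_derive t 1 (fun s => hgt o (g s)) (rad o p * (nvert N p * l)),
      is_derive t 1 (fun s => (g s).2) (Num.sg (nrad N o p) * (q * rad o p) * l),
      {for t, continuous (fun s => nrad N o (g s))} &
      is_derive t 1 (fun s => nvert N (g s)) (- (q * rad o p) * kapcur n r c x * l)].
Proof.
move=> gd gS y1; have Sp := nbhs_singleton gS.
have [k [eqn crv _]] := profile_at Sp y1.
have [hd td sd wd] := crv g t d gd gS erefl.
have sE := numEsg (nrad N o (g t)); have nE := nrad_norm Sp y1.
have s0 := rad_gt0 y1; have sn0 : rad o (g t) != 0 by rewrite gt_eqF.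
have x1 := rad2_gtN1 (g t); rewrite -sq_radius_rad// in x1.
have kE : nrad N o (g t) * k = qcur n r c (sq_radius o (g t)) * rad o (g t) * kapcur n r c (sq_radius o (g t)).
  have := curvature_equation n2 hr c0 x1; have := nrad_neq0 Sp y1.
  have q0 := qcur_gt0 r n2 c0 x1.
  have y0 : 0 < hgt o (g t) by exact: lt_trans ltr01 y1.
  have -> : Num.sqrt (1 + sq_radius o (g t)) = hgt o (g t) by rewrite sq_radius_rad// sqrt_rad.
  set Q := qcur _ _ _ _ in q0 nE *; set e := Num.sg _ in sE *.
  move=> s1; have ee : e * e = 1 by rewrite -expr2 sqr_sg s1.
  have er : e ^+ r = 1 by rewrite -sgrX nrad_expr// gtr0_sg// exprn_gt0// Q_gt0.
  have [r' rE] : exists r', r = r'.+1 by exists r.-1; rewrite prednK//; case/andP: hr.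
  have er' : e ^+ r' = e by rewrite -[LHS]mul1r -ee -mulrA -exprS -rE er mulr1.
  rewrite eqn sE nE.
  have -> : e * (Q * rad o (g t)) / rad o (g t) * hgt o (g t) = e * (Q * hgt o (g t)) by field.
  have rp : r.-1 = r' by rewrite rE.
  rewrite rp !exprMn er er' mul1r => /addrI H.
  have rn0 : r%:R != 0 :> R by rewrite pnatr_eq0 rE.
  have Y0 : Q ^+ r' * hgt o (g t) ^+ r' != 0 by rewrite mulf_neq0// expf_neq0// gt_eqF.
  have {}H : kapcur n r c (sq_radius o (g t)) = e * k.
    by apply: (mulfI Y0); apply: (mulfI rn0); rewrite H; ring.
  by rewrite H; ring.
split.
- by rewrite mulrA.
- by rewrite -nE -sE.
- by have /dif_is_derive/dif_cont := sd.
- apply: is_derive_eq wd _; rewrite mulNr kE; ring.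
Qed.

End Zero.

End FirstIntegral.

(** * Uniqueness of entire graphs *)

Section Congruence.
Context {R : realType} {n : nat}.
Notation E := ('rV[R]_n.+1 * R)%type.

Lemma sq_radius_isometry (A : 'M[R]_n.+1) o z (s t : R) : lor_isometry A ->
  sq_radius (o *m A) (z *m A, t) = sq_radius o (z, s).
Proof. by move=> iA; rewrite /sq_radius /hgt /= iA. Qed.

Lemma isometry_onto (A : 'M[R]_n.+1) o z : lor_isometry A -> hyp o -> hyp (o *m A) ->
  hyp z -> exists2 z', hyp z' & z' *m A = z.
Proof.
move=> iA ho hoA hz; have [uA iV] := (isometry_unit iA, isometry_inv iA).
exists (z *m invmx A); last by rewrite mulmxKV.
by apply: (isometry_hyp iV hoA) => //; rewrite mulmxK.
Qed.

Lemma congruent_shift (Q : R -> R -> Prop) (o : 'rV[R]_n.+1) (D : R) (S S' : set E) :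
  (2 <= n)%N -> hyp o ->
  S = [set p | hyp p.1 /\ Q (sq_radius base_point p) p.2] ->
  S' = [set p | hyp p.1 /\ Q (sq_radius o p) (p.2 - D)] -> congruent S S'.
Proof.
move=> n2 ho -> ->; have [A [hA iA bA]] := translation_to n2 ho.
exists A, D; split=> //; left.
have hb : hyp (base_point : 'rV[R]_n.+1) := hyp_base.
apply/seteqP; split=> [[z t] [/= hz Qz]|_ [[z t] [/= hz Qz] <-]].
  have [|z' hz' zE] := isometry_onto iA hb _ hz; first by rewrite bA.
  exists (z', t - D); last by rewrite /vtrans /htrans /= zE subrK.
  split=> //=; rewrite -(sq_radius_isometry _ _ _ t iA) bA zE; exact: Qz.
have hbA : hyp (base_point *m A) by rewrite bA.
split; first exact: isometry_hyp iA hb hbA hz.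
by rewrite /vtrans /htrans /= addrK -bA (sq_radius_isometry _ _ t _ iA).
Qed.

Lemma congruent_reflection (Q : R -> R -> Prop) (o : 'rV[R]_n.+1) (D : R) (S S' : set E) :
  (2 <= n)%N -> hyp o ->
  S = [set p | hyp p.1 /\ Q (sq_radius base_point p) p.2] ->
  S' = [set p | hyp p.1 /\ Q (sq_radius o p) (D - p.2)] -> congruent S S'.
Proof.
move=> n2 ho -> ->; have [A [hA iA bA]] := translation_to n2 ho.
exists A, 0; split=> //; right; exists (D / 2).
have hb : hyp (base_point : 'rV[R]_n.+1) := hyp_base.
have D2 : 2 * (D / 2) = D by rewrite mulrC divfK// pnatr_eq0.
apply/seteqP; split=> [[z t] [/= hz Qz]|_ [[z t] [/= hz Qz] <-]].
  have [|z' hz' zE] := isometry_onto iA hb _ hz; first by rewrite bA.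
  exists (z', D - t); last by rewrite /slice_reflection /vtrans /htrans /= zE D2 addr0 subKr.
  split=> //=; rewrite -(sq_radius_isometry _ _ _ t iA) bA zE; exact: Qz.
have hbA : hyp (base_point *m A) by rewrite bA.
split; first exact: isometry_hyp iA hb hbA hz.
by rewrite /slice_reflection /vtrans /htrans /= D2 addr0 subKr -bA (sq_radius_isometry _ _ t _ iA).
Qed.

Lemma hyp_at_radius (o : 'rV[R]_n.+1) (x t : R) : (2 <= n)%N -> hyp o -> 0 <= x ->
  exists2 z, hyp z & sq_radius o (z, t) = x.
Proof.
move=> n2 ho x0; have [A [_ iA bA]] := translation_to n2 ho.
have n0 : (0 < n)%N := ltnW n2.
have [b b1 _] := unit_direction (0 : 'rV[R]_n) n0.
have nE : normsq (Num.sqrt x *: b) = x.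
  rewrite /normsq; under eq_bigr do rewrite mxE exprMn.
  by rewrite -mulr_sumr -/(normsq b) b1 mulr1 sqr_sqrtr.
have hz : hyp (hpoint (Num.sqrt (1 + x)) (Num.sqrt x *: b)).
  by apply/hyp_hpoint; rewrite sqrtr_gt0 ltr_pwDl// nE sqr_sqrtr// addr_ge0.
have hb : hyp (base_point : 'rV[R]_n.+1) := hyp_base.
have hbA : hyp (base_point *m A) by rewrite bA.
exists (hpoint (Num.sqrt (1 + x)) (Num.sqrt x *: b) *m A).
  exact: isometry_hyp iA hb hbA hz.
rewrite -bA (sq_radius_isometry _ _ t _ iA) sq_radius_hpoint// nE sqr_sqrtr// addr_ge0//.
Qed.

Lemma rV_connected : connected [set: 'rV[R]_n].
Proof.
have -> : [set: 'rV[R]_n] = \bigcup_(a in [set: 'rV[R]_n]) ((fun t : R => t *: a) @` `[0, 1]%classic).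
  apply/seteqP; split=> // a _; exists a => //; exists 1; last by rewrite scale1r.
  by rewrite /= in_itv/= ler01 lexx.
apply: bigcup_connected => [|a _].
  by exists 0 => a _; exists 0; rewrite ?scale0r// /= in_itv/= lexx ler01.
apply: connected_continuous_connected; first exact: segment_connected.
by apply: continuous_subspaceT => t; exact: (dif_cont (dif_scalel a (dif_id t))).
Qed.

End Congruence.

Lemma sg_derive0 {R : realType} (f : R -> R) : {for (0 : R), continuous f} -> f 0 != 0 ->
  is_derive (0 : R) 1 (fun s => Num.sg (f s)) 0.
Proof.
move=> fc f0.
have h : \forall s \near (0 : R), Num.sg (f 0) = Num.sg (f s).
  case: (ltP 0 (f 0)) => fp.
    have h : \forall s \near (0 : R), 0 < f s by exact: (cvgr_gt _ fc _ fp).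
    by apply: filterS h => s sp; rewrite !gtr0_sg.
  have fn : f 0 < 0 by rewrite lt_neqAle f0.
  have h : \forall s \near (0 : R), f s < 0 by exact: (cvgr_lt _ fc _ fn).
  by apply: filterS h => s sp; rewrite !ltr0_sg.
apply/dif_is_derive; apply: dif_eq (dif_near h (dif_cst (Num.sg (f 0)) (0 : R))) _ => v.
by rewrite mulr0.
Qed.

Section Entire.
Context {R : realType} {n : nat}.
Notation E := ('rV[R]_n.+1 * R)%type.
Variables (N : E -> E) (o : 'rV[R]_n.+1) (r : nat) (c : R) (u : 'rV[R]_n.+1 -> R).
Let S : set E := [set p | hyp p.1 /\ p.2 = u p.1].
Hypotheses (n2 : (2 <= n)%N) (HS : hypersurface S) (HN : unit_normal S N).
Hypotheses (ho : hyp o)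
  (rot : forall A, rotation_about o A -> forall p, S p -> S (p.1 *m A, p.2)).
Hypotheses (hr : (1 <= r <= n)%N) (c0 : 0 < c).
Hypothesis HC : forall p, S p -> exists k,
  principal_curvatures S N p k /\ mean_curvature r k = c.
Hypothesis su : smooth_on_hyp u.

Let SH : S `<=` HxR := proj1 HS.

Lemma entire_connected : connected S.
Proof.
pose z (a : 'rV[R]_n) := hpoint (Num.sqrt (1 + normsq a)) a.
have zh a : hyp (z a).
  by apply/hyp_hpoint; rewrite sqrtr_gt0 ltr_pwDl ?normsq_ge0// sqr_sqrtr// addr_ge0// normsq_ge0.
have zC k : Ck k setT z.
  apply: (Ck_hpoint openT); first exact: (Ck_hyp_height k openT).
  by apply: Ck_linear; [exact: openT| |move=> b; exact: cvg_id].
have -> : S = (fun a => (z a, u (z a))) @` setT.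
  apply/seteqP; split=> [[x t] [/= hx ->]|_ [a _ <-]]; last by split=> //=; exact: zh.
  exists (spatial x) => //; have [_ _ zE] := @hyp_hpointE R n (x, 0) hx.
  by rewrite /z; move: zE => /= ->.
apply: connected_continuous_connected; first exact: rV_connected.
apply: continuous_subspaceT => a; have [W [g [oW Wz sg gu]]] := su (zh a).
have zd := Ck_dif1 (zC 1%N) (I : setT a).
have gd := Ck_dif1 (sg 1%N) Wz.
have nW : \forall b \near a, W (z b).
  by have zc := dif_cont zd; exact: (zc W (open_nbhs_nbhs (conj oW Wz))).
have nE : \forall b \near a, g (z b) = u (z b).
  by apply: filterS nW => b Wb; apply: gu; rewrite inE; split=> //; exact: zh.
have ud := dif_near nE (dif_comp zd gd).
exact: (dif_cont (dif_pair zd ud)).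
Qed.

Let F0 p (Sp : S p) (y1 : 1 < hgt o p) : first_integral N o r c p = 0.
Proof.
apply: (@first_integral_zero _ _ S N o r c n2 HS HN ho rot hr c0 HC (o, u o)) => //.
exact: entire_connected.
Qed.

(** Where [w = 0] the profile tangent [ptan] is vertical with speed [s != 0], while on the graph of
    a differentiable function a curve without horizontal velocity has no vertical velocity. On the
    axis [w^2 = 1]. *)
Lemma entire_nvert_neq0 p : S p -> nvert N p != 0.
Proof.
move=> Sp; have [y1|y1] := boolP (1 < hgt o p); last first.
  have po := hgt_axis HS ho Sp y1; have := nvert_axis n2 HS HN ho rot Sp po.
  by apply: contra_eq_neq => ->; rewrite expr0n/= eq_sym oner_eq0.
apply/eqP => w0; have [k [_ _ [g [gd gS g0]]]] := profile_equations n2 HS HN ho rot hr (HC Sp) Sp y1.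
have s0 := nrad_neq0 n2 HS ho hr c0 F0 Sp y1.
have [W [f [oW Wp sf fu]]] := su (SH Sp).
have gdif : dif g 0 (fun v => v *: ptan N o p) by apply/dif_curve.
have d1 := dif_fst gdif; have d2 := dif_snd gdif.
have fd : dif f (g 0).1 (fun v => 'D_v f (g 0).1).
  by rewrite g0; exact: Ck_dif1 (sf 1%N) Wp.
have nW : \forall s \near (0 : R), W (g s).1.
  have nWp : nbhs (g 0).1 W by rewrite g0; exact: open_nbhs_nbhs (conj oW Wp).
  have cc := dif_cont d1.
  exact: (cc W nWp).
have nE : \forall s \near (0 : R), f (g s).1 = (g s).2.
  by apply: filterS2 nW gS => s Ws [hs ->]; apply: fu; rewrite inE.
have := etrans (esym (dif_derive (1 : R) d2)) (dif_derive (1 : R) (dif_near nE (dif_comp d1 fd))).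
rewrite !scale1r /ptan /= w0 mul0r scale0r => sE.
have D0 : 'D_0 f (g 0).1 = 0 by have [df _] := fd; rewrite deriveE// linear0.
by move: s0; rewrite sE D0 eqxx.
Qed.

Lemma entire_radius x : 0 <= x -> exists2 p, S p & sq_radius o p = x.
Proof.
move=> x0; have [z hz zE] := hyp_at_radius 0 n2 ho x0.
by exists (z, u z).
Qed.

Let off p : S p -> 0 < sq_radius o p -> 1 < hgt o p.
Proof.
move=> Sp; have := hgt_ge1 HS ho Sp; rewrite le_eqVlt => /predU1P[E|//].
by move=> x0; exfalso; move: x0; rewrite /sq_radius -E expr1n subrr ltxx.
Qed.

(** An entire graph has points at every radius. If [c] exceeded the bound, [h] would reach 1 at some
    radius, and [w] would vanish there. *)
Lemma entire_bound : c <= (n%:R - r%:R) / n%:R.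
Proof.
rewrite leNgt; apply/negP => /(hcur_reaches1 n2 hr c0)[x x0 hx].
have [p Sp pE] := entire_radius (ltW x0).
have := nvert_hcur n2 HS HN ho rot hr c0 F0 Sp; rewrite pE hx -[RHS]add0r.
move=> /addIr/eqP; rewrite sqrf_eq0.
by rewrite (negbTE (entire_nvert_neq0 Sp)).
Qed.

(** The signs [e] of [s] and [de] of [w] are constant off the axis, and [f] compares the height with
    [e * de] times the model profile; [f] is stationary, hence constant off the axis, and on it by
    continuity. *)
Lemma entire_unique : congruent (graph_surface r c : set E) S.
Proof.
have cS := entire_connected; have hc := entire_bound.
have [p0 Sp0 p0E] := entire_radius ler01.
have y0 : 1 < hgt o p0 by apply: off => //; rewrite p0E ltr01.
pose e := Num.sg (nrad N o p0); pose de := Num.sg (nvert N p0).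
have stw : stationary S o (fun p => Num.sg (nvert N p)).
  move=> g d gd gS y1; have [_ _ _ wd] := profile_curve n2 HS HN ho rot hr c0 HC F0 gd gS y1.
  move/dif_is_derive/dif_cont : wd => wc.
  exact: (sg_derive0 wc (entire_nvert_neq0 (nbhs_singleton gS))).
have sts : stationary S o (fun p => Num.sg (nrad N o p)).
  move=> g d gd gS y1; have [_ _ sc _] := profile_curve n2 HS HN ho rot hr c0 HC F0 gd gS y1.
  exact: (sg_derive0 sc (nrad_neq0 n2 HS ho hr c0 F0 (nbhs_singleton gS) y1)).
have eE p : S p -> 1 < hgt o p -> Num.sg (nrad N o p) = e.
  by move=> Sp y1; exact: (off_axis_const n2 HS HN ho rot cS sts Sp y1 Sp0 y0).
have dE p : S p -> 1 < hgt o p -> Num.sg (nvert N p) = de.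
  by move=> Sp y1; exact: (off_axis_const n2 HS HN ho rot cS stw Sp y1 Sp0 y0).
have dd : de * de = 1 by rewrite -expr2 sqr_sg (entire_nvert_neq0 Sp0).
have ee : e * e = 1 by rewrite -expr2 sqr_sg (nrad_neq0 n2 HS ho hr c0 F0 Sp0 y0).
pose f (p : E) := p.2 - e * de * graph_profile n r c (sq_radius o p).
have lo p : S p -> - 2^-1 < sq_radius o p.
  by move=> /SH hp; apply: lt_le_trans (sq_radius_ge0 ho hp); lra.
have stf : stationary S o f.
  move=> g d gd gS y1; have Sg := nbhs_singleton gS.
  have [yd td _ _] := profile_curve n2 HS HN ho rot hr c0 HC F0 gd gS y1.
  move/dif_is_derive : yd => yd; move/dif_is_derive : td => td; apply/dif_is_derive.
  have xd := difB (difX 2 yd) (dif_cst (1 : R) (0 : R)).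
  have Ld := graph_profile_derive n2 hr c0 hc (lo _ Sg).
  apply: dif_eq (difB td (difM (dif_cst (e * de) (0 : R)) (dif_comp1 xd Ld))) _ => v.
  rewrite /slope (eE _ Sg y1).
  have hp := SH Sg; rewrite (sqrt_sq_radius ho hp).
  have wE : 1 - hcur n r c (sq_radius o (g 0)) = nvert N (g 0) ^+ 2.
    by rewrite -(nvert_hcur n2 HS HN ho rot hr c0 F0 Sg) addrK.
  have wn := entire_nvert_neq0 Sg; have wsg := normrEsg (nvert N (g 0)).
  rewrite dE// in wsg; rewrite wE sqrtr_sqr wsg.
  have yn : hgt o (g 0) != 0 by rewrite gt_eqF// (lt_trans ltr01).
  have den : de != 0 by apply: contra_eq_neq dd => ->; rewrite mulr0 eq_sym oner_eq0.
  rewrite expr1.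
  move: (nvert N _) (hgt o _) (qcur _ _ _ _) (rad _ _) (ip _ _) wn yn => w y q s l wn yn.
  by field; rewrite wn yn den.
have fc U X a : chart S U X -> U a -> {for a, continuous (fun b => f (X b))}.
  move=> cX Ua; have hX := chart_dif cX Ua.
  have Ld := graph_profile_derive n2 hr c0 hc (lo _ (chart_in cX Ua)).
  exact: (dif_cont (difB (dif_snd hX) (difM (dif_cst (e * de) a) (dif_comp1 (sq_radius_dif o hX) Ld)))).
have fk p : S p -> f p = f p0.
  apply: (axis_extend n2 HS HN ho rot fc) => {}p Sp y1.
  exact: (off_axis_const n2 HS HN ho rot cS stf Sp y1 Sp0 y0).
pose D := f p0.
have SE : S = [set p | hyp p.1 /\ p.2 = D + e * de * graph_profile n r c (sq_radius o p)].
  apply/seteqP; split=> [p Sp|[z t] [/= hz tE]].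
    by split; [exact: SH|rewrite /D -(fk _ Sp) /f subrK].
  split=> //=; have Sz : S (z, u z) by [].
  have DE : D = u z - e * de * graph_profile n r c (sq_radius o (z, u z)) := esym (fk _ Sz).
  by rewrite tE DE; exact: subrK.
pose Q (x t : R) := t = graph_profile n r c x.
(* The two values of [e * de] correspond to a translate of the model and to a reflected one. *)
have /eqP : (e * de) ^+ 2 = 1 by rewrite exprMn !expr2 ee dd mulr1.
rewrite sqrf_eq1 => /orP[] /eqP ed.
  apply: (@congruent_shift _ _ Q o D) => //; rewrite SE ed /Q.
  apply/seteqP; split=> p [hp pE]; split=> //; first by rewrite pE mul1r addrC addKr.
  by rewrite mul1r -pE addrC subrK.
apply: (@congruent_reflection _ _ Q o D) => //; rewrite SE ed /Q.
apply/seteqP; split=> p [hp pE]; split=> //; first by rewrite pE mulN1r opprB addrC subrK.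
by rewrite mulN1r -pE subKr.
Qed.

End Entire.

(** * Compact hypersurfaces *)

Lemma max_derive0 {R : realType} (f : R -> R) (d : R) : is_derive (0 : R) 1 f d ->
  (\forall s \near (0 : R), f s <= f 0) -> d = 0.
Proof.
move=> /dif_is_derive fd fm; apply: contrapT => /eqP d0.
have dp : 0 < `|d| by rewrite normr_gt0.
have e0 : 0 < `|d| / 2 by rewrite divr_gt0.
have h := dif_eps fd e0.
have [e /= ep he] := proj1 (nbhs_ballP _ _) (filterI h fm).
pose s := Num.sg d * (e / 2).
have sE : `|s| = e / 2 by rewrite normrM normr_sg d0 mul1r gtr0_norm// divr_gt0.
have [|h1 h2] := he s.
  by rewrite -ball_normE /= sub0r normrN sE ltr_pdivrMr// ltr_pMr// ltr1n.
move: h1; rewrite subr0 sE.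
have -> : s * d = `|d| * (e / 2) by rewrite /s [in RHS]normrEsg; ring.
move=> h1; have : `|d| * (e / 2) <= `|d| / 2 * (e / 2).
  apply: le_trans h1; rewrite -normrN opprB; apply: le_trans (ler_norm _).
  by rewrite lerDl oppr_ge0 subr_le0.
by rewrite ler_pM2r ?divr_gt0// ler_pdivlMr// ger_pMr// lern1.
Qed.

Section Compact.
Context {R : realType} {n : nat}.
Notation E := ('rV[R]_n.+1 * R)%type.
Variables (S : set E) (N : E -> E) (o : 'rV[R]_n.+1) (r : nat) (c : R).
Hypotheses (n2 : (2 <= n)%N) (HS : hypersurface S) (HN : unit_normal S N).
Hypotheses (ho : hyp o)
  (rot : forall A, rotation_about o A -> forall p, S p -> S (p.1 *m A, p.2)).
Hypotheses (hr : (1 <= r <= n)%N) (c0 : 0 < c).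
Hypothesis HC : forall p, S p -> exists k,
  principal_curvatures S N p k /\ mean_curvature r k = c.
Hypotheses (cptS : compact S) (cS : connected S) (S0 : S !=set0).

Let SH : S `<=` HxR := proj1 HS.
Let n0 : (0 < n)%N := ltnW n2.

(** Charts are homeomorphisms onto open subsets of [S], so continuity for the subspace topology can
    be tested in them. *)
Lemma within_continuous_charts (f : E -> R) :
  (forall U X a, chart S U X -> U a -> {for a, continuous (fun b => f (X b))}) ->
  {within S, continuous f}.
Proof.
move=> fc; apply/subspace_continuousP => p Sp A nA.
have [U [X [a [cX Ua XE]]]] := proj2 HS p Sp.
have nA' : nbhs (f (X a)) A by rewrite XE.
have h1 : \forall b \near a, A (f (X b)) := fc U X a cX Ua A nA'.
have [e e0 he] := proj1 (nbhs_ballP _ _) (filterI h1 (chart_near cX Ua)).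
have [_ _ _ _ img] := cX.
have oB : open (ball a e) by exact: ball_open.
have BU : ball a e `<=` U by move=> b /he[].
have [W [oW WE]] := img _ oB BU.
have Wp : W p.
  have : (X @` ball a e) p by exists a => //; exact: ballxx.
  by rewrite WE => -[].
have nW : \forall q \near p, W q by exact: open_nbhs_nbhs (conj oW Wp).
apply: filterS nW => q Wq Sq.
have [b Bb <-] : (X @` ball a e) q by rewrite WE.
by have [] := he b Bb.
Qed.

Lemma chart_max (f : E -> R) :
  (forall U X a, chart S U X -> U a -> {for a, continuous (fun b => f (X b))}) ->
  exists2 p, S p & forall q, S q -> f q <= f p.
Proof.
move=> /within_continuous_charts fc.
have [p pS pm] := compact_EVT_max S0 cptS fc.
by exists p; [move: pS; rewrite inE|move=> q Sq; apply: pm; rewrite inE].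
Qed.

Lemma tangent_curve p : S p -> 1 < hgt o p -> exists g : R -> E,
  [/\ is_derive (0 : R) 1 g (ptan N o p), \forall s \near (0 : R), S (g s), g 0 = p &
   ip (ptan N o p) (ptan N o p) = 1].
Proof.
move=> Sp y1; have [k [_ _ [g [gd gS g0]]]] := profile_equations n2 HS HN ho rot hr (HC Sp) Sp y1.
exists g; split=> //; have [U [X [a [cX Ua XE]]]] := proj2 HS p Sp.
by rewrite -XE; apply: (ptan_unit HS HN ho rot cX Ua); rewrite XE.
Qed.

Lemma critical_point (f : E -> R) p (g : R -> E) d : (forall q, S q -> f q <= f p) ->
  (\forall s \near (0 : R), S (g s)) -> g 0 = p ->
  is_derive (0 : R) 1 (fun s => f (g s)) d -> d = 0.
Proof.
move=> fm gS g0 fd; apply: (max_derive0 fd).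
by apply: filterS gS => s Sg; rewrite g0; exact: fm.
Qed.

Section AwayFromAxis.
Hypothesis off : forall p, S p -> 1 < hgt o p.

Let hgt_c U X a : chart S U X -> U a -> {for a, continuous (fun b => hgt o (X b))}.
Proof.
by move=> cX Ua; exact: (dif_cont (difN (dif_lorl o (dif_fst (chart_dif cX Ua))))).
Qed.

Let invrad_c U X a : chart S U X -> U a -> {for a, continuous (fun b => (rad o (X b))^-1)}.
Proof.
move=> cX Ua; have r0 := rad_gt0 (off (chart_in cX Ua)).
have rn : rad o (X a) != 0 by rewrite gt_eqF.
have vc : {for rad o (X a), continuous (fun x : R => x^-1)}.
  by exact: inv_continuous.
have rc : {for a, continuous (fun b => rad o (X b))}.
  by exact: (rad_continuous_chart cX Ua).
exact: (@continuous_comp _ _ _ (fun b => rad o (X b)) (fun x : R => x^-1) a rc vc).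
Qed.

Let nrad_c U X a : chart S U X -> U a -> {for a, continuous (fun b => nrad N o (X b))}.
Proof.
move=> cX Ua; have Nc := normal_continuous_chart HN cX Ua.
have ld := dif_cont (dif_lorl o (dif_fst (dif_id (N (X a))))).
have lc := @continuous_comp _ _ _ (fun b => N (X b)) (fun z : E => lor z.1 o) a Nc ld.
exact: (cvgM lc (invrad_c cX Ua)).
Qed.

Let height_c U X a : chart S U X -> U a -> {for a, continuous (fun b => (X b).2)}.
Proof. by move=> cX Ua; exact: (dif_cont (dif_snd (chart_dif cX Ua))). Qed.

(* If r > 1, then s = 0 at a highest point, and the curvature equation reads 0 = n c.
   If r = 1, then the derivative of w + n c t + e s w along the profile is
   (n - 1) coth(rho) s^2 + e (1 - 2 s^2) kappa, which is positive for small e > 0. *)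
Lemma away_from_axis_false : False.
Proof.
have [r1|r1] := boolP (1 < r)%N.
  have [p Sp pm] := chart_max height_c.
  have [k [eqn crv [g [gd gS g0]]]] := profile_equations n2 HS HN ho rot hr (HC Sp) Sp (off Sp).
  have [g' [_ _ _ TT]] := tangent_curve Sp (off Sp).
  have [_ td _ _] := crv g 0 _ gd gS g0.
  have := critical_point pm gS g0 td; rewrite TT mulr1 => s0.
  move: eqn; rewrite s0 !mul0r !expr0n.
  have -> : (r == 0)%N = false by move: r1; case: r.
  have -> : (r.-1 == 0)%N = false by move: r1; case: r => [|[]].
  rewrite mul0r !mulr0 addr0 => /eqP.
  by rewrite mulf_eq0 pnatr_eq0 -leqn0 leqNgt n0 gt_eqF.
have rE : r = 1%N by case/andP: hr => h1 _; apply/eqP; rewrite eqn_leq h1 leqNgt r1.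
pose B := n%:R * c; have B0 : 0 < B by rewrite mulr_gt0// ltr0n.
have [p1 Sp1 m1] : exists2 p, S p & forall q, S q -> hgt o q / rad o q <= hgt o p / rad o p.
  apply: (chart_max (f := fun p => hgt o p / rad o p)) => U X a cX Ua.
  exact: (cvgM (hgt_c cX Ua) (invrad_c cX Ua)).
pose A1 := (n%:R - 1) * (hgt o p1 / rad o p1).
(* The first bound gives [2 ep B <= 1/2], absorbed by [A / 2] as [A >= 1]; the second gives
   [ep A < B]. The maximum [A1] of [A] over the compact surface makes the choice independent of the
   point. *)
pose ep := Num.min (4 * B)^-1 (B / (A1 + 1)).
pose f (p : E) := nvert N p + B * p.2 + ep * (nrad N o p * nvert N p).
have [p Sp pm] : exists2 p, S p & forall q, S q -> f q <= f p.
  apply: chart_max => U X a cX Ua.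
  have wc := nvert_continuous_chart HN cX Ua.
  have Bc : {for a, continuous (fun=> B : R)} := dif_cont (dif_cst B a).
  have ec : {for a, continuous (fun=> ep : R)} := dif_cont (dif_cst ep a).
  exact: (cvgD (cvgD wc (cvgM Bc (height_c cX Ua))) (cvgM ec (cvgM (nrad_c cX Ua) wc))).
have [k [eqn crv [g [gd gS g0]]]] := profile_equations n2 HS HN ho rot hr (HC Sp) Sp (off Sp).
have [g' [_ _ _ TT]] := tangent_curve Sp (off Sp).
have [_ /dif_is_derive td /dif_is_derive sd /dif_is_derive wd] := crv g 0 _ gd gS g0.
have fd : is_derive (0 : R) 1 (fun s => f (g s))
   (- nrad N o p * k + B * nrad N o p + ep * (nvert N p ^+ 2 * k - nrad N o p ^+ 2 * k)).
  apply/dif_is_derive; apply: dif_eq (difD (difD wd (difM (dif_cst B (0 : R)) td))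
    (difM (dif_cst ep (0 : R)) (difM sd wd))) _ => v.
  by rewrite TT g0; ring.
have := critical_point pm gS g0 fd.
have u := nrad_sqr HS HN ho rot Sp (off Sp).
have r0 := rad_gt0 (off Sp).
have y0 : 0 < hgt o p by exact: lt_trans ltr01 (off Sp).
pose A := (n%:R - 1) * (hgt o p / rad o p).
have n1R : 1 <= n%:R - 1 :> R by rewrite lerBrDr -(natrD _ 1 1) ler_nat.
have kE : k = B - A * nrad N o p.
  by rewrite /B eqn rE expr1 /= expr0 /A; field; rewrite gt_eqF.
have Age1 : 1 <= A.
  rewrite /A -[leLHS]mulr1; apply: ler_pM => //.
  rewrite ler_pdivlMr// mul1r -(@ler_pXn2r _ 2)// ?nnegrE ?ltW// (rad2 HS ho Sp).
  by rewrite gtrBl.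
have AA1 : A <= A1 by apply: ler_wpM2l; [exact: le_trans ler01 n1R|exact: m1].
have ep0 : 0 < ep by rewrite lt_min invr_gt0 mulr_gt0//= divr_gt0//; lra.
have ep1 : ep * (4 * B) <= 1.
  have B4 : 0 < 4 * B by rewrite mulr_gt0.
  have e1 : ep <= (4 * B)^-1 by rewrite /ep ge_min lexx.
  by apply: le_trans (ler_wpM2r (ltW B4) e1) _; rewrite mulVf// gt_eqF.
have ep2 : ep * (A1 + 1) <= B.
  by rewrite -ler_pdivlMr ?/ep ?ge_min ?lexx ?orbT//; lra.
have wE : nvert N p ^+ 2 = 1 - nrad N o p ^+ 2 by lra.
have s1 : nrad N o p ^+ 2 <= 1 by rewrite -u lerDl sqr_ge0.
rewrite wE kE; apply/eqP; rewrite gt_eqF//.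
move: (nrad N o p) s1 => s s1; pose t := `|s|.
have tt : t ^+ 2 = s ^+ 2 by rewrite real_normK ?num_real.
have hz : s * (1 - 2 * s ^+ 2) <= t.
  apply: le_trans (ler_norm _) _; rewrite normrM ler_piMr// ler_norml.
  by move: (sqr_ge0 s) s1; move: (s ^+ 2) => z *; apply/andP; split; lra.
have A0 : 0 < A by exact: lt_le_trans Age1.
have e1 : 0 <= A / 2 * (t - ep) ^+ 2 by rewrite mulr_ge0 ?sqr_ge0// divr_ge0// ltW.
have e2 : 0 <= (A / 2 - 2 * ep * B) * t ^+ 2.
  rewrite mulr_ge0 ?sqr_ge0//; move: ep1 Age1; have -> : ep * (4 * B) = 2 * (2 * ep * B) by ring.
  by move: (2 * ep * B) (A) => z1 z2 *; lra.
have e3 : 0 < ep * (B - ep * A / 2).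
  rewrite mulr_gt0//; have h1 : ep * A <= ep * A1 by exact: (ler_wpM2l (ltW ep0) AA1).
  move: (ep2) (ep0) (h1); rewrite mulrDr mulr1; have : 0 < ep * A by exact: (mulr_gt0 ep0 A0).
  by move: (ep * A1) (ep * A) => z1 z2 *; lra.
have e4 : 0 <= ep * A * (t - s * (1 - 2 * s ^+ 2)).
  by rewrite mulr_ge0 ?subr_ge0// ltW// mulr_gt0.
have := addr_ge0 e1 e2; have := ltr_wpDl e4 e3.
(* The derivative of [f] along the profile is the sum of the quantities [e1] to [e4], of which [e3]
   is positive. *)
have -> : - s * (B - A * s) + B * s + ep * ((1 - s ^+ 2) * (B - A * s) - s ^+ 2 * (B - A * s)) =
  ep * A * (t - s * (1 - 2 * s ^+ 2)) + ep * (B - ep * A / 2) + (A / 2 * (t - ep) ^+ 2 + (A / 2 - 2 * ep * B) * t ^+ 2).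
  have -> : (t - ep) ^+ 2 = s ^+ 2 - 2 * t * ep + ep ^+ 2 by rewrite -tt; ring.
  by rewrite tt; field.
by move=> h1 h2; exact: ltr_wpDr h2 h1.
Qed.

End AwayFromAxis.

Lemma compact_touches_axis : exists2 p, S p & p.1 = o.
Proof.
apply: contrapT => H; apply: away_from_axis_false => p Sp.
have [//|/(hgt_axis HS ho Sp) po] := boolP (1 < hgt o p).
by case: H; exists p.
Qed.

Let F0 p (Sp : S p) (y1 : 1 < hgt o p) : first_integral N o r c p = 0.
Proof.
have [p0 Sp0 p0o] := compact_touches_axis.
exact: (first_integral_zero n2 HS HN ho rot hr c0 HC cS Sp0 p0o Sp y1).
Qed.

Lemma off_axis_point : exists2 p, S p & 1 < hgt o p.
Proof.
have [p Sp] := S0.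
have [q [Sq _ yq]] := off_axis_dense n2 HS HN ho rot Sp openT I.
by exists q.
Qed.

Let nvert_sqr p : S p -> nvert N p ^+ 2 = 1 - hcur n r c (sq_radius o p).
Proof. by move=> Sp; rewrite -(nvert_hcur n2 HS HN ho rot hr c0 F0 Sp) addrK. Qed.

Let off_radius p : S p -> 1 < hgt o p -> 0 < sq_radius o p.
Proof. by move=> Sp y1; rewrite (sq_radius_rad HS ho Sp) exprn_gt0// rad_gt0. Qed.

(** At an off-axis maximum of [de * w] the derivative of [w] along the profile would be
    [- q rad kappa], which is not 0. So the maximum lies on the axis, where [w] is 1 or -1; the
    wrong sign is excluded because [|w| < 1] off the axis. *)
Lemma nvert_extreme (de : R) : de = 1 \/ de = -1 -> exists2 p, S p & nvert N p = de.
Proof.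
move=> hde; have dd : de * de = 1 by case: hde => ->; rewrite ?mulr1// mulrNN mulr1.
have [p Sp pm] : exists2 p, S p & forall q, S q -> de * nvert N q <= de * nvert N p.
  apply: (chart_max (f := fun p => de * nvert N p)) => U X a cX Ua.
  have dc : {for a, continuous (fun=> de : R)} := dif_cont (dif_cst de a).
  exact: (cvgM dc (nvert_continuous_chart HN cX Ua)).
exists p => //.
have [y1|y1] := boolP (1 < hgt o p).
  have [g [gd gS g0 TT]] := tangent_curve Sp y1.
  have yg : 1 < hgt o (g 0) by rewrite g0.
  have [_ _ _ /dif_is_derive wd] := profile_curve n2 HS HN ho rot hr c0 HC F0 gd gS yg.
  have fd : is_derive (0 : R) 1 (fun s => de * nvert N (g s))
     (de * (- (qcur n r c (sq_radius o p) * rad o p) * kapcur n r c (sq_radius o p))).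
    apply/dif_is_derive; apply: dif_eq (difM (dif_cst de (0 : R)) wd) _ => v.
    by rewrite g0 TT; ring.
  have := critical_point pm gS g0 fd => /eqP.
  have x1 := sq_radius_gtN1 ho (SH Sp).
  have K0 : - (qcur n r c (sq_radius o p) * rad o p) * kapcur n r c (sq_radius o p) != 0.
    rewrite mulNr oppr_eq0 gt_eqF//.
    exact: (mulr_gt0 (mulr_gt0 (qcur_gt0 r n2 c0 x1) (rad_gt0 y1)) (kapcur_gt0 r n2 c0 x1)).
  move: K0; set K := (X in X != 0) => K0; rewrite mulf_eq0 (negbTE K0) orbF => /eqP d0.
  by move: dd; rewrite d0 mul0r => /esym/eqP; rewrite oner_eq0.
have po := hgt_axis HS ho Sp y1.
have w2 := nvert_axis n2 HS HN ho rot Sp po.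
have : (de * nvert N p) ^+ 2 = 1 by rewrite exprMn w2 mulr1 expr2.
move/eqP; rewrite sqrf_eq1 => /orP[/eqP h|/eqP h].
  by rewrite -[LHS]mul1r -dd -mulrA h mulr1.
exfalso; have [q Sq yq] := off_axis_point.
have h1 := pm q Sq; rewrite h in h1.
have hq := nvert_sqr Sq.
have h0 : 0 < hcur n r c (sq_radius o q).
  rewrite -(hcur0 n r c); apply: hcur_incr => //; exact: off_radius.
have : (de * nvert N q) ^+ 2 < 1.
  by rewrite exprMn [de ^+ 2]expr2 dd mul1r hq gtrBl.
rewrite ltNge => /negP; apply.
by move: (de * nvert N q) h1 => z h1; nra.
Qed.

Lemma nvert_onto (v : R) : -1 <= v <= 1 -> exists2 p, S p & nvert N p = v.
Proof.
move=> /andP[v1 v2].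
have wc : {within S, continuous (nvert N)}.
  by apply: within_continuous_charts => U X a cX Ua; exact: (nvert_continuous_chart HN cX Ua).
have := proj1 (connected_intervalP _) (connected_continuous_connected cS wc).
have [p Sp pE] := nvert_extreme (or_introl erefl).
have [q Sq qE] := nvert_extreme (or_intror erefl).
move=> H; have := H (-1) 1 _ _ v.
case; [by exists q|by exists p|by rewrite v1 v2|].
by move=> z Sz zE; exists z.
Qed.

(** By connectedness [w] vanishes somewhere, so [h = 1] there, which [hcur_lt1] excludes for small
    [c]. *)
Lemma compact_bound : (n%:R - r%:R) / n%:R < c.
Proof.
rewrite ltNge; apply/negP => hc.
have [|p Sp p0] := @nvert_onto 0; first by rewrite lerN10 ler01.
have := nvert_sqr Sp; rewrite p0 expr0n/= => /eqP; rewrite eq_sym subr_eq0 => /eqP h1.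
have := hcur_lt1 n2 hr c0 hc (sq_radius_gtN1 ho (SH Sp)).
by rewrite -h1 ltxx.
Qed.

(** [t + P (e w)] is stationary, so [S] lies in a vertical translate of the model centred at [o];
    the sign [e] is absorbed into the parameter of the model, so a translation suffices. *)
Lemma compact_unique xs : 0 < xs -> hcur n r c xs = 1 ->
  congruent (compact_surface r c xs : set E) S.
Proof.
move=> xs0 hxs; have [p0 Sp0 y0] := off_axis_point.
pose e := Num.sg (nrad N o p0).
have sts : stationary S o (fun p => Num.sg (nrad N o p)).
  move=> g d gd gS y1; have [_ _ sc _] := profile_curve n2 HS HN ho rot hr c0 HC F0 gd gS y1.
  exact: (sg_derive0 sc (nrad_neq0 n2 HS ho hr c0 F0 (nbhs_singleton gS) y1)).
have eE p : S p -> 1 < hgt o p -> Num.sg (nrad N o p) = e.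
  by move=> Sp y1; exact: (off_axis_const n2 HS HN ho rot cS sts Sp y1 Sp0 y0).
have ee : e * e = 1 by rewrite -expr2 sqr_sg (nrad_neq0 n2 HS ho hr c0 F0 Sp0 y0).
pose P := height_of n r c xs.
have ew2 p : S p -> (e * nvert N p) ^+ 2 = 1 - hcur n r c (sq_radius o p).
  by move=> Sp; rewrite exprMn [e ^+ 2]expr2 ee mul1r nvert_sqr.
have h0 p : S p -> 0 <= hcur n r c (sq_radius o p).
  by move=> /SH hp; apply: (hcur_ge0 n2 hr c0); exact: sq_radius_ge0.
have h1 p : S p -> hcur n r c (sq_radius o p) <= 1.
  by move=> Sp; rewrite -subr_ge0 -ew2// sqr_ge0.
have sq1 (w : R) : w ^+ 2 <= 1 -> -1 <= w <= 1.
  by rewrite -real_normK ?num_real// expr_le1// ler_norml.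
have ew p : S p -> -1 <= e * nvert N p <= 1.
  by move=> Sp; apply: sq1; rewrite ew2// lerBlDr lerDl h0.
have chiE p : S p -> chi n r c xs (1 - (e * nvert N p) ^+ 2) = sq_radius o p.
  move=> Sp; rewrite ew2// subKr (chiK n2 hr c0 xs0 hxs)// ?h1//.
  exact: (sq_radius_ge0 ho (SH Sp)).
have Pd p (Sp : S p) := height_of_derive n2 hr c0 xs0 hxs (wmax_le n2 hr c0 (ew p Sp)).
pose f (p : E) := p.2 + P (e * nvert N p).
have stf : stationary S o f.
  move=> g d gd gS y1; have Sg := nbhs_singleton gS.
  have [_ /dif_is_derive td _ /dif_is_derive wd] := profile_curve n2 HS HN ho rot hr c0 HC F0 gd gS y1.
  apply/dif_is_derive.
  apply: dif_eq (difD td (dif_comp1 (difM (dif_cst e (0 : R)) wd) (Pd _ Sg))) _ => v.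
  rewrite chiE// (eE _ Sg y1).
  have k0 : kapcur n r c (sq_radius o (g 0)) != 0.
    by rewrite gt_eqF// kapcur_gt0// (sq_radius_gtN1 ho (SH Sg)).
  by field.
have fc U X a : chart S U X -> U a -> {for a, continuous (fun b => f (X b))}.
  move=> cX Ua; have Sp := chart_in cX Ua.
  have ec : {for a, continuous (fun=> e : R)} := dif_cont (dif_cst e a).
  have wc : {for a, continuous (fun b => e * nvert N (X b))}.
    by exact: (cvgM ec (nvert_continuous_chart HN cX Ua)).
  have /dif_is_derive/dif_cont pc := Pd _ Sp.
  have Pc := @continuous_comp _ _ _ (fun b => e * nvert N (X b)) P a wc pc.
  exact: (cvgD (dif_cont (dif_snd (chart_dif cX Ua))) Pc).
have fk p : S p -> f p = f p0.
  apply: (axis_extend n2 HS HN ho rot fc) => {}p Sp y1.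
  exact: (off_axis_const n2 HS HN ho rot cS stf Sp y1 Sp0 y0).
pose Q (x t : R) := exists w, w ^+ 2 + hcur n r c x = 1 /\ t = - P w.
apply: (@congruent_shift _ _ Q o (f p0)) => //.
apply/seteqP; split=> [p Sp|[z t] [/= hz [w [w2 tE]]]].
  split; first exact: SH.
  exists (e * nvert N p); rewrite ew2// subrK; split=> //.
  by rewrite -(fk _ Sp) /f opprD addrA subrr sub0r.
have x0 := @sq_radius_ge0 _ _ o ho (z, t) hz.
have w1 : -1 <= w <= 1.
  by apply: sq1; rewrite -w2 lerDl (hcur_ge0 n2 hr c0).
have ew1 : -1 <= e * w <= 1.
  by apply: sq1; rewrite exprMn [e ^+ 2]expr2 ee mul1r -w2 lerDl (hcur_ge0 n2 hr c0).
(* For the reverse inclusion: the point of [S] with the matching [w] has the same radius and height,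
   and a rotation about [o] carries it to the given point. *)
have [p Sp pE] := nvert_onto ew1.
have pw : e * nvert N p = w by rewrite pE mulrA ee mul1r.
have xE : sq_radius o p = sq_radius o (z, t).
  rewrite -chiE// pw -(chiK n2 hr c0 xs0 hxs x0); last by rewrite -w2 lerDr sqr_ge0.
  by congr chi; rewrite -w2 addrC addKr.
have yE : lor p.1 o = lor z o.
  have yp := hgt_hyp ho (SH Sp); have yz := @hgt_hyp _ _ o ho (z, t) hz.
  have : hgt o p = hgt o (z, t).
    rewrite -(sqrt_sq_radius ho (SH Sp)) xE.
    exact: (@sqrt_sq_radius _ _ o ho (z, t) hz).
  by rewrite /hgt /= => /oppr_inj.
have [A rA zE] := rotation_transitive n2 ho (SH Sp) hz yE.
have := rot rA Sp; rewrite zE.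
suff -> : t = p.2 by [].
have fE : p.2 + P w = f p0 by rewrite -(fk _ Sp) /f pw.
by move: tE; rewrite -fE => /eqP; rewrite subr_eq addrC addrK => /eqP.
Qed.

End Compact.

Theorem theorem5p6 (R : realType) (n r : nat)
    (hn : (2 <= n)%N) (hr : (1 <= r <= n)%N) :
  [/\ (* (i) *)
      forall c : R, 0 < c -> c <= (n%:R - r%:R) / n%:R ->
        exists (S : set ('rV[R]_n.+1 * R)) (N : 'rV[R]_n.+1 * R -> 'rV[R]_n.+1 * R),
          [/\ entire_rotational_Hr_graph r c S N,
              strictly_convex S N
            & forall S' N', entire_rotational_Hr_graph r c S' N' ->
                congruent S S'],
      (* (ii) *)
      forall c : R, (n%:R - r%:R) / n%:R < c ->
        exists (S : set ('rV[R]_n.+1 * R)) (N : 'rV[R]_n.+1 * R -> 'rV[R]_n.+1 * R),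
          [/\ compact_rotational_Hr_hypersurface r c S N,
              strictly_convex S N
            & forall S' N', compact_rotational_Hr_hypersurface r c S' N' ->
                congruent S S'],
      forall c : R, 0 < c ->
        forall (S : set ('rV[R]_n.+1 * R)) (N : 'rV[R]_n.+1 * R -> 'rV[R]_n.+1 * R),
          compact_rotational_Hr_hypersurface r c S N ->
          (n%:R - r%:R) / n%:R < c
    & forall c : R, 0 < c ->
        forall (S : set ('rV[R]_n.+1 * R)) (N : 'rV[R]_n.+1 * R -> 'rV[R]_n.+1 * R),
          entire_rotational_Hr_graph r c S N ->
          0 < c /\ c <= (n%:R - r%:R) / n%:R].
Proof.
split.
- move=> c c0 hc; exists (graph_surface r c), (graph_normal r c).
  have [h1 h2] := graph_model hn hr c0 hc.
  split; [exact: h1|exact: h2|move=> S' N' [[HS HN HC] [u [su Su]] [ctr [ho rot]]]].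
  subst S'; exact: (entire_unique hn HS HN ho rot hr c0 HC su).
- move=> c hc; have c0 : 0 < c.
    by apply: le_lt_trans hc; rewrite divr_ge0 ?ler0n// subr_ge0 ler_nat; case/andP: hr.
  have [xs xs0 hxs] := hcur_reaches1 hn hr c0 hc.
  have [h1 h2] := compact_model hn hr c0 xs0 hxs.
  exists (compact_surface r c xs), (compact_normal r c xs).
  split; [exact: h1|exact: h2|move=> S' N' [[HS HN HC] cptS cS S0 [ctr [ho rot]]]].
  exact: (compact_unique hn HS HN ho rot hr c0 HC cptS cS S0 xs0 hxs).
- move=> c c0 S N [[HS HN HC] cptS cS S0 [ctr [ho rot]]].
  exact: (compact_bound hn HS HN ho rot hr c0 HC cptS cS S0).
- move=> c c0 S N [[HS HN HC] [u [su Su]] [ctr [ho rot]]]; split; first exact: c0.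
  subst S; exact: (entire_bound hn HS HN ho rot hr c0 HC su).
Qed.
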